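(* Let $L/K$ be a finite separable extension. Then the jumps of the torus $\mathrm{Res}_{L/K}\mathbf{G}_m$ are $$0, \frac{1}{[L:K]},\dots,\frac{[L:K]-1}{[L:K]}.$$ In particular, $$c_{tame}(\mathrm{Res}_{L/K}\mathbf{G}_m)=\frac{[L:K]-1}{2}.$$
   Context: $K$ is a complete discretely valued field whose ring of integers $\mathcal{O}_K$ is strictly Henselian, with algebraically closed residue field $k$ of characteristic $p>0$. For a positive integer $d$ prime to $p$, $K(d)$ denotes the unique extension of $K$ of degree $d$, $\mathcal{O}_{K(d)}$ its ring of integers and $\mathfrak{m}_d$ the maximal ideal of $\mathcal{O}_{K(d)}$. A Néron lft-model is a smooth separated model, locally of finite type, satisfying the Néron mapping property. Let $B$ be a semiabelian variety over $K$ of dimension $g$ (tori are included), let $\mathscr{B}$ be its Néron lft-model over $\mathcal{O}_K$, and let $\mathscr{B}(d)$ be the Néron lft-model of $B\times_K \mathrm{Spec}\, K(d)$ over $\mathcal{O}_{K(d)}$. The canonical base change morphism induces $\psi_d\colon \mathrm{Lie}(\mathscr{B})\otimes_{\mathcal{O}_K}\mathcal{O}_{K(d)}\to \mathrm{Lie}(\mathscr{B}(d))$, and $\mathrm{coker}\,\psi_d\cong\bigoplus_{i=1}^g \mathcal{O}_{K(d)}/\mathfrak{m}_d^{j_{d,i}}$ for unique integers $0\le j_{d,1}\leq\dots\leq j_{d,g}$, called the $d$-jumps of $B$. Choose a tower $K\subseteq K(d_1)\subseteq K(d_2)\subseteq\cdots$ of finite tame extensions which is cofinal in the set of all finite tame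 extensions of $K$. The jumps of $B$ are the real numbers $j_i:=\lim_{n\to\infty} j_{d_n,i}/d_n$ for $i=1,\dots,g$ (the limits exist and are independent of the tower). The tame base change conductor of $B$ is $c_{tame}(B):=\sum_{i=1}^g j_i$. *)

(* Defs.v *)
From HB Require Import structures.
From mathcomp Require Import all_boot all_order all_algebra all_field.
From mathcomp Require Import classical_sets reals topology normedtype sequences.
From mathcomp Require mpoly.

(* [mpoly] is used through qualified names only: importing it clashes with the
   notations of [sequences] and its dependencies. *)

Set Implicit Arguments.
Unset Strict Implicit.
Unset Printing Implicit Defensive.

Import Order.TTheory GRing.Theory Num.Theory.
Import numFieldNormedType.Exports.

Local Open Scope ring_scope.

(* A normalized discrete valuation; its value at 0 is irrelevant, "v 0 = +oo"
   is taken care of by [vge]. *)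
Record dvaluation (K : fieldType) := DValuation {
  dval :> K -> int;
  dvalM : forall x y, x != 0 -> y != 0 -> dval (x * y) = dval x + dval y;
  dvalD : forall x y, x != 0 -> y != 0 -> x + y != 0 ->
    Num.min (dval x) (dval y) <= dval (x + y);
  dval_uniformizer : exists2 x, x != 0 & dval x = 1 }.

Definition vge (K : fieldType) (v : dvaluation K) (n : int) (x : K) : bool :=
  (x == 0) || (n <= v x).

Section IntegerRing.
Variables (K : fieldType) (v : dvaluation K).

Definition integral : {pred K} := vge v 0.

Lemma dval1 : v 1 = 0.
Proof.
have := dvalM v (oner_neq0 K) (oner_neq0 K).
by rewrite mulr1 => /eqP; rewrite -subr_eq subrr eq_sym => /eqP.
Qed.

Lemma dvalN x : v (- x) = v x.
Proof.
have N1 : -1 != 0 :> K by rewrite oppr_eq0 oner_eq0.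
have vN1 : v (-1) = 0.
  have := dvalM v N1 N1; rewrite mulrNN mulr1 dval1 => /esym/eqP.
  by rewrite -mulr2n mulrn_eq0 => /eqP.
have [->|x0] := eqVneq x 0; first by rewrite oppr0.
by rewrite -mulN1r dvalM// vN1 add0r.
Qed.

Fact integral_subring : subring_closed integral.
Proof.
split=> [|x y|x y]; rewrite !unfold_in /integral /vge.
- by rewrite dval1 lexx orbT.
- have [->|x0] := eqVneq x 0; first by rewrite sub0r oppr_eq0 dvalN.
  have [->|y0] := eqVneq y 0; first by rewrite subr0 (negbTE x0).
  have [//|xy0 /= vx vy] := eqVneq (x - y) 0.
  apply: le_trans (dvalD v x0 _ xy0); last by rewrite oppr_eq0.
  by rewrite dvalN le_min vx vy.
- have [->|x0] := eqVneq x 0; first by rewrite mul0r eqxx.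
  have [->|y0] := eqVneq y 0; first by rewrite mulr0 eqxx.
  by move=> /= vx vy; rewrite dvalM// addr_ge0 ?orbT.
Qed.

HB.instance Definition _ := GRing.isSubringClosed.Build K integral
  integral_subring.

Record intring := IntRing { int_elt : K; _ : int_elt \in integral }.

HB.instance Definition _ := [isSub for int_elt].
HB.instance Definition _ := [Choice of intring by <:].
HB.instance Definition _ := [SubChoice_isSubComNzRing of intring by <:].

Definition int_incl : {rmorphism intring -> K} := val : {rmorphism intring -> K}.

Definition complete_dv : Prop :=
  forall u : nat -> K,
    (forall n : nat, exists N : nat, forall i j : nat,
       (N <= i)%N -> (N <= j)%N -> vge v n (u i - u j)) ->
    exists l : K, forall n : nat, exists N : nat, forall i : nat,
       (N <= i)%N -> vge v n (u i - l).

Definition residue_map (k : fieldType) (res : {rmorphism intring -> k}) : Prop :=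
  (forall a : k, exists x, res x = a) /\
  (forall x, res x = 0 <-> vge v 1 (int_elt x)).

Definition henselian (k : fieldType) (res : {rmorphism intring -> k}) : Prop :=
  forall (f : {poly intring}) (a : k), f \is monic ->
    root (map_poly res f) a -> ~~ root (map_poly res f)^`() a ->
    exists2 b : intring, root f b & res b = a.

End IntegerRing.

(* [w] is, up to normalization, an extension of [v]. *)
Definition dv_extends (K : fieldType) (v : dvaluation K)
    (L : fieldExtType K) (w : dvaluation L) : Prop :=
  forall x : K, (x%:A \in integral w) = (x \in integral v).

Section IntegerRingMap.
Variables (K : fieldType) (v : dvaluation K) (L : fieldExtType K).
Variables (w : dvaluation L) (vw : dv_extends v w).

Fact int_map_subproof (x : intring v) : (int_elt x)%:A \in integral w.
Proof. by rewrite vw; case: x. Qed.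

Definition int_map_fun (x : intring v) : intring w := IntRing (int_map_subproof x).

Fact int_map_zmod : zmod_morphism int_map_fun.
Proof. by move=> x y; apply: val_inj; rewrite /= scalerBl. Qed.

Fact int_map_monoid : monoid_morphism int_map_fun.
Proof.
split=> [|x y]; apply: val_inj; rewrite /= ?scale1r//.
by rewrite -scalerAl mul1r scalerA.
Qed.

HB.instance Definition _ := GRing.isZmodMorphism.Build _ _ int_map_fun int_map_zmod.
HB.instance Definition _ :=
  GRing.isMonoidMorphism.Build _ _ int_map_fun int_map_monoid.

Definition int_map : {rmorphism intring v -> intring w} := int_map_fun.

End IntegerRingMap.

(* [comAlgType] only contains nonzero algebras, and carries the scaling as a
   canonical structure on the type, which makes it unsuitable for restricting
   scalars along a varying morphism. *)
Record algebra (R : comNzRingType) := Algebra {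
  alg_ring :> comPzRingType;
  str : {rmorphism R -> alg_ring} }.

Record algHom (R : comNzRingType) (A B : algebra R) := AlgHom {
  alg_hom :> {rmorphism A -> B};
  alg_homE : forall r, alg_hom (str A r) = str B r }.

Definition base (R : comNzRingType) : algebra R := @Algebra R R idfun.

Definition restr (R S : comNzRingType) (phi : {rmorphism R -> S})
  (A : algebra S) : algebra R := @Algebra R A (str A \o phi).

Fact restr_homE (R S : comNzRingType) (phi : {rmorphism R -> S})
    (A B : algebra S) (f : algHom A B) r :
  f (str (restr phi A) r) = str (restr phi B) r.
Proof. exact: alg_homE. Qed.

Definition restr_hom (R S : comNzRingType) (phi : {rmorphism R -> S})
    (A B : algebra S) (f : algHom A B) : algHom (restr phi A) (restr phi B) :=
  @AlgHom R (restr phi A) (restr phi B) f (restr_homE phi f).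

(* The composition laws are stated up to pointwise equality of morphisms. *)
Record functor (R : comNzRingType) := Functor {
  pts :> algebra R -> Type;
  fmap : forall A B : algebra R, algHom A B -> pts A -> pts B;
  fmap_id : forall A (f : algHom A A) x, f =1 id -> fmap f x = x;
  fmap_comp : forall A B C (f : algHom A B) (g : algHom B C) (h : algHom A C) x,
    h =1 g \o f -> fmap h x = fmap g (fmap f x) }.

Record nattrans (R : comNzRingType) (X Y : functor R) := NatTrans {
  ntmap :> forall A : algebra R, X A -> Y A;
  ntmapE : forall A B (f : algHom A B) x,
    ntmap (fmap f x) = fmap f (ntmap x) }.

Record gfunctor (R : comNzRingType) := GFunctor {
  gpts :> algebra R -> groupType;
  gmap : forall A B : algebra R, algHom A B -> gpts A -> gpts B;
  gmap_id : forall A (f : algHom A A) x, f =1 id -> gmap f x = x;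
  gmap_comp : forall A B C (f : algHom A B) (g : algHom B C) (h : algHom A C) x,
    h =1 g \o f -> gmap h x = gmap g (gmap f x);
  gmapM : forall A B (f : algHom A B), {morph gmap f : x y / (x * y)%g};
  gpts_comm : forall A (x y : gpts A), (x * y = y * x)%g }.

Definition underlying (R : comNzRingType) (G : gfunctor R) : functor R :=
  @Functor R (fun A => G A) (@gmap R G) (@gmap_id R G) (@gmap_comp R G).

Section BaseChange.
Variables (R S : comNzRingType) (phi : {rmorphism R -> S}).

(* S-valued points of X x_R S are the R-algebra points of X. *)
Definition base_change (X : functor R) : functor S.
Proof.
refine (@Functor S (fun A => X (restr phi A))
  (fun A B f => fmap (restr_hom phi f)) _ _).
- by move=> A f x fid; apply: fmap_id.
- by move=> A B C f g h x hgf; apply: fmap_comp.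
Defined.

Definition base_changeG (G : gfunctor R) : gfunctor S.
Proof.
refine (@GFunctor S (fun A => G (restr phi A))
  (fun A B f => gmap (restr_hom phi f)) _ _ _ _).
- by move=> A f x fid; apply: gmap_id.
- by move=> A B C f g h x hgf; apply: gmap_comp.
- by move=> A B f x y; apply: gmapM.
- by move=> A x y; apply: gpts_comm.
Defined.

End BaseChange.

Definition unit_ideal (A : comPzRingType) (I : A -> Prop) : Prop :=
  exists (n : nat) (b a : 'I_n -> A),
    (forall i, I (a i)) /\ \sum_(i < n) b i * a i = 1.

(* [l] exhibits [B] as the localization A[1/f]. *)
Definition is_localization (R : comNzRingType) (A B : algebra R) (f : A)
    (l : algHom A B) : Prop :=
  [/\ exists y, l f * y = 1,
      forall b, exists a n, b * l f ^+ n = l a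
    & forall a, l a = 0 -> exists n, f ^+ n * a = 0].

Definition is_field (A : comPzRingType) : Prop :=
  (1 : A) <> 0 /\ forall x : A, x <> 0 -> exists y, x * y = 1.

Section Schemes.
Variables (R : comNzRingType) (X : functor R).

(* Agreement on overlaps is tested on all C receiving B i and B j over A,
   which amounts to testing it on A[1/(f i * f j)]. *)
Definition zariski_sheaf : Prop :=
  forall (A : algebra R) (n : nat) (f : 'I_n -> A) (B : 'I_n -> algebra R)
    (l : forall i, algHom A (B i)),
    unit_ideal (fun a => exists i, a = f i) ->
    (forall i, is_localization (f i) (l i)) ->
    forall x : forall i, X (B i),
      (forall i j (C : algebra R) (u : algHom (B i) C) (w : algHom (B j) C),
         u \o l i =1 w \o l j -> fmap u (x i) = fmap w (x j)) ->
      exists! y : X A, forall i, fmap (l i) y = x i.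

Definition subfunctor := forall A : algebra R, X A -> Prop.

(* The pullback of [U] to Spec A along each x : X A is the open subscheme
   D(I) for some I. *)
Definition is_open (U : subfunctor) : Prop :=
  forall (A : algebra R) (x : X A), exists I : A -> Prop,
    forall (B : algebra R) (f : algHom A B),
      U B (fmap f x) <-> unit_ideal (fun b => exists2 a, I a & b = f a).

Definition is_spec (U : subfunctor) (A : algebra R) : Prop :=
  exists u : X A,
    (forall (B : algebra R) (x : X B),
       U B x <-> exists f : algHom A B, fmap f u = x) /\
    (forall (B : algebra R) (f g : algHom A B),
       fmap f u = fmap g u -> f =1 g).

Definition affine_cover (J : Type) (U : J -> subfunctor) (A : J -> algebra R)
    : Prop :=
  [/\ forall i, is_open (U i),
      forall i, is_spec (U i) (A i)
    & forall (F : algebra R) (x : X F), is_field F -> exists i, U i F x].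

Definition is_scheme : Prop :=
  zariski_sheaf /\
  exists (J : Type) (U : J -> subfunctor) (A : J -> algebra R), affine_cover U A.

(* The diagonal is a closed immersion: x = y cuts out a closed subscheme V(I)
   of Spec A for all x, y : X A. *)
Definition separated : Prop :=
  forall (A : algebra R) (x y : X A), exists I : A -> Prop,
    forall (B : algebra R) (f : algHom A B),
      fmap f x = fmap f y <-> forall a, I a -> f a = 0.

Definition poly_eval (A : algebra R) (n : nat) (a : 'I_n -> A)
    (q : mpoly.mpoly n R) : A :=
  \sum_(m <- mpoly.msupp q)
    str A (mpoly.mcoeff m q) * \prod_(i < n) a i ^+ (mpoly.fun_of_multinom m i).

(* A is isomorphic to R[x_1, .., x_n] / (q_1, .., q_m), expressed through the
   universal property of the latter. *)
Definition finitely_presented (A : algebra R) : Prop :=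
  exists (n m : nat) (a : 'I_n -> A) (q : 'I_m -> mpoly.mpoly n R),
    (forall k, poly_eval a (q k) = 0) /\
    forall (B : algebra R) (b : 'I_n -> B), (forall k, poly_eval b (q k) = 0) ->
      (exists f : algHom A B, forall i, f (a i) = b i) /\
      (forall f g : algHom A B, (forall i, f (a i) = g (a i)) -> f =1 g).

Definition locally_finitely_presented : Prop :=
  exists (J : Type) (U : J -> subfunctor) (A : J -> algebra R),
    affine_cover U A /\ forall i, finitely_presented (A i).

Definition formally_smooth : Prop :=
  forall (A B : algebra R) (f : algHom A B),
    (forall b, exists a, f a = b) ->
    (forall a a' : A, f a = 0 -> f a' = 0 -> a * a' = 0) ->
    forall y : X B, exists x : X A, fmap f x = y.

Definition smooth_scheme : Prop :=
  [/\ is_scheme, locally_finitely_presented & formally_smooth].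

End Schemes.

(* A smooth scheme is locally of finite presentation, hence locally of finite
   type. By the Néron mapping property, the group law on the generic fibre
   extends in a unique way to the model; it is made part of the data. *)
Record neron_lft (K : fieldType) (v : dvaluation K) (T : gfunctor K) := NeronLft {
  nr_model :> gfunctor (intring v);
  nr_generic : nattrans (underlying (base_changeG (int_incl v) nr_model))
                        (underlying T);
  nr_genericM : forall (A : algebra K)
      (x y : base_changeG (int_incl v) nr_model A),
    nr_generic A (x * y)%g = (nr_generic A x * nr_generic A y)%g :> T A;
  nr_generic_bij : forall A, bijective (nr_generic A);
  nr_smooth : smooth_scheme (underlying nr_model);
  nr_separated : separated (underlying nr_model);
  nr_mapping : forall Y : functor (intring v), smooth_scheme Y ->
    forall u : nattrans (base_change (int_incl v) Y) (underlying T),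
    exists h : nattrans Y (underlying nr_model),
      (forall (A : algebra K) (y : Y (restr (int_incl v) A)),
         nr_generic A (h _ y) = u A y) /\
      (forall h' : nattrans Y (underlying nr_model),
         (forall (A : algebra K) (y : Y (restr (int_incl v) A)),
            nr_generic A (h' _ y) = u A y) ->
         forall A y, h' A y = h A y) }.

Section NeronBaseChange.
Variables (K : fieldType) (v : dvaluation K) (T : gfunctor K).
Variables (L : fieldExtType K) (w : dvaluation L) (vw : dv_extends v w).
Variables (N : neron_lft v T) (N' : neron_lft w (base_changeG (in_alg L) T)).

(* An L-algebra has two O_K-algebra structures, through O_L and through K; they
   are equal, but not convertible. *)
Definition square_hom (A : algebra L) :
  algHom (restr (int_map vw) (restr (int_incl w) A))
         (restr (int_incl v) (restr (in_alg L) A)) :=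
  @AlgHom _ (restr (int_map vw) (restr (int_incl w) A))
    (restr (int_incl v) (restr (in_alg L) A)) idfun (fun=> erefl).

(* The morphism N x O_L -> N' extending the identity of T x L. *)
Definition is_base_change_morphism
    (h : nattrans (base_change (int_map vw) (underlying N)) (underlying N'))
    : Prop :=
  forall (A : algebra L)
    (x : N (restr (int_map vw) (restr (int_incl w) A))),
    nr_generic N' A (h (restr (int_incl w) A) x) =
    nr_generic N (restr (in_alg L) A) (gmap (square_hom A) x).

End NeronBaseChange.

(* (a, b) stands for a + b eps. *)
Record dualnum (A : Type) := Dual { dn_re : A; dn_eps : A }.

Section DualNumbers.
Variable A : comPzRingType.
Implicit Types x y z : dualnum A.

Definition dn_pair x := (dn_re x, dn_eps x).
Definition pair_dn (x : A * A) := Dual x.1 x.2.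
Fact dn_pairK : cancel dn_pair pair_dn. Proof. by case. Qed.

HB.instance Definition _ := Choice.copy (dualnum A) (can_type dn_pairK).

Definition dn_add x y := Dual (dn_re x + dn_re y) (dn_eps x + dn_eps y).
Definition dn_opp x := Dual (- dn_re x) (- dn_eps x).
Definition dn_mul x y :=
  Dual (dn_re x * dn_re y) (dn_re x * dn_eps y + dn_eps x * dn_re y).

Fact dn_addA : associative dn_add.
Proof. by move=> [? ?] [? ?] [? ?]; rewrite /dn_add/= !addrA. Qed.
Fact dn_addC : commutative dn_add.
Proof. by move=> [a b] [c d]; rewrite /dn_add/= (addrC a) (addrC b). Qed.
Fact dn_add0 : left_id (Dual 0 0) dn_add.
Proof. by move=> [? ?]; rewrite /dn_add/= !add0r. Qed.
Fact dn_addN : left_inverse (Dual 0 0) dn_opp dn_add.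
Proof. by move=> [? ?]; rewrite /dn_add/= !addNr. Qed.

HB.instance Definition _ :=
  GRing.isZmodule.Build (dualnum A) dn_addA dn_addC dn_add0 dn_addN.

Fact dn_mulA : associative dn_mul.
Proof.
move=> [? ?] [? ?] [? ?]; rewrite /dn_mul/=; congr Dual; first exact: mulrA.
by rewrite mulrDr mulrDl !mulrA addrA.
Qed.
Fact dn_mulC : commutative dn_mul.
Proof.
move=> [a b] [c d]; rewrite /dn_mul/=; congr Dual; first exact: mulrC.
by rewrite addrC (mulrC b) (mulrC a).
Qed.
Fact dn_mul1 : left_id (Dual 1 0) dn_mul.
Proof. by move=> [? ?]; rewrite /dn_mul/= !mul1r mul0r addr0. Qed.
Fact dn_mulD : left_distributive dn_mul +%R.
Proof.
move=> [a b] [c d] [e f]; rewrite /dn_mul/= /GRing.add/= /dn_add/=.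
by congr Dual; rewrite !mulrDl// addrACA.
Qed.

HB.instance Definition _ := GRing.Zmodule_isComPzRing.Build (dualnum A)
  dn_mulA dn_mulC dn_mul1 dn_mulD.

Definition dn_const (a : A) : dualnum A := Dual a 0.
Fact dn_const_zmod : zmod_morphism dn_const.
Proof. by move=> a b; congr Dual; rewrite /= subr0. Qed.
Fact dn_const_monoid : monoid_morphism dn_const.
Proof. by split=> // a b; congr Dual; rewrite /= mulr0 mul0r addr0. Qed.
HB.instance Definition _ := GRing.isZmodMorphism.Build _ _ dn_const dn_const_zmod.
HB.instance Definition _ :=
  GRing.isMonoidMorphism.Build _ _ dn_const dn_const_monoid.

Fact dn_re_zmod : zmod_morphism (@dn_re A). Proof. by []. Qed.
Fact dn_re_monoid : monoid_morphism (@dn_re A). Proof. by []. Qed.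
HB.instance Definition _ := GRing.isZmodMorphism.Build _ _ (@dn_re A) dn_re_zmod.
HB.instance Definition _ :=
  GRing.isMonoidMorphism.Build _ _ (@dn_re A) dn_re_monoid.

Definition dn_scale (c : A) (x : dualnum A) : dualnum A :=
  Dual (dn_re x) (c * dn_eps x).
Fact dn_scale_zmod c : zmod_morphism (dn_scale c).
Proof. by move=> x y; congr Dual; rewrite /= mulrBr. Qed.
Fact dn_scale_monoid c : monoid_morphism (dn_scale c).
Proof.
split=> [|x y]; congr Dual; rewrite /= ?mulr0//.
by rewrite mulrDr mulrCA !mulrA.
Qed.
HB.instance Definition _ c :=
  GRing.isZmodMorphism.Build _ _ (dn_scale c) (dn_scale_zmod c).
HB.instance Definition _ c :=
  GRing.isMonoidMorphism.Build _ _ (dn_scale c) (dn_scale_monoid c).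

End DualNumbers.

Section DualMap.
Variables (A B : comPzRingType) (f : {rmorphism A -> B}).

Definition dn_map (x : dualnum A) : dualnum B := Dual (f (dn_re x)) (f (dn_eps x)).
Fact dn_map_zmod : zmod_morphism dn_map.
Proof. by move=> x y; congr Dual; rewrite /= rmorphB. Qed.
Fact dn_map_monoid : monoid_morphism dn_map.
Proof.
split=> [|x y]; congr Dual; rewrite /= ?rmorph1 ?rmorph0//.
  by rewrite rmorphM.
by rewrite rmorphD !rmorphM.
Qed.
HB.instance Definition _ := GRing.isZmodMorphism.Build _ _ dn_map dn_map_zmod.
HB.instance Definition _ := GRing.isMonoidMorphism.Build _ _ dn_map dn_map_monoid.

End DualMap.

Section Lie.
Variable R : comNzRingType.

Definition dual_alg : algebra R := @Algebra R (dualnum R) (@dn_const R).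

Definition aug_hom : algHom dual_alg (base R) :=
  @AlgHom R dual_alg (base R) (@dn_re R) (fun=> erefl).

Fact scale_homE (c r : R) : dn_scale c (str dual_alg r) = str dual_alg r.
Proof. by congr Dual; rewrite /= mulr0. Qed.

Definition scale_hom (c : R) : algHom dual_alg dual_alg :=
  @AlgHom R dual_alg dual_alg (dn_scale c) (scale_homE c).

Variable G : gfunctor R.

(* Lie G is the kernel of G(R[eps]) -> G(R); its addition is the group law of
   G(R[eps]), and c in R acts through eps |-> c eps. *)
Definition lie (x : G dual_alg) : Prop := gmap aug_hom x = 1%g.

Definition lie_scale (c : R) (x : G dual_alg) : G dual_alg := gmap (scale_hom c) x.

End Lie.

(* For a smooth group scheme T over K, dim T is the dimension of Lie T. *)
Definition has_dimension (K : fieldType) (T : gfunctor K) (g : nat) : Prop :=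
  exists f : 'rV[K]_g -> T (dual_alg K),
    [/\ forall a b, f (a + b) = (f a * f b)%g,
        forall c a, f (c *: a) = lie_scale c (f a),
        injective f
      & forall x, lie x <-> exists a, f a = x].

Section LieMap.
Variables (R S : comNzRingType) (phi : {rmorphism R -> S}).

Fact dual_homE (r : R) :
  dn_map phi (str (dual_alg R) r) = str (restr phi (dual_alg S)) r.
Proof. by congr Dual; rewrite /= rmorph0. Qed.

Definition dual_hom : algHom (dual_alg R) (restr phi (dual_alg S)) :=
  @AlgHom R (dual_alg R) (restr phi (dual_alg S)) (dn_map phi) dual_homE.

Variables (G : gfunctor R) (G' : gfunctor S).
Variable h : nattrans (base_change phi (underlying G)) (underlying G').

Definition lie_map (x : G (dual_alg R)) : G' (dual_alg S) :=
  h (dual_alg S) (gmap dual_hom x).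

(* The image of psi : Lie(G) (x)_R S -> Lie(G'), x (x) c |-> c lie_map(x): every
   element of the source is a finite sum of such tensors. *)
Inductive im_psi : G' (dual_alg S) -> Prop :=
| im_psi0 : im_psi 1%g
| im_psiD (c : S) x y : lie x -> im_psi y ->
    im_psi (lie_scale c (lie_map x) * y)%g.

(* [M] with [q] is a cokernel of psi. *)
Definition is_coker_psi (M : lmodType S) (q : G' (dual_alg S) -> M) : Prop :=
  [/\ forall x y, lie x -> lie y -> q (x * y)%g = q x + q y,
      forall c x, lie x -> q (lie_scale c x) = c *: q x,
      forall m, exists2 x, lie x & q x = m
    & forall x, lie x -> (q x = 0 <-> im_psi x)].

End LieMap.

(* [M] is isomorphic to the direct sum of the O/m^(j i), where
   m^n = {x | n <= w x} for the normalized valuation [w]. *)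
Definition is_sum_of_cyclics (L : fieldType) (w : dvaluation L) (g : nat)
    (j : 'I_g -> nat) (M : lmodType (intring w)) : Prop :=
  exists r : {linear 'rV[intring w]_g -> M},
    (forall m, exists a, r a = m) /\
    (forall a, r a = 0 <-> forall i, vge w (j i) (int_elt (a 0 i))).

(* A cofinal tower of finite tame extensions of K, together with the Néron
   lft-models and base change morphisms. Over a complete K with algebraically
   closed residue field of characteristic p, finite extensions are totally
   ramified, so that the tame ones are those of degree prime to p; there is
   only one of each degree, and [jd_fields n] is K(d_n) with
   d_n = \dim {:jd_fields n}. *)
Record jump_data (K : fieldType) (v : dvaluation K) (p : nat) (T : gfunctor K) :=
    JumpData {
  jd_fields : nat -> fieldExtType K;
  jd_val : forall n, dvaluation (jd_fields n);
  jd_ext : forall n, dv_extends v (jd_val n);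
  jd_tame : forall n, coprime p (\dim {:jd_fields n});
  jd_tower : forall n, inhabited 'AHom(jd_fields n, jd_fields n.+1);
  jd_cofinal : forall E : fieldExtType K, coprime p (\dim {:E}) ->
    exists n, inhabited 'AHom(E, jd_fields n);
  jd_neron : neron_lft v T;
  jd_nerond : forall n,
    neron_lft (jd_val n) (base_changeG (in_alg (jd_fields n)) T);
  jd_hom : forall n,
    nattrans (base_change (int_map (jd_ext n)) (underlying jd_neron))
             (underlying (jd_nerond n));
  jd_homE : forall n, is_base_change_morphism (@jd_hom n) }.

Section Jumps.
Variables (K : fieldType) (v : dvaluation K) (p : nat) (T : gfunctor K).
Variable D : jump_data v p T.

Definition degree (n : nat) : nat := \dim {:jd_fields D n}.

Definition is_djumps (n g : nat) (j : 'I_g -> nat) : Prop :=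
  {homo j : a b / (a <= b)%N >-> (a <= b)%N} /\
  exists (M : lmodType (intring (jd_val D n)))
         (q : jd_nerond D n (dual_alg (intring (jd_val D n))) -> M),
    is_coker_psi (jd_hom D n) q /\ is_sum_of_cyclics j M.

Definition is_jumps (R : realType) (g : nat) (j : 'I_g -> R) : Prop :=
  has_dimension T g /\
  exists dj : nat -> 'I_g -> nat,
    (forall n, is_djumps n (dj n)) /\
    (forall i, ((dj n i)%:R / (degree n)%:R : R) @[n --> \oo] --> j i)%classic.

Definition is_ctame (R : realType) (c : R) : Prop :=
  exists (g : nat) (j : 'I_g -> R), is_jumps j /\ c = \sum_(i < g) j i.

End Jumps.

Section Units.
Variable A : comPzRingType.

(* Carrying the inverse avoids deciding invertibility. *)
Definition units := {u : A * A | u.1 * u.2 == 1}.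
HB.instance Definition _ := Choice.on units.

Implicit Types u v : units.

Fact units_inj u v : (val u).1 = (val v).1 -> u = v.
Proof.
case: u v => [[a b] /= ab] [[c d] /= cd] /= ac; apply: val_inj => /=.
move/eqP: ab; move/eqP: cd; rewrite -ac => ad ab; congr pair.
by rewrite -[b]mulr1 -ad mulrA (mulrC b) ab mul1r.
Qed.

Fact units_mul_subproof u v :
  ((val u).1 * (val v).1) * ((val u).2 * (val v).2) == 1.
Proof. by rewrite mulrACA (eqP (valP u)) (eqP (valP v)) mulr1. Qed.
Fact units_one_subproof : (1 : A) * 1 == 1. Proof. by rewrite mulr1. Qed.
Fact units_inv_subproof u : (val u).2 * (val u).1 == 1.
Proof. by rewrite mulrC (valP u). Qed.

Definition units_mul u v : units :=
  exist _ ((val u).1 * (val v).1, (val u).2 * (val v).2) (units_mul_subproof u v).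
Definition units_one : units := exist _ (1, 1) units_one_subproof.
Definition units_inv u : units :=
  exist _ ((val u).2, (val u).1) (units_inv_subproof u).

Fact units_mulA : associative units_mul.
Proof. by move=> u v w; apply: units_inj; rewrite /= mulrA. Qed.
Fact units_mul1 : left_id units_one units_mul.
Proof. by move=> u; apply: units_inj; rewrite /= mul1r. Qed.
Fact units_mul1r : right_id units_one units_mul.
Proof. by move=> u; apply: units_inj; rewrite /= mulr1. Qed.
Fact units_mulV : left_inverse units_one units_inv units_mul.
Proof. by move=> u; apply: units_inj; rewrite /= mulrC; apply/eqP/(valP u). Qed.
Fact units_mulVr : right_inverse units_one units_inv units_mul.
Proof. by move=> u; apply: units_inj; apply/eqP/(valP u). Qed.

HB.instance Definition _ := isGroup.Build units
  units_mulA units_mul1 units_mul1r units_mulV units_mulVr.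

End Units.

Section UnitsMap.
Variables (A B : comPzRingType) (f : {rmorphism A -> B}).

Fact units_map_subproof (u : units A) : f (val u).1 * f (val u).2 == 1.
Proof. by rewrite -rmorphM (eqP (valP u)) rmorph1. Qed.

Definition units_map (u : units A) : units B :=
  exist _ (f (val u).1, f (val u).2) (units_map_subproof u).

End UnitsMap.

Definition Gm (R : comNzRingType) : gfunctor R.
Proof.
refine (@GFunctor R (fun A => units A) (fun A B f => units_map f) _ _ _ _).
- by move=> A f x fid; apply: units_inj; apply: fid.
- by move=> A B C f g h x hgf; apply: units_inj; apply: hgf.
- by move=> A B f x y; apply: units_inj; rewrite /= rmorphM.
- by move=> A x y; apply: units_inj; rewrite /= mulrC.
Defined.

(* The L-algebra A (x)_K L for a finite extension L/K and a K-algebra A: it is a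
   free A-module on the basis e = (vbasis {:L}), with the structure constants of
   L. See [tensor_pushout] for its universal property. *)
Section Tensor.
Variables (K : fieldType) (L : fieldExtType K).

Local Notation n := (\dim {:L}).
Local Notation e := (vbasis {:L}).

Definition tensor (A : algebra K) := 'rV[A]_n.

Section Ring.
Variable A : algebra K.

HB.instance Definition _ := GRing.Zmodule.on (tensor A).

Definition tensor_mul (x y : tensor A) : tensor A :=
  \row_k \sum_i \sum_j x 0 i * y 0 j * str A (coord e k (e`_i * e`_j)).

Definition tensor_incl (l : L) : tensor A := \row_k str A (coord e k l).

Let regmx (l : L) : 'M[A]_n := \matrix_(i, k) str A (coord e k (e`_i * l)).
Let rho (y : tensor A) : 'M[A]_n := \sum_j y 0 j *: regmx e`_j.

Let coordE (l : L) : l = \sum_i coord e i l *: e`_i.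
Proof. exact/coord_vbasis/memvf. Qed.

Let tensor_mulE x y : tensor_mul x y = x *m rho y.
Proof.
apply/rowP => k; rewrite !mxE; apply: eq_bigr => i _.
rewrite summxE mulr_sumr; apply: eq_bigr => j _.
by rewrite !mxE mulrA.
Qed.

Let regmx_sum (l : L) : regmx l = \sum_k str A (coord e k l) *: regmx e`_k.
Proof.
apply/matrixP => i k; rewrite !mxE summxE {1}(coordE l) mulr_sumr !linear_sum.
rewrite rmorph_sum; apply: eq_bigr => m _.
by rewrite -scalerAr linearZ rmorphM !mxE.
Qed.

Let regmxM (l m : L) : regmx (l * m) = regmx l *m regmx m.
Proof.
apply/matrixP => i k; rewrite !mxE mulrA {1}(coordE (e`_i * l)) mulr_suml.
rewrite !linear_sum rmorph_sum; apply: eq_bigr => j _.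
by rewrite -scalerAl linearZ rmorphM !mxE.
Qed.

Let rho_incl (l : L) : rho (tensor_incl l) = regmx l.
Proof. by rewrite regmx_sum; apply: eq_bigr => k _; rewrite mxE. Qed.

Let incl_regmx (l m : L) : tensor_incl l *m regmx m = tensor_incl (l * m).
Proof.
apply/rowP => k; rewrite !mxE {2}(coordE l) mulr_suml !linear_sum rmorph_sum.
apply: eq_bigr => j _.
by rewrite -scalerAl linearZ rmorphM !mxE.
Qed.

Let rhoM (x y : tensor A) : rho (tensor_mul x y) = rho x *m rho y.
Proof.
rewrite tensor_mulE [in RHS]/rho mulmx_suml.
transitivity (\sum_i \sum_k (x 0 i * rho y i k) *: regmx e`_k).
  rewrite exchange_big /=; apply: eq_bigr => k _.
  by rewrite mxE scaler_suml.
apply: eq_bigr => i _; rewrite -scalemxAl.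
under eq_bigr do rewrite -scalerA.
rewrite -scaler_sumr; congr (_ *: _).
rewrite mulmx_sumr.
under [RHS]eq_bigr => j _.
  rewrite -scalemxAr -regmxM regmx_sum scaler_sumr; over.
rewrite exchange_big /=; apply: eq_bigr => k _.
rewrite summxE scaler_suml; apply: eq_bigr => j _.
by rewrite !mxE scalerA.
Qed.

Fact tensor_mulA : associative tensor_mul.
Proof. by move=> x y z; rewrite !tensor_mulE -mulmxA -rhoM tensor_mulE. Qed.

Fact tensor_mulC : commutative tensor_mul.
Proof.
move=> x y; apply/rowP => k; rewrite !mxE exchange_big /=.
apply: eq_bigr => i _; apply: eq_bigr => j _.
by rewrite (mulrC (x _ _)) (mulrC e`_j).
Qed.

Fact tensor_inclM (l m : L) :
  tensor_incl (l * m) = tensor_mul (tensor_incl l) (tensor_incl m).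
Proof. by rewrite tensor_mulE rho_incl incl_regmx. Qed.

Fact tensor_mul1 : left_id (tensor_incl 1) tensor_mul.
Proof.
move=> x; rewrite tensor_mulE mulmx_sumr; apply/rowP => k.
rewrite summxE (bigD1 k)//= -scalemxAr incl_regmx mul1r !mxE.
rewrite coord_free ?(basis_free (vbasisP _))// eqxx rmorph1 mulr1.
rewrite big1 ?addr0// => j jk; rewrite -scalemxAr incl_regmx mul1r !mxE.
rewrite coord_free ?(basis_free (vbasisP _))//.
by rewrite (negbTE jk) rmorph0 mulr0.
Qed.

Fact tensor_mulDl : left_distributive tensor_mul +%R.
Proof. by move=> x y z; rewrite !tensor_mulE mulmxDl. Qed.

HB.instance Definition _ := GRing.Zmodule_isComPzRing.Build (tensor A)
  tensor_mulA tensor_mulC tensor_mul1 tensor_mulDl.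

Fact tensor_incl_zmod : zmod_morphism tensor_incl.
Proof. by move=> l m; apply/rowP => k; rewrite !mxE !linearB rmorphB. Qed.
Fact tensor_incl_monoid : monoid_morphism tensor_incl.
Proof. by split=> // l m; exact: tensor_inclM. Qed.

HB.instance Definition _ :=
  GRing.isZmodMorphism.Build _ _ tensor_incl tensor_incl_zmod.
HB.instance Definition _ :=
  GRing.isMonoidMorphism.Build _ _ tensor_incl tensor_incl_monoid.

Definition tensor_alg : algebra L := @Algebra L (tensor A) tensor_incl.

End Ring.

Section Map.
Variables (A B : algebra K) (f : algHom A B).

Definition tensor_map (x : tensor A) : tensor B := map_mx f x.

Fact tensor_map_incl (l : L) : tensor_map (tensor_incl A l) = tensor_incl B l.
Proof. by apply/rowP => k; rewrite !mxE alg_homE. Qed.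
Fact tensor_map_zmod : zmod_morphism tensor_map.
Proof. by move=> x y; exact: map_mxB. Qed.
Fact tensor_map_monoid : monoid_morphism tensor_map.
Proof.
split=> [|x y]; first exact: tensor_map_incl.
apply/rowP => k; rewrite !mxE rmorph_sum; apply: eq_bigr => i _.
rewrite rmorph_sum; apply: eq_bigr => j _.
by rewrite !rmorphM alg_homE !mxE.
Qed.

HB.instance Definition _ :=
  GRing.isZmodMorphism.Build _ _ tensor_map tensor_map_zmod.
HB.instance Definition _ :=
  GRing.isMonoidMorphism.Build _ _ tensor_map tensor_map_monoid.

Definition tensor_hom : algHom (tensor_alg A) (tensor_alg B) :=
  @AlgHom L (tensor_alg A) (tensor_alg B) tensor_map tensor_map_incl.

End Map.

Definition weil_restriction (G : gfunctor L) : gfunctor K.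
Proof.
refine (@GFunctor K (fun A => G (tensor_alg A))
  (fun A B f => gmap (tensor_hom f)) _ _ _ _).
- move=> A f x fid; apply: gmap_id => y.
  by apply/rowP => k; rewrite !mxE fid.
- move=> A B C f g h x hgf; apply: gmap_comp => y.
  by apply/rowP => k; rewrite !mxE hgf.
- by move=> A B f x y; apply: gmapM.
- by move=> A x y; apply: gpts_comm.
Defined.

End Tensor.

Section TensorPushout.
Variables (K : fieldType) (L : fieldExtType K) (A : algebra K).

Local Notation e := (vbasis {:L}).

Definition tensor_inj (a : A) : tensor L A := a *: (tensor_incl A 1 : 'rV_ _).

Let tensor_injM (a : A) (y : tensor L A) : tensor_inj a * y = a *: (y : 'rV_ _).
Proof.
rewrite -[in RHS](tensor_mul1 y); apply/rowP => k; rewrite !mxE mulr_sumr.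
apply: eq_bigr => i _; rewrite mulr_sumr; apply: eq_bigr => j _.
by rewrite !mxE !mulrA.
Qed.

Let tensorE (x : tensor L A) :
  x = \sum_i tensor_inj (x 0 i) * tensor_incl A e`_i.
Proof.
apply/rowP => k; rewrite summxE (bigD1 k)//= tensor_injM !mxE.
rewrite coord_free ?(basis_free (vbasisP _))// eqxx rmorph1 mulr1.
rewrite big1 ?addr0// => j jk; rewrite tensor_injM !mxE.
rewrite coord_free ?(basis_free (vbasisP _))//.
by rewrite (negbTE jk) rmorph0 mulr0.
Qed.

Variables (B : comPzRingType) (f : {rmorphism A -> B}) (g : {rmorphism L -> B}).
Hypothesis fg : forall x : K, f (str A x) = g x%:A.

Let copair (x : tensor L A) : B := \sum_i f (x 0 i) * g e`_i.

Let gE (l : L) : g l = \sum_k f (str A (coord e k l)) * g e`_k.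
Proof.
rewrite {1}(coord_vbasis (memvf l)) rmorph_sum; apply: eq_bigr => k _.
by rewrite fg -rmorphM -scalerAl mul1r.
Qed.

Let copair_incl (l : L) : copair (tensor_incl A l) = g l.
Proof. by rewrite gE; apply: eq_bigr => k _; rewrite mxE. Qed.

Let copair_inj (a : A) : copair (tensor_inj a) = f a.
Proof.
rewrite -[f a]mulr1 -(rmorph1 g) -copair_incl mulr_sumr.
by apply: eq_bigr => k _; rewrite mxE rmorphM mulrA.
Qed.

Fact copair_zmod : zmod_morphism copair.
Proof.
move=> x y; rewrite -sumrB; apply: eq_bigr => k _.
by rewrite !mxE rmorphB mulrBl.
Qed.

Fact copair_monoid : monoid_morphism copair.
Proof.
split=> [|x y]; first by rewrite copair_incl rmorph1.
rewrite mulr_suml.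
transitivity (\sum_i \sum_j f (x 0 i) * f (y 0 j) * g (e`_i * e`_j)); last first.
  apply: eq_bigr => i _; rewrite mulr_sumr; apply: eq_bigr => j _.
  by rewrite rmorphM mulrACA.
transitivity (\sum_k \sum_i \sum_j
    f (x 0 i) * f (y 0 j) * (f (str A (coord e k (e`_i * e`_j))) * g e`_k)).
  apply: eq_bigr => k _; rewrite mxE rmorph_sum mulr_suml.
  apply: eq_bigr => i _; rewrite rmorph_sum mulr_suml.
  by apply: eq_bigr => j _; rewrite !rmorphM !mulrA.
rewrite exchange_big; apply: eq_bigr => i _ /=.
rewrite exchange_big; apply: eq_bigr => j _ /=.
by rewrite -mulr_sumr -gE.
Qed.

HB.instance Definition _ := GRing.isZmodMorphism.Build _ _ copair copair_zmod.
HB.instance Definition _ :=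
  GRing.isMonoidMorphism.Build _ _ copair copair_monoid.

Theorem tensor_pushout :
  exists2 h : {rmorphism tensor L A -> B},
    (forall a, h (tensor_inj a) = f a) /\ (forall l, h (tensor_incl A l) = g l)
  & forall h' : {rmorphism tensor L A -> B},
      (forall a, h' (tensor_inj a) = f a) ->
      (forall l, h' (tensor_incl A l) = g l) -> h' =1 h.
Proof.
exists (copair : {rmorphism _ -> _}).
  by split; [exact: copair_inj | exact: copair_incl].
move=> h' h'f h'g x; rewrite {1}(tensorE x) rmorph_sum; apply: eq_bigr => i _.
by rewrite rmorphM h'f h'g.
Qed.

End TensorPushout.

(* Main.v *)
Require Import Defs.
From HB Require Import structures.
From mathcomp Require Import all_boot all_order all_algebra all_field.
From mathcomp Require Import boolp classical_sets reals topology normedtype sequences.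
From mathcomp Require Import ring zify.
From mathcomp Require mpoly.
Import (canonicals) mpoly.
Import Defs.

Set Implicit Arguments.
Unset Strict Implicit.
Unset Printing Implicit Defensive.

Import Order.TTheory GRing.Theory Num.Theory.
Import numFieldNormedType.Exports.

Local Open Scope ring_scope.
Local Open Scope quotient_scope.

(* Write n = [L : K], d = [K(d) : K], let pi, z, t be uniformizers of K, K(d), L,
   and let w be the valuation of K(d). Separatedness and the generic fibre embed
   the Lie algebra of the model over O_K(d) into K(d) (x)_K L, via 1 + a eps |-> a.
   Its image consists of the sums of the c_i (x) t^i with w(c_i) >= - floor(d i / n),
   and the one of the model over O_K is O_L, so that the d-jumps are exactly the
   floor(d i / n).

   Upper bound: by smoothness a tangent vector lifts to a formal curve, so 1 + a eps
   lifts to a unit of constant term 1 among the power series over K(d) (x)_K L with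
   bounded coefficients. By the Gauss lemma its coefficients, in particular a, are
   integral in every valued field receiving K(d) and L. In one which splits the
   minimal polynomial of z, the conjugates of z and, by tameness, their
   differences all have the same valuation, and Newton interpolation recovers the
   coefficients of a with respect to the powers of z.

   Lower bound: if a is integral, then 1 + s a is a unit over an open neighbourhood
   of the zero section of the affine s-line, and the Néron mapping property extends
   it to a curve in the model with tangent vector a. *)

(** * Discrete valuations *)

(** No Néron model is constructed: everything is deduced from separatedness, smoothness and the
    mapping property, so that one argument serves over O_K and over O_K(d). The obstacle is that
    K(d) (x)_K L need not be a field, so that it carries no valuation; integrality in it is tested
    along pairs of embeddings of K(d) and L into a discretely valued field which agree on K. Such
    fields arise by adjoining roots and extending the valuation each time, by Chevalley's argument.
    Completeness of K and the algebraically closed residue field act on K(d) and L: both are totally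
    ramified, the powers of a uniformizer are a basis of their integers over O_K, and these integers
    are integral over O_K, hence stay integral under every embedding which is integral on O_K. The
    constant floor(d i / n) is the largest m for which z^(-m) (x) t^i is integral: up to a unit its
    n-th power is pi^i / z^(n m), of valuation d i - n m. An integral equation of a also provides
    the open neighbourhood on which 1 + s a is invertible. Finally floor(d i / n) / d tends to i / n
    because d is unbounded along the tower, roots of X^m - pi giving extensions of every degree. *)

Section Valuation.
Variables (K : fieldType) (v : dvaluation K).
Implicit Types (x y : K) (m n : int).

Lemma vge0 n : vge v n 0. Proof. by rewrite /vge eqxx. Qed.

Lemma vgeE n x : x != 0 -> vge v n x = (n <= v x).
Proof. by rewrite /vge => /negbTE->. Qed.

Lemma vge_le m n x : m <= n -> vge v n x -> vge v m x.
Proof.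
by rewrite /vge => mn /orP[->//|nx]; rewrite (le_trans mn nx) orbT.
Qed.

Lemma vgeN n x : vge v n (- x) = vge v n x.
Proof. by rewrite /vge oppr_eq0 dvalN. Qed.

Lemma vgeD n x y : vge v n x -> vge v n y -> vge v n (x + y).
Proof.
have [->|x0] := eqVneq x 0; first by rewrite add0r.
have [->|y0] := eqVneq y 0; first by rewrite addr0.
have [->|xy0] := eqVneq (x + y) 0; first by rewrite vge0.
rewrite !vgeE// => nx ny; apply: le_trans (dvalD v x0 y0 xy0).
by rewrite le_min nx ny.
Qed.

Lemma vgeB n x y : vge v n x -> vge v n y -> vge v n (x - y).
Proof. by move=> nx ny; apply: vgeD; rewrite ?vgeN. Qed.

Lemma vgeM m n x y : vge v m x -> vge v n y -> vge v (m + n) (x * y).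
Proof.
have [->|x0] := eqVneq x 0; first by rewrite mul0r !vge0.
have [->|y0] := eqVneq y 0; first by rewrite mulr0 !vge0.
rewrite !vgeE ?mulf_neq0// dvalM// => mx ny; exact: lerD.
Qed.

Lemma vge_sum n (J : Type) (r : seq J) (P : pred J) (F : J -> K) :
  (forall j, P j -> vge v n (F j)) -> vge v n (\sum_(j <- r | P j) F j).
Proof. by move=> nF; elim/big_ind: _ => //; [exact: vge0|exact: vgeD]. Qed.

Lemma dvalV x : x != 0 -> v x^-1 = - v x.
Proof.
move=> x0; apply/eqP; rewrite -addr_eq0 -dvalM ?invr_eq0// mulVf//.
by rewrite dval1.
Qed.

Lemma dvalX x (n : nat) : x != 0 -> v (x ^+ n) = v x *+ n.
Proof.
move=> x0; elim: n => [|n IH]; first by rewrite expr0 dval1.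
by rewrite exprS dvalM ?expf_neq0// IH mulrS.
Qed.

Lemma dvalXz x (n : int) : x != 0 -> v (x ^ n) = v x * n.
Proof.
move=> x0; case: n => n; first by rewrite -exprnP dvalX// -mulr_natr natz.
by rewrite NegzE -exprnN dvalV ?expf_neq0// dvalX// mulrN -mulr_natr natz.
Qed.

(** The ultrametric inequality, applied to x = (x + y) - y, excludes a larger valuation of the
    sum. *)
Lemma dval_dominant x y : x != 0 -> vge v (v x + 1) y ->
  x + y != 0 /\ v (x + y) = v x.
Proof.
move=> x0; have [->|y0] := eqVneq y 0; first by rewrite addr0.
rewrite vgeE// => xy.
have s0 : x + y != 0.
  apply/eqP => /eqP; rewrite addr_eq0 => /eqP e; move: xy.
  by rewrite e dvalN; lia.
split=> //; apply/eqP; rewrite eq_le; apply/andP; split; last first.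
  by apply: le_trans (dvalD v x0 y0 s0); rewrite le_min; lia.
have e : (x + y) + - y = x by rewrite addrK.
have := dvalD v s0 (_ : - y != 0); rewrite oppr_eq0 e => /(_ y0 x0).
by rewrite ge_min dvalN; lia.
Qed.

Lemma dval_sum_dominant (n : nat) (F : 'I_n -> K) (i : 'I_n) :
  F i != 0 -> (forall j, j != i -> vge v (v (F i) + 1) (F j)) ->
  \sum_j F j != 0 /\ v (\sum_j F j) = v (F i).
Proof.
move=> Fi0 Fj; rewrite (bigD1 i)//=; apply: dval_dominant => //.
exact: vge_sum.
Qed.

(** Integers bounded below have a minimum. The Gauss lemma requires the first index which attains
    it. *)
Lemma vge_min_attained (m : int) (F : nat -> K) (i : nat) :
  F i != 0 -> (forall j, vge v m (F j)) ->
  exists i0, [/\ F i0 != 0, forall j, vge v (v (F i0)) (F j)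
    & forall j, (j < i0)%N -> vge v (v (F i0) + 1) (F j)].
Proof.
move=> Fi0 Fm.
(* Valuations are shifted by the lower bound [m], so that the minimum is taken over natural
   numbers. *)
pose P (a : nat) := `[< exists j, F j != 0 /\ v (F j) = m + a%:Z >].
have exP : exists a, P a.
  exists `|v (F i) - m|%N; apply/asboolP; exists i; split=> //.
  by have := Fm i; rewrite vgeE//; lia.
case: (ex_minnP exP) => a /asboolP[j [Fj0 Fj]] amin.
pose Q b := (F b != 0) && (v (F b) == m + a%:Z).
have exQ : exists b, Q b by exists j; rewrite /Q Fj0 Fj eqxx.
case: (ex_minnP exQ) => b /andP[Fb0 /eqP Fb] bmin.
have aP c : vge v (v (F b)) (F c).
  have [->|Fc0] := eqVneq (F c) 0; first exact: vge0.
  rewrite vgeE// Fb.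
  have mc : m <= v (F c) by have := Fm c; rewrite vgeE.
  have : (a <= `|v (F c) - m|)%N.
    by apply: amin; apply/asboolP; exists c; split=> //; lia.
  by lia.
exists b; split=> // c cb; have := aP c.
have [->|Fc0] := eqVneq (F c) 0; first by rewrite !vge0.
rewrite !vgeE// Fb => le; have : ~~ Q c.
  by apply/negP => /bmin; lia.
by rewrite /Q Fc0/=; lia.
Qed.

Lemma integralE x : (x \in integral v) = vge v 0 x. Proof. by []. Qed.

End Valuation.

Section ValuationEstimates.
Variables (K : fieldType) (v : dvaluation K).

Lemma vge_self x : vge v (v x) x. Proof. by rewrite /vge lexx orbT. Qed.

Lemma vgePn n x : vge v n x = false -> x != 0 /\ v x < n.
Proof. by move=> /negbT; rewrite /vge negb_or -ltNge => /andP[]. Qed.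

Lemma vge_prime x y : vge v 0 x -> vge v 0 y -> vge v 1 (x * y) ->
  vge v 1 x \/ vge v 1 y.
Proof.
have [->|x0] := eqVneq x 0; first by left; exact: vge0.
have [->|y0] := eqVneq y 0; first by right; exact: vge0.
rewrite !vgeE ?mulf_neq0// dvalM// => vx vy vxy.
by case: (ltrP 0 (v x)) => ?; [left|right]; lia.
Qed.

Lemma vgeX x (n : nat) : vge v 0 x -> vge v 0 (x ^+ n).
Proof.
move=> vx; elim: n => [|n IH]; first by rewrite expr0 vgeE ?oner_eq0// dval1.
by rewrite exprS -[0](addr0 0); exact: vgeM.
Qed.

Lemma vge_bound (n : nat) (f : nat -> K) :
  exists m : int, forall j, (j < n)%N -> vge v m (f j).
Proof.
elim: n => [|n [m mf]]; first by exists 0.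
exists (Num.min m (v (f n))) => j; rewrite ltnS leq_eqVlt => /orP[/eqP->|/mf].
  by apply: vge_le (vge_self _); rewrite ge_min lexx orbT.
by apply: vge_le; rewrite ge_min lexx.
Qed.

Lemma vge_all0 x : (forall m : nat, vge v m%:Z x) -> x = 0.
Proof.
move=> vx; apply/eqP; apply: contrapT => /negP x0.
by have := vx (`|v x|.+1)%N; rewrite vgeE//; lia.
Qed.

(** A nonzero term of least valuation is unique, so it dominates the others and the sum has its
    valuation. *)
Lemma vge_sum_distinct (n : nat) (f : 'I_n -> K) (m : int) :
  (forall i j, f i != 0 -> f j != 0 -> v (f i) = v (f j) -> i = j) ->
  vge v m (\sum_i f i) -> forall i, vge v m (f i).
Proof.
move=> dist vs i; apply: contrapT => /negP/negbTE/vgePn[fi0 vfi].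
(* Extension by zero beyond [n], to which the minimum over a sequence applies. *)
pose g (l : nat) := if insub l is Some j then f j else 0.
have gE (j : 'I_n) : g j = f j by rewrite /g valK.
have g0 l : ~~ (l < n)%N -> g l = 0 by move=> ln; rewrite /g insubN.
have [M gM] := vge_bound n g.
have {}gM j : vge v M (g j).
  have [/gM//|nj] := ltnP j n; rewrite g0; first exact: vge0.
  by rewrite -leqNgt.
have gi0 : g i != 0 by rewrite gE.
have [l [gl0 gl _]] := vge_min_attained gi0 gM.
have ln : (l < n)%N by apply: contraNT gl0 => /g0 ->.
pose j := Ordinal ln; have gj : g l = f j by rewrite -(gE j).
have fj0 : f j != 0 by rewrite -gj.
have [j' jj'|s0 vs'] := @dval_sum_dominant _ v _ f j fj0.
  have := gl j'; rewrite gE gj; have [->|fj'0] := eqVneq (f j') 0; first by rewrite !vge0.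
  rewrite !vgeE// le_eqVlt => /orP[/eqP e|]; last by lia.
  by move: jj'; rewrite (dist _ _ fj0 fj'0 e) eqxx.
move: vs; rewrite vgeE// vs' => mfj.
by have := gl i; rewrite gE gj vgeE//; lia.
Qed.

End ValuationEstimates.

Lemma algebraic_relation (K : fieldType) (F : fieldExtType K) (x : F) :
  exists P : {poly K}, [/\ P != 0, (size P <= (\dim {:F}).+1)%N
    & root (map_poly (in_alg F) P) x].
Proof.
have /polyOver1P[P PE] := minPolyOver 1%AS x.
exists P; rewrite -PE root_minPoly; split=> //.
  apply/eqP => P0; have := monic_minPoly 1%AS x.
  by rewrite PE P0 rmorph0 monicE lead_coef0 eq_sym oner_eq0.
have : size (minPoly 1 x) = size P by rewrite PE size_map_poly.
rewrite size_minPoly => <-; rewrite ltnS.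
rewrite -[adjoin_degree _ _]muln1 -[X in (_ * X)%N](dimv1 F) -dim_Fadjoin.
exact/dimvS/subvf.
Qed.

Lemma algV (K : fieldType) (F : fieldExtType K) (c : K) :
  (c^-1)%:A = (c%:A)^-1 :> F.
Proof. exact: (fmorphV (in_alg F)). Qed.

Lemma algM (K : fieldType) (F : fieldExtType K) (c d : K) :
  (c * d)%:A = c%:A * d%:A :> F.
Proof. exact: (rmorphM (in_alg F)). Qed.

Lemma algXz (K : fieldType) (F : fieldExtType K) (c : K) (n : int) :
  (c ^ n)%:A = (c%:A) ^ n :> F.
Proof. exact: (fmorphXz (in_alg F)). Qed.

Lemma alg_eq0 (K : fieldType) (F : fieldExtType K) (c : K) :
  (c%:A == 0 :> F) = (c == 0).
Proof. by rewrite scaler_eq0 oner_eq0 orbF. Qed.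

Lemma alg_sum (K : fieldType) (F : fieldExtType K) (m : nat) (f : 'I_m -> K) :
  (\sum_i f i)%:A = \sum_i (f i)%:A :> F.
Proof. exact: (rmorph_sum (in_alg F)). Qed.

Lemma algX (K : fieldType) (F : fieldExtType K) (c : K) (m : nat) :
  (c ^+ m)%:A = c%:A ^+ m :> F.
Proof. exact: (rmorphXn (in_alg F)). Qed.

(** * Localization and gluing *)

Section Localization.
Variables (A : comPzRingType) (f : A).

(** The pair (a, n) stands for a / f^n. The factor f^k keeps the relation transitive when f is a
    zero divisor. *)
Definition loc_rel (x y : A * nat) : bool :=
  `[< exists k, f ^+ (k + y.2) * x.1 = f ^+ (k + x.2) * y.1 >].

Fact loc_rel_refl : reflexive loc_rel.
Proof. by move=> x; apply/asboolP; exists 0%N. Qed.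

Fact loc_rel_sym : symmetric loc_rel.
Proof.
by move=> x y; apply/asboolP/asboolP=> -[k e]; exists k.
Qed.

Fact loc_rel_trans : transitive loc_rel.
Proof.
move=> y x z /asboolP[k exy] /asboolP[l eyz]; apply/asboolP.
exists (k + l + y.2)%N; move: exy eyz; rewrite !exprD.
move: (f ^+ k) (f ^+ l) (f ^+ x.2) (f ^+ y.2) (f ^+ z.2) => K1 L1 X Y Z exy eyz.
transitivity (L1 * Z * (K1 * Y * x.1)); first by ring.
rewrite exy; transitivity (K1 * X * (L1 * Z * y.1)); first by ring.
by rewrite eyz; ring.
Qed.

Canonical loc_equiv := EquivRel loc_rel loc_rel_refl loc_rel_sym loc_rel_trans.

Definition loc := {eq_quot loc_rel}.
HB.instance Definition _ := Choice.on loc.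

Definition loc_frac (a : A) (n : nat) : loc := \pi_({eq_quot loc_rel}) (a, n).

Lemma loc_fracP a m b n :
  loc_frac a m = loc_frac b n <-> exists k, f ^+ (k + n) * a = f ^+ (k + m) * b.
Proof.
split=> [/eqquotP/asboolP//|e]; exact/eqquotP/asboolP.
Qed.

Lemma loc_ind (x : loc) : exists a n, x = loc_frac a n.
Proof. by exists (repr x).1, (repr x).2; rewrite /loc_frac -surjective_pairing reprK. Qed.

Definition loc_add (x y : loc) : loc :=
  loc_frac (f ^+ (repr y).2 * (repr x).1 + f ^+ (repr x).2 * (repr y).1)
    ((repr x).2 + (repr y).2).
Definition loc_mul (x y : loc) : loc :=
  loc_frac ((repr x).1 * (repr y).1) ((repr x).2 + (repr y).2).
Definition loc_opp (x : loc) : loc := loc_frac (- (repr x).1) (repr x).2.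

Lemma loc_repr a n : exists k,
  f ^+ (k + n) * (repr (loc_frac a n)).1 = f ^+ (k + (repr (loc_frac a n)).2) * a.
Proof. by apply/loc_fracP; rewrite /loc_frac -surjective_pairing reprK. Qed.

Lemma loc_addE a m b n :
  loc_add (loc_frac a m) (loc_frac b n) =
  loc_frac (f ^+ n * a + f ^+ m * b) (m + n).
Proof.
rewrite /loc_add; have [k] := loc_repr a m; have [l] := loc_repr b n.
case: (repr _) => b' n'; case: (repr _) => a' m' /=.
move=> eb ea; apply/loc_fracP; exists (k + l)%N; move: ea eb; rewrite !exprD.
move: (f ^+ k) (f ^+ l) (f ^+ m) (f ^+ n) (f ^+ m') (f ^+ n').
move=> k1 l1 m1 n1 m2 n2 ea eb.
transitivity (l1 * n1 * n2 * (k1 * m1 * a') + k1 * m1 * m2 * (l1 * n1 * b')).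
  by ring.
by rewrite ea eb; ring.
Qed.

Lemma loc_mulE a m b n :
  loc_mul (loc_frac a m) (loc_frac b n) = loc_frac (a * b) (m + n).
Proof.
rewrite /loc_mul; have [k] := loc_repr a m; have [l] := loc_repr b n.
case: (repr _) => b' n'; case: (repr _) => a' m' /=.
move=> eb ea; apply/loc_fracP; exists (k + l)%N; move: ea eb; rewrite !exprD.
move: (f ^+ k) (f ^+ l) (f ^+ m) (f ^+ n) (f ^+ m') (f ^+ n').
move=> k1 l1 m1 n1 m2 n2 ea eb.
transitivity ((k1 * m1 * a') * (l1 * n1 * b')); first by ring.
by rewrite ea eb; ring.
Qed.

Lemma loc_oppE a m : loc_opp (loc_frac a m) = loc_frac (- a) m.
Proof.
rewrite /loc_opp; have [k] := loc_repr a m.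
case: (repr _) => a' m' /= ea; apply/loc_fracP; exists k.
by rewrite !mulrN ea.
Qed.

Lemma loc_frac_eq a m b n : f ^+ n * a = f ^+ m * b -> loc_frac a m = loc_frac b n.
Proof. by move=> e; apply/loc_fracP; exists 0%N. Qed.

Fact loc_addA : associative loc_add.
Proof.
move=> x y z; have [a [m ->]] := loc_ind x; have [b [n ->]] := loc_ind y.
have [c [p ->]] := loc_ind z; rewrite !loc_addE; apply: loc_frac_eq.
by rewrite !exprD; ring.
Qed.
Fact loc_addC : commutative loc_add.
Proof.
move=> x y; have [a [m ->]] := loc_ind x; have [b [n ->]] := loc_ind y.
by rewrite !loc_addE; apply: loc_frac_eq; rewrite !exprD; ring.
Qed.
Fact loc_add0 : left_id (loc_frac 0 0) loc_add.
Proof.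
move=> x; have [a [m ->]] := loc_ind x; rewrite !loc_addE; apply: loc_frac_eq.
by rewrite !exprD expr0; ring.
Qed.
Fact loc_addN : left_inverse (loc_frac 0 0) loc_opp loc_add.
Proof.
move=> x; have [a [m ->]] := loc_ind x.
by rewrite loc_oppE loc_addE; apply: loc_frac_eq; rewrite !exprD expr0; ring.
Qed.

HB.instance Definition _ :=
  GRing.isZmodule.Build loc loc_addA loc_addC loc_add0 loc_addN.

Fact loc_mulA : associative loc_mul.
Proof.
move=> x y z; have [a [m ->]] := loc_ind x; have [b [n ->]] := loc_ind y.
have [c [p ->]] := loc_ind z; rewrite !loc_mulE; apply: loc_frac_eq.
by rewrite !exprD; ring.
Qed.
Fact loc_mulC : commutative loc_mul.
Proof.
move=> x y; have [a [m ->]] := loc_ind x; have [b [n ->]] := loc_ind y.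
by rewrite !loc_mulE; apply: loc_frac_eq; rewrite !exprD; ring.
Qed.
Fact loc_mul1 : left_id (loc_frac 1 0) loc_mul.
Proof.
move=> x; have [a [m ->]] := loc_ind x; rewrite !loc_mulE; apply: loc_frac_eq.
by rewrite !exprD expr0; ring.
Qed.
Fact loc_mulDl : left_distributive loc_mul loc_add.
Proof.
move=> x y z; have [a [m ->]] := loc_ind x; have [b [n ->]] := loc_ind y.
have [c [p ->]] := loc_ind z; rewrite loc_addE !loc_mulE loc_addE.
by apply: loc_frac_eq; rewrite !exprD; ring.
Qed.

HB.instance Definition _ := GRing.Zmodule_isComPzRing.Build loc
  loc_mulA loc_mulC loc_mul1 loc_mulDl.

Definition loc_incl (a : A) : loc := loc_frac a 0.

Fact loc_incl_zmod : zmod_morphism loc_incl.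
Proof.
move=> a b; transitivity (loc_add (loc_incl a) (loc_opp (loc_incl b))) => //.
by rewrite /loc_incl loc_oppE loc_addE; apply: loc_frac_eq; rewrite !expr0; ring.
Qed.
Fact loc_incl_monoid : monoid_morphism loc_incl.
Proof. by split=> // a b; rewrite [RHS]loc_mulE. Qed.

HB.instance Definition _ := GRing.isZmodMorphism.Build _ _ loc_incl loc_incl_zmod.
HB.instance Definition _ :=
  GRing.isMonoidMorphism.Build _ _ loc_incl loc_incl_monoid.

End Localization.

Definition loc_alg (R : comNzRingType) (A : algebra R) (f : A) : algebra R :=
  @Algebra R (loc f) (@loc_incl A f \o str A).

Definition loc_hom (R : comNzRingType) (A : algebra R) (f : A) :
    algHom A (loc_alg f) :=
  @AlgHom R A (loc_alg f) (@loc_incl A f) (fun=> erefl).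

Lemma loc_homP (R : comNzRingType) (A : algebra R) (f : A) :
  is_localization f (loc_hom f).
Proof.
split=> [|x|a /= /loc_fracP[k]].
- exists (loc_frac f 1 1); rewrite /= [LHS]loc_mulE; apply: loc_frac_eq.
  by rewrite expr1 expr0; ring.
- have [a [n ->]] := loc_ind x; exists a, n; rewrite -rmorphXn [LHS]loc_mulE.
  by apply: loc_frac_eq; rewrite addn0 expr0; ring.
- by rewrite mulr0 addn0 => e; exists k.
Qed.

Lemma mulr_exp_inv (A : comPzRingType) (x y : A) n :
  x * y = 1 -> x ^+ n * y ^+ n = 1.
Proof. by move=> xy; rewrite -exprMn xy expr1n. Qed.

(** Each b is l(a) / l(f)^n for a chosen pair (a, n), and u(b) = g(a) z^n. The kernel of l is killed
    by powers of f, which g makes invertible; hence the choice is immaterial and u is a morphism. *)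
Lemma loc_lift (R : comNzRingType) (A B C : algebra R) (f : A) (l : algHom A B)
    (g : algHom A C) (z : C) :
  is_localization f l -> g f * z = 1 -> exists u : algHom B C, u \o l =1 g.
Proof.
case=> [[y fy] lsurj lker] gz.
have rep b : exists an : A * nat, b * l f ^+ an.2 = l an.1.
  by have [a [n e]] := lsurj b; exists (a, n).
pose an b := projT1 (cid (rep b)).
have anE b : b * l f ^+ (an b).2 = l (an b).1 := projT2 (cid (rep b)).
pose u b := g (an b).1 * z ^+ (an b).2.
have cancel n (c c' : C) : c * g f ^+ n = c' * g f ^+ n -> c = c'.
  move=> e; rewrite -[c]mulr1 -[c']mulr1 -(mulr_exp_inv n gz).
  by rewrite !mulrA e.
have uE b a n : b * l f ^+ n = l a -> u b * g f ^+ n = g a.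
  move=> e; have [|k ek] := lker ((an b).1 * f ^+ n - a * f ^+ (an b).2).
    rewrite rmorphB !rmorphM !rmorphXn -anE -e.
    by rewrite -!mulrA [X in _ - b * X]mulrC subrr.
  rewrite /u.
  have {}ek : g (an b).1 * g f ^+ n = g a * g f ^+ (an b).2.
    move/(congr1 g): ek; rewrite rmorphM rmorphB !rmorphM !rmorphXn rmorph0.
    rewrite mulrC => ek; apply: (cancel k); apply/eqP.
    by rewrite -subr_eq0 -mulrBl ek.
  by rewrite mulrAC ek -mulrA mulr_exp_inv ?mulr1.
have ul a : u (l a) = g a.
  by have := uE (l a) a 0%N; rewrite !expr0 !mulr1; apply.
have uD : zmod_morphism u.
  move=> b b'; apply: (cancel ((an b).2 + (an b').2)%N).
  rewrite (uE _ ((an b).1 * f ^+ (an b').2 - (an b').1 * f ^+ (an b).2)).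
    rewrite rmorphB !rmorphM !rmorphXn -(uE b _ _ (anE b)).
    by rewrite -(uE b' _ _ (anE b')) exprD; ring.
  rewrite rmorphB !rmorphM !rmorphXn -!anE exprD; ring.
have uM : monoid_morphism u.
  split=> [|b b']; first by rewrite -(rmorph1 l) ul rmorph1.
  apply: (cancel ((an b).2 + (an b').2)%N).
  rewrite (uE _ ((an b).1 * (an b').1)).
    rewrite !rmorphM -(uE b _ _ (anE b)).
    by rewrite -(uE b' _ _ (anE b')) exprD; ring.
  by rewrite !rmorphM -!anE exprD; ring.
pose uz := GRing.isZmodMorphism.Build _ _ u uD.
pose um := GRing.isMonoidMorphism.Build _ _ u uM.
pose U : {rmorphism B -> C} := HB.pack u uz um.
have US r : U (str B r) = str C r by rewrite -(alg_homE l) [LHS]ul alg_homE.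
by exists (AlgHom US).
Qed.

Definition ideal_like (A : comPzRingType) (I : A -> Prop) : Prop :=
  [/\ I 0, forall x y, I x -> I y -> I (x + y) & forall x y, I y -> I (x * y)].

Lemma ideal_sum (A : comPzRingType) (I : A -> Prop) (J : Type) (r : seq J)
    (P : pred J) (F : J -> A) :
  ideal_like I -> (forall j, P j -> I (F j)) -> I (\sum_(j <- r | P j) F j).
Proof. by case=> I0 ID IM IF; elim/big_ind: _. Qed.

(** The radical of I is an ideal containing S, hence contains 1, all of whose powers are 1. *)
Lemma unit_ideal_radical (A : comPzRingType) (S I : A -> Prop) :
  ideal_like I -> unit_ideal S -> (forall a, S a -> exists N, I (a ^+ N)) -> I 1.
Proof.
move=> idI [n [b [a [Sa e]]]] SI; have [I0 ID IM] := idI.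
have IX x m k : I (x ^+ m) -> I (x ^+ (k + m)) by rewrite exprD => /IM.
have radD x y : (exists N, I (x ^+ N)) -> (exists N, I (y ^+ N)) ->
    exists N, I ((x + y) ^+ N).
  case=> [N IN] [M IM']; exists (N + M)%N; rewrite exprDn.
  apply: (ideal_sum _ idI) => i _; rewrite -mulr_natr mulrC; apply: (IM).
  have [Mi|iM] := leqP M i.
    by apply: (IM); rewrite -(subnK Mi); apply: IX.
  rewrite mulrC; apply: (IM); rewrite -addnBA; last exact: ltnW.
  by rewrite addnC; apply: IX.
have radM x y : (exists N, I (y ^+ N)) -> exists N, I ((x * y) ^+ N).
  by case=> N IN; exists N; rewrite exprMn; apply: IM.
have : exists N, I (1 ^+ N).
  rewrite -e; elim/big_ind: _ => [||i _]; first by exists 1%N.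
    exact: radD.
  exact/radM/SI.
by case=> N; rewrite expr1n.
Qed.

Section Gluing.
Variables (R : comNzRingType) (A : algebra R) (n : nat) (f : 'I_n -> A).
Variables (B : 'I_n -> algebra R) (l : forall i, algHom A (B i)).
Hypothesis f1 : unit_ideal (fun a => exists i, a = f i).
Hypothesis lP : forall i, is_localization (f i) (l i).

(** The annihilator of y - y' is an ideal which contains a power of each f i. *)
Lemma glue_unique (y y' : A) : (forall i, l i y = l i y') -> y = y'.
Proof.
move=> e; apply/eqP; rewrite -subr_eq0 -[_ - _]mul1r; apply/eqP.
apply: (@unit_ideal_radical A _ (fun z => z * (y - y') = 0) _ f1).
  split=> [|u w eu ew|u w ew]; first by rewrite mul0r.
    by rewrite mulrDl eu ew addr0.
  by rewrite -mulrA ew mulr0.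
move=> _ [i ->]; have [_ _] := lP i; apply.
by rewrite rmorphB e subrr.
Qed.

Lemma glue (x : forall i, B i) :
  (forall i j (C : algebra R) (u : algHom (B i) C) (w : algHom (B j) C),
     u \o l i =1 w \o l j -> u (x i) = w (x j)) ->
  exists y : A, forall i, l i y = x i.
Proof.
move=> xP.
(* The z such that the local sections z * x i glue form an ideal, which contains
   a power of each f i. *)
pose I z := exists y : A, forall i, l i y = l i z * x i.
suff [y yP] : I 1 by exists y => i; rewrite yP rmorph1 mul1r.
apply: (unit_ideal_radical _ f1).
  split=> [|u w [y ey] [y' ey']|u w [y ey]].
  - by exists 0 => i; rewrite !rmorph0 mul0r.
  - by exists (y + y') => i; rewrite !rmorphD mulrDl ey ey'.
  - by exists (u * y) => i; rewrite !rmorphM -mulrA ey.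
move=> _ [i ->]; have [[z fz] lsurj _] := lP i.
have [a [m e]] := lsurj (x i).
have NP j : exists N, l j (f i) ^+ N * (l j (f i) ^+ m * x j - l j a) = 0.
  (* [C] is A[1/(f_i f_j)], the overlap of the two charts, where x i and x j agree. The kernel of
     [w] is killed by powers of l_j(f_i). *)
  pose C := loc_alg (l j (f i)); pose w := loc_hom (l j (f i)).
  have wP : is_localization _ w := loc_homP _.
  have [[c wc] _ wker] := wP.
  have wl r : [eta w \o l j] (str A r) = str C r by rewrite /= alg_homE.
  have [u ul] := loc_lift (lP i) (wc : AlgHom wl (f i) * c = 1).
  apply: wker; rewrite rmorphB rmorphM rmorphXn -(xP i j C u w ul).
  rewrite -[w (l j (f i))]ul -[w (l j a)]ul /= -rmorphXn -rmorphM mulrC e subrr//.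
pose N := (\max_j projT1 (cid (NP j)))%N.
exists (N + m)%N, (f i ^+ N * a) => j.
apply/eqP; rewrite eq_sym -subr_eq0 !rmorphM !rmorphXn exprD -mulrA -mulrBr.
have Nj : (projT1 (cid (NP j)) <= N)%N by apply: leq_bigmax.
by rewrite -(subnK Nj) exprD -mulrA (projT2 (cid (NP j))) mulr0.
Qed.

End Gluing.

(** * Principal open subsets of the affine line *)

Section Peval.
Variable R : comNzRingType.

Definition peval (B : algebra R) (t : B) (P : {poly R}) : B :=
  \sum_(i < size P) str B P`_i * t ^+ i.

Lemma pevalE (B : algebra R) (t : B) (P : {poly R}) n :
  (size P <= n)%N -> peval t P = \sum_(i < n) str B P`_i * t ^+ i.
Proof.
move=> Pn; rewrite [RHS](bigID (fun i : 'I_n => (i < size P)%N))/=.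
rewrite [X in _ = _ + X]big1 ?addr0 => [|i]; last first.
  by rewrite -leqNgt => /(nth_default 0)->; rewrite rmorph0 mul0r.
by rewrite /peval (big_ord_widen _ (fun i => str B P`_i * t ^+ i) Pn).
Qed.

Fact peval_zmod (B : algebra R) (t : B) : zmod_morphism (peval t).
Proof.
move=> P Q; pose n := maxn (size P) (size Q).
rewrite !(@pevalE B t _ n) ?leq_maxl ?leq_maxr//; last first.
  by rewrite (leq_trans (size_polyD _ _))// size_polyN.
rewrite -sumrB; apply: eq_bigr => i _.
by rewrite coefB rmorphB mulrBl.
Qed.

HB.instance Definition _ (B : algebra R) (t : B) :=
  GRing.isZmodMorphism.Build {poly R} B (peval t) (peval_zmod t).

Lemma pevalC (B : algebra R) (t : B) c : peval t c%:P = str B c.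
Proof.
rewrite (@pevalE B t _ 1) ?size_polyC_leq1//.
by rewrite big_ord1 coefC mulr1.
Qed.

Lemma pevalMX (B : algebra R) (t : B) P : peval t (P * 'X) = peval t P * t.
Proof.
rewrite (@pevalE B t _ (size P).+1) ?(leq_trans (size_polyMleq _ _))//; last first.
  by rewrite size_polyX addn2.
rewrite big_ord_recl coefMX rmorph0 mul0r add0r mulr_suml.
by apply: eq_bigr => i _; rewrite coefMX exprSr mulrA.
Qed.

Lemma pevalX (B : algebra R) (t : B) : peval t 'X = t.
Proof. by rewrite -['X]mul1r pevalMX pevalC rmorph1 mul1r. Qed.

Lemma pevalCM (B : algebra R) (t : B) c P :
  peval t (c%:P * P) = str B c * peval t P.
Proof.
rewrite mul_polyC (@pevalE B t _ (size P)) ?size_scale_leq// mulr_sumr.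
by apply: eq_bigr => i _; rewrite coefZ rmorphM mulrA.
Qed.

Fact peval_monoid (B : algebra R) (t : B) : monoid_morphism (peval t).
Proof.
split=> [|P Q]; first by rewrite -[1]/(1%:P) pevalC rmorph1.
elim/poly_ind: P => [|P c IH]; first by rewrite mul0r raddf0 mul0r.
by rewrite mulrDl !raddfD/= mulrAC !pevalMX pevalCM IH pevalC mulrDl mulrAC.
Qed.

HB.instance Definition _ (B : algebra R) (t : B) :=
  GRing.isMonoidMorphism.Build {poly R} B (peval t) (peval_monoid t).

Lemma peval_nat (B C : algebra R) (f : algHom B C) (t : B) P :
  f (peval t P) = peval (f t) P.
Proof.
rewrite rmorph_sum; apply: eq_bigr => i _.
by rewrite rmorphM rmorphXn alg_homE.
Qed.

Definition poly_alg : algebra R := @Algebra R {poly R} (@polyC R).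

Definition peval_hom (B : algebra R) (t : B) : algHom poly_alg B :=
  @AlgHom R poly_alg B (peval t) (pevalC t).

End Peval.

Section PrincipalOpen.
Variables (R : comNzRingType) (g : {poly R}).

(** Points of the open subscheme D(g) of the affine line: pairs (t, s) where s is the inverse of
    g(t), hence determined by t. *)
Definition dopen_pts (B : algebra R) : Type :=
  {u : B * B | u.2 * peval u.1 g == 1}.

Fact dopen_map_subproof (B C : algebra R) (f : algHom B C) (u : dopen_pts B) :
  (f (val u).2) * peval (f (val u).1) g == 1.
Proof. by rewrite -peval_nat -rmorphM (eqP (valP u)) rmorph1. Qed.

Definition dopen_map (B C : algebra R) (f : algHom B C) (u : dopen_pts B) :
    dopen_pts C :=
  exist _ (f (val u).1, f (val u).2) (dopen_map_subproof f u).

Definition dopen : functor R.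
Proof.
refine (@Functor R dopen_pts dopen_map _ _).
- by move=> A f [[t s] ts] fid; apply: val_inj; rewrite /= !fid.
- by move=> A B C f h k [[t s] ts] hgf; apply: val_inj; rewrite /= !hgf.
Defined.

Lemma dopen_sheaf : zariski_sheaf dopen.
Proof.
move=> A n f B l f1 lP x xP.
have [i j C u w e|t tP] := @glue R A n f B l f1 lP (fun i => (val (x i)).1).
  by have /(congr1 (fun z => (val z).1)) := xP i j C u w e.
have [i j C u w e|s sP] := @glue R A n f B l f1 lP (fun i => (val (x i)).2).
  by have /(congr1 (fun z => (val z).2)) := xP i j C u w e.
have ts : s * peval t g == 1.
  apply/eqP/(glue_unique f1 lP) => i; rewrite rmorphM peval_nat tP sP rmorph1.
  exact/eqP/(valP (x i)).
exists (exist _ (t, s) ts); split=> [i|[[t' s'] ts'] e].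
  by apply: val_inj; rewrite /= tP sP -surjective_pairing.
apply: val_inj; congr pair; apply: (glue_unique f1 lP) => i.
  by rewrite tP -(e i).
by rewrite sP -(e i).
Qed.

Definition dopen_ring : algebra R := @loc_alg R (poly_alg R) g.

Let X : dopen_ring := loc_incl g ('X : poly_alg R).
Let Y : dopen_ring := loc_frac g 1 1.

Let gY : Y * loc_hom (g : poly_alg R) g = 1.
Proof.
rewrite [LHS]loc_mulE; apply: loc_frac_eq.
by rewrite expr1 expr0; ring.
Qed.

Lemma loc_fracE (A : comPzRingType) (f : A) a n :
  loc_frac f a n = loc_incl f a * loc_frac f 1 1 ^+ n.
Proof.
have -> : loc_frac f 1 1 ^+ n = loc_frac f 1 n.
  elim: n => [|n IH]; first exact: loc_frac_eq.
  by rewrite exprS IH [LHS]loc_mulE mulr1.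
by rewrite [RHS]loc_mulE mulr1.
Qed.

Lemma dopen_univ_subproof : Y * peval X g == 1.
Proof.
rewrite -(peval_nat (loc_hom (g : poly_alg R)) 'X).
suff pX (P : {poly R}) : peval ('X : poly_alg R) P = P by rewrite pX; apply/eqP/gY.
elim/poly_ind: P => [|P c IH]; first by rewrite /peval size_poly0 big_ord0.
by rewrite rmorphD/= pevalMX pevalC IH.
Qed.

Definition dopen_univ : dopen dopen_ring := exist _ (X, Y) dopen_univ_subproof.

Lemma dopen_ring_ext (B : algebra R) (f h : algHom dopen_ring B) :
  f X = h X -> f Y = h Y -> f =1 h.
Proof.
move=> eX eY z; have [a [n ->]] := loc_ind z.
rewrite loc_fracE !rmorphM !rmorphXn -/Y eY; congr (_ * _).
elim/poly_ind: a => [|P c IH]; first by rewrite !rmorph0.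
rewrite !(rmorphD, rmorphM) /= IH eX; congr (_ + _).
by have := alg_homE f c; have := alg_homE h c; rewrite /= => -> ->.
Qed.

Lemma dopen_ring_lift (B : algebra R) (t s : B) : s * peval t g = 1 ->
  exists f : algHom dopen_ring B, f X = t /\ f Y = s.
Proof.
move=> ts; have ts' : (peval_hom t) g * s = 1 by rewrite mulrC.
have [f fE] := loc_lift (loc_homP (g : poly_alg R)) ts'; exists f; split.
  by have := fE 'X; rewrite /= => ->; rewrite pevalX.
have /(congr1 f) := gY; rewrite rmorphM rmorph1 [f (loc_hom _ _)]fE /= => e.
by rewrite -[LHS]mulr1 -ts mulrCA [f Y * _]e mulr1.
Qed.

Lemma dopen_spec : is_spec (fun A (_ : dopen A) => True) dopen_ring.
Proof.
exists dopen_univ; split=> [B [[t s] /= ts]|B f h].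
  split=> // _; have [f [fX fY]] := dopen_ring_lift (eqP ts); exists f.
  by apply: val_inj; rewrite /= fX fY.
move=> e; apply: dopen_ring_ext.
  by have /(congr1 (fun z => (val z).1)) := e.
by have /(congr1 (fun z => (val z).2)) := e.
Qed.

Lemma dopen_cover :
  affine_cover (fun (_ : unit) A (_ : dopen A) => True) (fun=> dopen_ring).
Proof.
split=> [_ A x|_|F x _]; last by exists tt.
  exists (fun=> True) => B f; split=> // _; exists 1%N, (fun=> 1), (fun=> 1).
  by split=> [_|]; [exists 1; rewrite ?rmorph1|rewrite big_ord1 mulr1].
exact: dopen_spec.
Qed.

Section PolyEval.
Variables (n : nat) (A : algebra R) (a : 'I_n -> A).

Lemma poly_evalE (s : seq (mpoly.multinom n)) (q : mpoly.mpoly n R) :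
  uniq s -> {subset mpoly.msupp q <= s} ->
  poly_eval a q = \sum_(m <- s)
    str A (mpoly.mcoeff m q) * \prod_(i < n) a i ^+ (mpoly.fun_of_multinom m i).
Proof.
move=> us qs; rewrite [RHS](bigID (mem (mpoly.msupp q)))/=.
rewrite [X in _ = _ + X]big1 ?addr0 => [|m mq]; last first.
  by rewrite mpoly.memN_msupp_eq0// rmorph0 mul0r.
rewrite -big_filter; apply: perm_big; apply: uniq_perm.
- exact: mpoly.msupp_uniq.
- exact: filter_uniq.
- move=> m; rewrite mem_filter; case: (boolP (m \in mpoly.msupp q)) => //.
  by move/qs ->.
Qed.

Lemma poly_eval_is_zmod : zmod_morphism (@poly_eval R A n a).
Proof.
move=> p q; pose s := undup (mpoly.msupp p ++ mpoly.msupp q ++ mpoly.msupp (p - q)).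
rewrite !(@poly_evalE s) ?undup_uniq//; try by
  move=> m; rewrite mem_undup !mem_cat => ->; rewrite ?orbT.
rewrite -sumrB; apply: eq_bigr => m _.
by rewrite mpoly.mcoeffB rmorphB mulrBl.
Qed.

HB.instance Definition _ := GRing.isZmodMorphism.Build _ _ (@poly_eval R A n a)
  poly_eval_is_zmod.

Lemma poly_evalZX c m : poly_eval a (c *: mpoly.mpolyX R m) =
  str A c * \prod_(i < n) a i ^+ (mpoly.fun_of_multinom m i).
Proof.
rewrite (@poly_evalE [:: m])// => [|m'].
  by rewrite big_seq1 mpoly.mcoeffZ mpoly.mcoeffX eqxx mulr1.
rewrite mpoly.mcoeff_msupp mpoly.mcoeffZ mpoly.mcoeffX inE.
by rewrite [m' == m]eq_sym; case: (m == m') => //; rewrite mulr0 eqxx.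
Qed.

End PolyEval.

Let mon (i j : nat) : mpoly.multinom 2 := mpoly.Multinom [tuple i; j].

(** The polynomial y g(x) - 1, which alone presents R[x][1/g]. *)
Let q : mpoly.mpoly 2 R :=
  \sum_(k < size g) g`_k *: mpoly.mpolyX R (mon k 1) - 1 *: mpoly.mpolyX R (mon 0 0).

Let poly_evalq (B : algebra R) (b : 'I_2 -> B) :
  poly_eval b q = b (lift ord0 ord0) * peval (b ord0) g - 1.
Proof.
rewrite /q raddfB raddf_sum /= poly_evalZX rmorph1 mul1r; congr (_ - _).
  rewrite mulr_sumr; apply: eq_bigr => k _.
  rewrite poly_evalZX big_ord_recl big_ord1 /mpoly.fun_of_multinom/=.
  by rewrite !(tnth_nth 0%N)/= expr1; ring.
rewrite big1// => i _; rewrite /mpoly.fun_of_multinom (tnth_nth 0%N)/=.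
by case: i => [[|[|//]]] /=.
Qed.

Lemma dopen_fp : finitely_presented dopen_ring.
Proof.
exists 2%N, 1%N, (fun i => if i == ord0 then X else Y), (fun=> q); split.
  by move=> _; rewrite poly_evalq/= (eqP dopen_univ_subproof) subrr.
move=> B b /(_ ord0); rewrite poly_evalq => /eqP; rewrite subr_eq0 => /eqP bP.
split=> [|f h fh].
  have [f [fX fY]] := dopen_ring_lift bP; exists f => i.
  case: eqP => [->//|i0]; rewrite fY; congr b; apply: val_inj => /=.
  by case: i i0 => [[|[|//]]] //= ? /eqP.
by apply: dopen_ring_ext; [exact: (fh ord0)|exact: (fh (lift ord0 ord0))].
Qed.

(** A lift s' of s is inverse to g(t') up to an error e with e^2 = 0, and s' (1 + e) is an exact
    inverse. *)
Lemma dopen_formally_smooth : formally_smooth dopen.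
Proof.
move=> A B f fsurj fnil [[t s] /= ts].
have [t' t'E] := fsurj t; have [s' s'E] := fsurj s.
pose e := 1 - s' * peval t' g.
have fe : f e = 0.
  by rewrite rmorphB rmorphM rmorph1 s'E peval_nat t'E (eqP ts) subrr.
have ee := fnil _ _ fe fe.
have ts' : (s' + s' * e) * peval t' g == 1.
  apply/eqP; transitivity (1 - e * e); last by rewrite ee subr0.
  by rewrite /e; ring.
exists (exist _ (t', s' + s' * e) ts'); apply: val_inj => /=.
by rewrite rmorphD rmorphM fe mulr0 addr0 t'E s'E.
Qed.

Lemma dopen_smooth : smooth_scheme dopen.
Proof.
split; last exact: dopen_formally_smooth.
  split; first exact: dopen_sheaf.
  by exists unit, (fun _ A _ => True), (fun=> dopen_ring); exact: dopen_cover.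
exists unit, (fun _ A _ => True), (fun=> dopen_ring); split.
  exact: dopen_cover.
by move=> _; exact: dopen_fp.
Qed.

End PrincipalOpen.

(** * Power series and formal curves *)

Section Truncation.
Variable R : comNzRingType.

Lemma take_polyMl m (p q : {poly R}) :
  take_poly m (take_poly m p * q) = take_poly m (p * q).
Proof.
apply/polyP => i; rewrite !coef_take_poly; case: ifP => // im.
rewrite !coefM; apply: eq_bigr => j _.
by rewrite coef_take_poly (leq_ltn_trans _ im) ?leq_ord.
Qed.

Lemma take_polyMr m (p q : {poly R}) :
  take_poly m (p * take_poly m q) = take_poly m (p * q).
Proof. by rewrite mulrC take_polyMl mulrC. Qed.

Lemma take_poly_take m n (p : {poly R}) : (m <= n)%N ->
  take_poly m (take_poly n p) = take_poly m p.
Proof.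
move=> mn; apply/polyP => i; rewrite !coef_take_poly; case: ifP => // im.
by rewrite (leq_trans im mn).
Qed.

Variable m : nat.

Definition size_le : {pred {poly R}} := fun p => (size p <= m)%N.

Fact size_le_zmod : zmod_closed size_le.
Proof.
split=> [|p q]; rewrite !unfold_in /size_le ?size_poly0// => pm qm.
by rewrite (leq_trans (size_polyD _ _))// size_polyN geq_max pm.
Qed.
HB.instance Definition _ := GRing.isZmodClosed.Build {poly R} size_le size_le_zmod.

(** The ring R[X]/(X^m), each class being represented by its polynomial of degree less than m. *)
Record trunc := Trunc { trunc_poly : {poly R}; _ : trunc_poly \in size_le }.
HB.instance Definition _ := [isSub for trunc_poly].
HB.instance Definition _ := [Choice of trunc by <:].
HB.instance Definition _ := [SubChoice_isSubZmodule of trunc by <:].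

Fact take_poly_size_le p : take_poly m p \in size_le.
Proof. exact: size_take_poly. Qed.

Definition trunc_of (p : {poly R}) : trunc := Trunc (take_poly_size_le p).

Lemma trunc_ofK (x : trunc) : trunc_of (val x) = x.
Proof. by apply: val_inj; rewrite /= take_poly_id//; case: x. Qed.

Definition trunc_mul (x y : trunc) : trunc := trunc_of (val x * val y).

Fact trunc_mulA : associative trunc_mul.
Proof.
by move=> x y z; apply: val_inj; rewrite /= take_polyMl take_polyMr mulrA.
Qed.
Fact trunc_mulC : commutative trunc_mul.
Proof. by move=> x y; apply: val_inj; rewrite /= mulrC. Qed.
Fact trunc_mul1 : left_id (trunc_of 1) trunc_mul.
Proof.
by move=> x; rewrite -[RHS]trunc_ofK; apply: val_inj; rewrite /= take_polyMl mul1r.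
Qed.
Fact trunc_mulDl : left_distributive trunc_mul +%R.
Proof. by move=> x y z; apply: val_inj; rewrite /= mulrDl take_polyD. Qed.

HB.instance Definition _ := GRing.Zmodule_isComPzRing.Build trunc
  trunc_mulA trunc_mulC trunc_mul1 trunc_mulDl.

Fact trunc_of_zmod : zmod_morphism trunc_of.
Proof.
move=> p q; apply: val_inj; apply/polyP => i.
by rewrite /= !(coefB, coef_take_poly); case: ifP; rewrite ?subr0.
Qed.
Fact trunc_of_monoid : monoid_morphism trunc_of.
Proof.
by split=> // p q; apply: val_inj; rewrite /= take_polyMl take_polyMr.
Qed.
HB.instance Definition _ := GRing.isZmodMorphism.Build _ _ trunc_of trunc_of_zmod.
HB.instance Definition _ :=
  GRing.isMonoidMorphism.Build _ _ trunc_of trunc_of_monoid.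

Definition trunc_alg : algebra R := @Algebra R trunc (trunc_of \o @polyC R).

End Truncation.

Section TruncationMap.
Variables (R : comNzRingType) (m n : nat).
Hypothesis mn : (m <= n)%N.

(* The hypothesis is a phantom argument, on which the morphism structure below
   can depend. *)
Definition retrunc_fun of (m <= n)%N := fun (x : trunc R n) => trunc_of m (val x).

Fact retrunc_zmod : zmod_morphism (retrunc_fun mn).
Proof. by move=> x y; rewrite /retrunc_fun !raddfB. Qed.
Fact retrunc_monoid : monoid_morphism (retrunc_fun mn).
Proof.
split=> [|x y]; first by apply: val_inj; rewrite /= take_poly_take.
rewrite /retrunc_fun -rmorphM; apply: val_inj => /=.
by rewrite take_poly_take.
Qed.
HB.instance Definition _ :=
  GRing.isZmodMorphism.Build _ _ (retrunc_fun mn) retrunc_zmod.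
HB.instance Definition _ :=
  GRing.isMonoidMorphism.Build _ _ (retrunc_fun mn) retrunc_monoid.

Fact retrunc_homE r : retrunc_fun mn (str (trunc_alg R n) r) = str (trunc_alg R m) r.
Proof. by apply: val_inj; rewrite /= take_poly_take. Qed.

Definition retrunc : algHom (trunc_alg R n) (trunc_alg R m) :=
  @AlgHom R (trunc_alg R n) (trunc_alg R m) (retrunc_fun mn) retrunc_homE.

End TruncationMap.

Section Series.
Variable R : comNzRingType.

Record fps := Fps { coef : nat -> R }.

HB.instance Definition _ := gen_eqMixin fps.
HB.instance Definition _ := gen_choiceMixin fps.

Implicit Types x y : fps.

Lemma fps_ext x y : coef x =1 coef y -> x = y.
Proof. by case: x y => [a] [b] /= /funext ->. Qed.

Definition fps_add x y := Fps (fun k => coef x k + coef y k).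
Definition fps_opp x := Fps (fun k => - coef x k).
Definition fps0 := Fps (fun=> 0).
Definition fps_mul x y :=
  Fps (fun k => \sum_(i < k.+1) coef x i * coef y (k - i)%N).
Definition fpsC (c : R) := Fps (fun k => if k == 0%N then c else 0).

Fact fps_addA : associative fps_add.
Proof. by move=> x y z; apply: fps_ext => k; exact: addrA. Qed.
Fact fps_addC : commutative fps_add.
Proof. by move=> x y; apply: fps_ext => k; exact: addrC. Qed.
Fact fps_add0 : left_id fps0 fps_add.
Proof. by move=> x; apply: fps_ext => k; exact: add0r. Qed.
Fact fps_addN : left_inverse fps0 fps_opp fps_add.
Proof. by move=> x; apply: fps_ext => k; exact: addNr. Qed.

HB.instance Definition _ :=
  GRing.isZmodule.Build fps fps_addA fps_addC fps_add0 fps_addN.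

Definition fps_take (m : nat) x : {poly R} := \poly_(i < m) coef x i.

(** The multiplicative laws of power series are checked on all truncations, where they are those of
    polynomials. *)
Lemma fps_take_inj x y : (forall m, fps_take m x = fps_take m y) -> x = y.
Proof.
move=> e; apply: fps_ext => k; have /(congr1 (fun p : {poly R} => p`_k)) := e k.+1.
by rewrite !coef_poly ltnSn.
Qed.

Lemma fps_takeM m x y :
  fps_take m (fps_mul x y) = take_poly m (fps_take m x * fps_take m y).
Proof.
apply/polyP => k; rewrite coef_take_poly coef_poly; case: ifP => // km.
rewrite coefM; apply: eq_bigr => i _; rewrite !coef_poly.
by rewrite (leq_ltn_trans _ km) ?leq_ord// (leq_ltn_trans (leq_subr _ _) km).
Qed.

Lemma fps_takeD m x y :
  fps_take m (fps_add x y) = fps_take m x + fps_take m y.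
Proof.
by apply/polyP => k; rewrite coefD !coef_poly; case: ifP; rewrite ?addr0.
Qed.

Lemma fps_takeC m c : fps_take m (fpsC c) = take_poly m c%:P.
Proof.
by apply/polyP => k; rewrite coef_take_poly coef_poly coefC.
Qed.

Fact fps_mulA : associative fps_mul.
Proof.
move=> x y z; apply: fps_take_inj => m.
by rewrite !fps_takeM take_polyMl take_polyMr mulrA.
Qed.
Fact fps_mulC : commutative fps_mul.
Proof. by move=> x y; apply: fps_take_inj => m; rewrite !fps_takeM mulrC. Qed.
Fact fps_mul1 : left_id (fpsC 1) fps_mul.
Proof.
move=> x; apply: fps_take_inj => m.
by rewrite fps_takeM fps_takeC take_polyMl mul1r take_poly_id ?size_poly.
Qed.
Fact fps_mulDl : left_distributive fps_mul fps_add.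
Proof.
move=> x y z; apply: fps_take_inj => m.
by rewrite !(fps_takeM, fps_takeD) mulrDl take_polyD.
Qed.

HB.instance Definition _ := GRing.Zmodule_isComPzRing.Build fps
  fps_mulA fps_mulC fps_mul1 fps_mulDl.

Lemma coefM_fps x y k :
  coef (x * y) k = \sum_(i < k.+1) coef x i * coef y (k - i)%N.
Proof. by []. Qed.
Lemma coef1_fps k : coef 1 k = (k == 0%N)%:R.
Proof. by rewrite /= ; case: eqP. Qed.

Fact fpsC_zmod : zmod_morphism fpsC.
Proof.
by move=> a b; apply: fps_ext => k /=; case: ifP; rewrite ?subr0.
Qed.
Fact fpsC_monoid : monoid_morphism fpsC.
Proof.
split=> // a b; apply: fps_take_inj => m.
by rewrite fps_takeM !fps_takeC take_polyMl take_polyMr polyCM.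
Qed.
HB.instance Definition _ := GRing.isZmodMorphism.Build _ _ fpsC fpsC_zmod.
HB.instance Definition _ :=
  GRing.isMonoidMorphism.Build _ _ fpsC fpsC_monoid.

Lemma coef_sum_fps (I : Type) (r : seq I) (P : pred I) (F : I -> fps) k :
  coef (\sum_(i <- r | P i) F i) k = \sum_(i <- r | P i) coef (F i) k.
Proof. exact: (big_morph (fun x => coef x k)). Qed.

Lemma coefMC_fps x c k : coef (x * fpsC c) k = coef x k * c.
Proof.
rewrite coefM_fps big_ord_recr /= subnn eqxx big1 ?add0r// => i _.
by rewrite subn_eq0 leqNgt ltn_ord mulr0.
Qed.

Definition fps_alg : algebra R := @Algebra R fps fpsC.

End Series.

Section SeriesMap.
Variables (R S : comNzRingType) (phi : {rmorphism R -> S}).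

Definition fps_map (x : fps R) : fps S := Fps (phi \o coef x).

Fact fps_map_zmod : zmod_morphism fps_map.
Proof. by move=> x y; apply: fps_ext => k; exact: rmorphB. Qed.
Fact fps_map_monoid : monoid_morphism fps_map.
Proof.
split=> [|x y]; apply: fps_ext => k /=.
  by case: ifP; rewrite ?rmorph1 ?rmorph0.
by rewrite rmorph_sum; apply: eq_bigr => i _; rewrite rmorphM.
Qed.
HB.instance Definition _ :=
  GRing.isZmodMorphism.Build _ _ fps_map fps_map_zmod.
HB.instance Definition _ :=
  GRing.isMonoidMorphism.Build _ _ fps_map fps_map_monoid.

Lemma fps_mapC c : fps_map (fpsC c) = fpsC (phi c).
Proof. by apply: fps_ext => k /=; case: ifP; rewrite ?rmorph0. Qed.

End SeriesMap.

(** * Series with bounded denominators and the Gauss lemma *)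

Section BoundedSeries.
Variables (K : fieldType) (v : dvaluation K).

(** These are the integral series with a uniformizer inverted, the counterpart of O[[s]] on the
    generic fibre. The bound provides coefficients of least valuation. *)
Definition bounded : {pred fps K} :=
  fun x => `[< exists N : int, forall k, vge v N (coef x k) >].

Lemma boundedP (x : fps K) :
  reflect (exists N : int, forall k, vge v N (coef x k)) (x \in bounded).
Proof. exact: asboolP. Qed.

Fact bounded_subring : subring_closed bounded.
Proof.
split=> [|x y|x y]; rewrite ?unfold_in.
- apply/boundedP; exists 0 => k; rewrite coef1_fps.
  by case: (k == 0%N); rewrite ?vge0// vgeE ?oner_eq0// dval1.
- move=> /boundedP[M xM] /boundedP[N yN]; apply/boundedP.
  exists (Num.min M N) => k; apply: vgeB.
    by apply: vge_le (xM k); rewrite ge_min lexx.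
  by apply: vge_le (yN k); rewrite ge_min lexx orbT.
- move=> /boundedP[M xM] /boundedP[N yN]; apply/boundedP; exists (M + N) => k.
  by apply: vge_sum => i _; apply: vgeM.
Qed.

HB.instance Definition _ := GRing.isSubringClosed.Build (fps K) bounded
  bounded_subring.

Record bfps := BFps { bfps_val : fps K; _ : bfps_val \in bounded }.
HB.instance Definition _ := [isSub for bfps_val].
HB.instance Definition _ := [Choice of bfps by <:].
HB.instance Definition _ := GRing.SubChoice_isSubComPzRing.Build (fps K) bounded
  bfps bounded_subring.

Fact fpsC_bounded c : fpsC c \in bounded.
Proof.
apply/boundedP; exists (v c) => k /=; case: ifP => _; last exact: vge0.
by rewrite /vge lexx orbT.
Qed.

Definition bfpsC (c : K) : bfps := BFps (fpsC_bounded c).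

Fact bfpsC_zmod : zmod_morphism bfpsC.
Proof. by move=> a b; apply: val_inj; rewrite /= rmorphB. Qed.
Fact bfpsC_monoid : monoid_morphism bfpsC.
Proof. by split=> [|a b]; apply: val_inj; rewrite //= rmorphM. Qed.
HB.instance Definition _ := GRing.isZmodMorphism.Build _ _ bfpsC bfpsC_zmod.
HB.instance Definition _ :=
  GRing.isMonoidMorphism.Build _ _ bfpsC bfpsC_monoid.

Definition bfps_alg : algebra K := @Algebra K bfps bfpsC.

(* Gauss' lemma: if i and j are the first indices where the coefficients of u and
   w have the least valuation, then the terms of the coefficient of index i + j of
   u * w other than u_i w_j have a larger valuation. *)
Lemma bounded_unit_integral (u w : fps K) :
  u \in bounded -> w \in bounded -> u * w = 1 -> coef u 0 = 1 ->
  forall k, vge v 0 (coef u k).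
Proof.
move=> /boundedP[M uM] /boundedP[N wN] uw u0 k.
have w0 : coef w 0 = 1.
  have /(congr1 (fun x => coef x 0)) := uw.
  by rewrite coefM_fps coef1_fps big_ord1 u0 mul1r.
have n0 (x : fps K) : coef x 0 = 1 -> coef x 0 != 0 by move=> ->; exact: oner_neq0.
have [i [ui0 ui uj]] := @vge_min_attained _ v _ _ _ (n0 u u0) uM.
have [j [wj0 wj wl]] := @vge_min_attained _ v _ _ _ (n0 w w0) wN.
have iij : (i < (i + j).+1)%N by rewrite ltnS leq_addr.
pose F (a : 'I_(i + j).+1) := coef u a * coef w (i + j - a)%N.
have Fi : F (Ordinal iij) = coef u i * coef w j by rewrite /F /= addKn.
have Fv : v (F (Ordinal iij)) = v (coef u i) + v (coef w j) by rewrite Fi dvalM.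
have Fi0 : F (Ordinal iij) != 0 by rewrite Fi mulf_neq0.
have [|s0 sE] := @dval_sum_dominant _ v _ _ _ Fi0.
  move=> a ai; rewrite Fv /F; have [lt|gt|eq] := ltngtP a i.
  - by rewrite addrAC; apply: vgeM; [exact: uj|exact: wj].
  - rewrite -addrA; apply: vgeM; [exact: ui|apply: wl].
    by have := ltn_ord a; lia.
  - by case/eqP: ai; apply: val_inj.
have /(congr1 (fun x => coef x (i + j)%N)) := uw.
rewrite coefM_fps coef1_fps -/(F _) => e.
(* The coefficient of index i + j of u w = 1 is nonzero, hence i + j = 0 and the two least
   valuations add up to 0. Neither is positive, as u and w have constant term 1, so both vanish. *)
move: s0 sE; rewrite e; case: (eqVneq (i + j)%N 0%N) => [ij _|_ /eqP//].
rewrite Fv -[true%:R]/(1 : K) dval1 => vij.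
have vi : v (coef u i) <= 0 by have := ui 0%N; rewrite u0 vgeE ?oner_eq0// dval1.
have vj : v (coef w j) <= 0 by have := wj 0%N; rewrite w0 vgeE ?oner_eq0// dval1.
by apply: vge_le (ui k); lia.
Qed.

End BoundedSeries.

Section AlgHomComp.
Variables (R : comNzRingType) (A B C : algebra R).

Fact alg_comp_subproof (g : algHom B C) (f : algHom A B) r :
  (g \o f) (str A r) = str C r.
Proof. by rewrite /= !alg_homE. Qed.

Definition alg_comp (g : algHom B C) (f : algHom A B) : algHom A C :=
  @AlgHom R A C (g \o f) (alg_comp_subproof g f).

Definition alg_id : algHom A A := @AlgHom R A A idfun (fun=> erefl).

Lemma fmap_alg_comp (X : functor R) (g : algHom B C) (f : algHom A B) (x : X A) :
  fmap (alg_comp g f) x = fmap g (fmap f x).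
Proof. exact: fmap_comp. Qed.

End AlgHomComp.

Lemma fmap_eq (R : comNzRingType) (X : functor R) (A B : algebra R)
    (f g : algHom A B) (x : X A) : f =1 g -> fmap f x = fmap g x.
Proof.
move=> fg; rewrite (fmap_comp (f := alg_id A) (g := g)) ?(fmap_id (f := alg_id A))//.
Qed.

Lemma gmap_eq (R : comNzRingType) (X : gfunctor R) (A B : algebra R)
    (f g : algHom A B) (x : X A) : f =1 g -> gmap f x = gmap g x.
Proof. exact: (@fmap_eq _ (underlying X)). Qed.

Section TruncDual.
Variable R : comNzRingType.

Section Maps.
Variable m : nat.

Definition trunc_const (x : trunc R m.+1) : R := (val x)`_0.

Fact trunc_const_zmod : zmod_morphism trunc_const.
Proof. by move=> x y; rewrite /trunc_const raddfB coefB. Qed.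
Fact trunc_const_monoid : monoid_morphism trunc_const.
Proof.
split=> [|x y]; rewrite /trunc_const/= coef_take_poly/= ?coefC//.
by rewrite coefM big_ord1.
Qed.
HB.instance Definition _ :=
  GRing.isZmodMorphism.Build _ _ trunc_const trunc_const_zmod.
HB.instance Definition _ :=
  GRing.isMonoidMorphism.Build _ _ trunc_const trunc_const_monoid.

Fact trunc_const_homE r : trunc_const (str (trunc_alg R m.+1) r) = str (base R) r.
Proof. by rewrite /trunc_const/= coef_take_poly coefC. Qed.

Lemma trunc_unit (x : trunc R m.+1) (b : R) : trunc_const x * b = 1 ->
  exists y, y * x = 1.
Proof.
(* The constant term of z is zero, so z is nilpotent and 1 - z = b x is inverted by a geometric
   series. *)
move=> xb; pose z := 1 - trunc_of m.+1 b%:P * x.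
suff zm : z ^+ m.+1 = 0.
  exists ((\sum_(i < m.+1) z ^+ i) * trunc_of m.+1 b%:P); rewrite -mulrA.
  have -> : trunc_of m.+1 b%:P * x = - (z - 1) by rewrite /z; ring.
  by rewrite mulrN mulrC -subrX1 zm sub0r opprK.
have : (1 - b%:P * val x)`_0 = 0.
  by rewrite coefB coefC coefCM/= mulrC xb subrr.
have [q [c e]] : exists q c, 1 - b%:P * val x = q * 'X + c%:P.
  move: (1 - _) => P; elim/poly_ind: P => [|P c _]; last by exists P, c.
  by exists 0, 0; rewrite mul0r addr0.
rewrite e coefD coefMX coefC add0r => /= c0.
have -> : z = trunc_of m.+1 (q * 'X).
  rewrite /z -[x in LHS]trunc_ofK -rmorphM -(rmorph1 (trunc_of m.+1)) -rmorphB.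
  by rewrite e c0 addr0.
by rewrite -rmorphXn exprMn; apply: val_inj; rewrite /= take_polyMXn_0.
Qed.

End Maps.

Definition trunc_dual (x : trunc R 2) : dualnum R := Dual (val x)`_0 (val x)`_1.

Fact trunc_dual_zmod : zmod_morphism trunc_dual.
Proof. by move=> x y; rewrite /trunc_dual raddfB !coefB. Qed.
Fact trunc_dual_monoid : monoid_morphism trunc_dual.
Proof.
split=> [|x y]; congr Dual; rewrite /= coef_take_poly/= ?coefC ?coefM//.
  by rewrite big_ord1.
by rewrite big_ord_recr big_ord1.
Qed.
HB.instance Definition _ :=
  GRing.isZmodMorphism.Build _ _ trunc_dual trunc_dual_zmod.
HB.instance Definition _ :=
  GRing.isMonoidMorphism.Build _ _ trunc_dual trunc_dual_monoid.

Fact trunc_dual_homE r : trunc_dual (str (trunc_alg R 2) r) = str (dual_alg R) r.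
Proof. by rewrite /trunc_dual/= !coef_take_poly !coefC. Qed.

Definition trunc_dual_hom : algHom (trunc_alg R 2) (dual_alg R) :=
  @AlgHom R (trunc_alg R 2) (dual_alg R) trunc_dual trunc_dual_homE.

Definition fps_dual (x : fps R) : dualnum R := Dual (coef x 0) (coef x 1).

Fact fps_dual_zmod : zmod_morphism fps_dual. Proof. by []. Qed.
Fact fps_dual_monoid : monoid_morphism fps_dual.
Proof.
split=> // x y; congr Dual => /=; first by rewrite big_ord1.
by rewrite big_ord_recr big_ord1.
Qed.
HB.instance Definition _ :=
  GRing.isZmodMorphism.Build _ _ fps_dual fps_dual_zmod.
HB.instance Definition _ :=
  GRing.isMonoidMorphism.Build _ _ fps_dual fps_dual_monoid.

Definition fps_dual_hom : algHom (fps_alg R) (dual_alg R) :=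
  @AlgHom R (fps_alg R) (dual_alg R) fps_dual (fun=> erefl).

End TruncDual.

(** * Lifting a tangent vector to a formal curve *)

Section FormalCurve.
Variables (R : comNzRingType) (F : algebra R).
Hypothesis fieldF : is_field F.
Hypothesis local : forall a : R, str F a <> 0 -> exists b, a * b = 1.
Variable X : functor R.
Hypothesis (schX : is_scheme X) (smX : formally_smooth X).
Variable x0 : X (dual_alg R).

(** With this shift [Tr 0] is R[s]/(s^2), the ring of dual numbers, so that the curve starts from
    the tangent vector itself. *)
Local Notation Tr m := (trunc_alg R m.+2).

Let step m : algHom (Tr m.+1) (Tr m) := retrunc R (leqnSn m.+2).

Let start : exists x : X (Tr 0), fmap (trunc_dual_hom R) x = x0.
Proof.
apply: smX => [[b c]|x y].
  exists (trunc_of 2 (b%:P + c *: 'X)); rewrite /= /trunc_dual/=.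
  by rewrite !coef_take_poly !(coefD, coefC, coefZ, coefX)/= ?mulr0 ?mulr1 ?addr0 ?add0r.
move=> /= [x0' x1] _; suff -> : x = 0 by rewrite mul0r.
apply: val_inj; apply/polyP => -[|[|i]]; rewrite coef0 //.
by apply: nth_default; have := valP x; rewrite /size_le => /leq_trans; apply.
Qed.

(** The kernel of [step m] is spanned by s^(m+2), whose square vanishes modulo s^(m+3). *)
Let lift m (x : X (Tr m)) : exists x' : X (Tr m.+1), fmap (step m) x' = x.
Proof.
apply: smX => [x'|a b /= ea eb].
  exists (trunc_of m.+3 (val x')); apply: val_inj => /=.
  by rewrite take_poly_take// take_poly_id//; exact: (valP x').
have low (c : trunc R m.+3) : retrunc_fun (leqnSn m.+2) c = 0 ->
    forall i, (i < m.+2)%N -> (val c)`_i = 0.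
  move=> /(congr1 (fun z => (val z))) /= ec i im.
  by have := congr1 (fun p : {poly R} => p`_i) ec; rewrite coef_take_poly im coef0.
apply: val_inj; apply/polyP => i; rewrite coef0 /= coef_take_poly.
case: ifP => // im; rewrite coefM big1// => j _.
have [jm|jm] := ltnP j m.+2; first by rewrite (low _ ea)// mul0r.
by rewrite (low _ eb) ?mulr0//; lia.
Qed.

Let Fixpoint xs m : X (Tr m) :=
  if m is m'.+1 return X (Tr m) then projT1 (cid (lift (xs m'))) else projT1 (cid start).

Let xs0 : fmap (trunc_dual_hom R) (xs 0) = x0 := projT2 (cid start).
Let xsS m : fmap (step m) (xs m.+1) = xs m := projT2 (cid (lift (xs m))).

Let toF (m : nat) : algHom (trunc_alg R m.+1) F :=
  @AlgHom R (trunc_alg R m.+1) F (str F \o @trunc_const R m)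
    (fun r => congr1 (str F) (trunc_const_homE m r)).

Let xF : X F := fmap (toF 1) (xs 0).

Let xsF m : fmap (toF m.+1) (xs m) = xF.
Proof.
elim: m => // m <-; rewrite -(xsS m) -fmap_alg_comp; apply: fmap_eq => a /=.
by rewrite /trunc_const /= coef_take_poly.
Qed.

(* The successive liftings x_m all lie in an affine open subscheme containing the
   image xF of the closed point, since the truncated rings are local. *)
Lemma formal_curve : exists y : X (fps_alg R), fmap (fps_dual_hom R) y = x0.
Proof.
have [_ [J [U [A [Uopen Uspec Ucov]]]]] := schX.
have [i Ui] := Ucov F xF fieldF.
(* The pullback of U_i is D(I), and it contains the point xF: some element of I is nonzero in F. Its
   constant coefficient is then a unit of R, and it is itself a unit of the truncated ring. *)
have Um m : U i (Tr m) (xs m).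
  have [I IP] := Uopen i (Tr m) (xs m).
  have := (IP F (toF m.+1)).1; rewrite xsF => /(_ Ui)[n [b [a [Ia ba]]]].
  have [j ja] : exists j, a j <> 0.
    apply: contrapT => /forallNP a0; apply: fieldF.1.
    by rewrite -ba big1// => j _; have /contrapT -> := a0 j; rewrite mulr0.
  have [c Ic ac] := Ia j.
  have [r rc] : exists r, trunc_const c * r = 1 by apply: local; rewrite ac in ja.
  have [d dc] := trunc_unit rc.
  have := (IP (Tr m) (alg_id _)).2; rewrite (fmap_id (f := alg_id _))//; apply.
  exists 1%N, (fun=> d), (fun=> c); split=> [_|]; first by exists c.
  by rewrite big_ord1.
have [u [uP uinj]] := Uspec i.
have phiP m := (uP _ (xs m)).1 (Um m).
pose phi m := projT1 (cid (phiP m)).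
have phiE m : fmap (phi m) u = xs m := projT2 (cid (phiP m)).
have phiS m a : step m (phi m.+1 a) = phi m a.
  by apply: (uinj _ (alg_comp (step m) (phi m.+1)) (phi m)); rewrite fmap_alg_comp !phiE xsS.
have coefle k m a : (k <= m)%N -> (val (phi m a))`_k = (val (phi k a))`_k.
  elim: m => [|m IH]; first by rewrite leqn0 => /eqP->.
  rewrite leq_eqVlt => /orP[/eqP->//|km]; rewrite -IH// -(phiS m) /= coef_take_poly.
  by have -> : (k < m.+2)%N by lia.
(* The morphisms [phi m] from the coordinate ring are compatible; the coefficient of index k of
   their limit is read at level k. *)
pose f a : fps R := Fps (fun k => (val (phi k a))`_k).
have fD : zmod_morphism f.
  by move=> a b; apply: fps_ext => k; rewrite /f/= rmorphB; exact: coefB.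
have fM : monoid_morphism f.
  split=> [|a b]; apply: fps_ext => k; rewrite /f/= ?rmorph1 ?rmorphM/=.
    by rewrite coef_take_poly/= coefC ltnS leqnSn; case: eqP.
  rewrite coef_take_poly ltnS leqnSn coefM; apply: eq_bigr => j _.
  by rewrite (coefle j)// ?(coefle (k - j)%N)// ?leq_subr// -ltnS.
pose fz := GRing.isZmodMorphism.Build _ _ f fD.
pose fm := GRing.isMonoidMorphism.Build _ _ f fM.
pose f' : {rmorphism A i -> fps R} := HB.pack f fz fm.
have fS r : f' (str (A i) r) = str (fps_alg R) r.
  apply: fps_ext => k /=; rewrite alg_homE /= coef_take_poly ltnS leqnSn coefC.
  by case: eqP.
pose h : algHom (A i) (fps_alg R) :=
  @AlgHom R (A i) (fps_alg R) f' fS.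
exists (fmap h u); rewrite -fmap_alg_comp -xs0 -phiE -fmap_alg_comp.
apply: fmap_eq => a /=; congr Dual.
by rewrite -(phiS 0%N) /= coef_take_poly.
Qed.

End FormalCurve.

(** * Tangent vectors of the Weil restriction *)

Section TensorInjection.
Variables (K : fieldType) (L : fieldExtType K).
Local Notation e := (vbasis {:L}).

Section One.
Variable A : algebra K.

Lemma tensorM_coord (x y : tensor L A) k :
  (x * y) 0 k = \sum_i \sum_j x 0 i * y 0 j * str A (coord e k (e`_i * e`_j)).
Proof. by rewrite [LHS]mxE. Qed.

Lemma tensor_inclE l k : tensor_incl A l 0 k = str A (coord e k l).
Proof. by rewrite mxE. Qed.

Lemma tensorZl (a : A) (x y : tensor L A) :
  ((a *: (x : 'rV[A]_ _) : tensor L A) * y) = a *: ((x * y : tensor L A) : 'rV[A]_ _).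
Proof.
apply/rowP => k; rewrite [RHS]mxE !tensorM_coord mulr_sumr; apply: eq_bigr => i _.
by rewrite mulr_sumr; apply: eq_bigr => j _; rewrite mxE !mulrA.
Qed.

Lemma tensor_injM (a : A) (y : tensor L A) :
  tensor_inj L a * y = a *: (y : 'rV[A]_ _).
Proof.
by rewrite /tensor_inj tensorZl; congr (_ *: _); exact: tensor_mul1.
Qed.

Fact tensor_inj_zmod : zmod_morphism (@tensor_inj K L A).
Proof. by move=> a b; rewrite /tensor_inj scalerBl. Qed.
Fact tensor_inj_monoid : monoid_morphism (@tensor_inj K L A).
Proof.
split=> [|a b]; first by rewrite /tensor_inj scale1r.
by rewrite tensor_injM /tensor_inj scalerA.
Qed.
HB.instance Definition _ :=
  GRing.isZmodMorphism.Build A (tensor L A) (@tensor_inj K L A) tensor_inj_zmod.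
HB.instance Definition _ :=
  GRing.isMonoidMorphism.Build A (tensor L A) (@tensor_inj K L A) tensor_inj_monoid.

Lemma tensor_decomp (x : tensor L A) :
  x = \sum_i tensor_inj L (x 0 i) * tensor_incl A e`_i.
Proof.
apply/rowP => k; rewrite summxE (bigD1 k)//= tensor_injM mxE tensor_inclE.
rewrite coord_free ?(basis_free (vbasisP _))// eqxx rmorph1 mulr1.
rewrite big1 ?addr0// => j jk; rewrite tensor_injM mxE tensor_inclE.
rewrite coord_free ?(basis_free (vbasisP _))//.
by rewrite (negbTE jk) rmorph0 mulr0.
Qed.

End One.

Lemma tensor_map_inj (A B : algebra K) (f : algHom A B) a :
  tensor_map (L := L) f (tensor_inj L a) = tensor_inj L (f a).
Proof.
by apply/rowP => k; rewrite !mxE rmorphM alg_homE.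
Qed.

Lemma vbasis_coord (l : L) : l = \sum_i coord e i l *: e`_i.
Proof. exact/coord_vbasis/memvf. Qed.

End TensorInjection.

Section DualEps.
Variable A : comPzRingType.
Fact dn_eps_zmod : zmod_morphism (@dn_eps A). Proof. by []. Qed.
HB.instance Definition _ := GRing.isZmodMorphism.Build _ _ (@dn_eps A) dn_eps_zmod.
Lemma dn_re_sum n (F : 'I_n -> dualnum A) :
  dn_re (\sum_i F i) = \sum_i dn_re (F i).
Proof. exact: (rmorph_sum (@dn_re A)). Qed.
Lemma dn_eps_sum n (F : 'I_n -> dualnum A) :
  dn_eps (\sum_i F i) = \sum_i dn_eps (F i).
Proof. exact: (raddf_sum (@dn_eps A)). Qed.

End DualEps.

(** * The Lie algebra of a model inside M (x)_K L *)

Section NeronLie.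
Variables (M : fieldType) (w : dvaluation M) (T : gfunctor M) (N : neron_lft w T).
Variables (K : fieldType) (L : fieldExtType K) (phi : {rmorphism K -> M}).

Local Notation e := (vbasis {:L}).
Local Notation n := (\dim {:L}).
Local Notation O := (intring w).
Local Notation incl := (int_incl w).
Local Notation tens A := (tensor L (restr phi A)).
Local Notation tinj A := (@tensor_inj K L (restr phi A)).

(* [theta] identifies T with the torus of units of A (x)_K L. This covers both the
   Weil restriction over K = M and its base change to an extension M of K. *)
Variable theta : forall A : algebra M, T A -> units (tens A).
Hypothesis theta_inj : forall A, injective (@theta A).
Hypothesis theta_surj : forall A u, exists x, @theta A x = u.
Hypothesis thetaM : forall A, {morph @theta A : x y / (x * y)%g}.
Hypothesis theta_nat : forall (A B : algebra M) (f : algHom A B) x,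
  theta (gmap f x) = units_map (@tensor_map K L _ _ (restr_hom phi f)) (theta x).

Let theta1 A : theta (1 : T A)%g = 1%g.
Proof. by apply: (@mulgI _ (theta (1 : T A)%g)); rewrite -thetaM !mulg1. Qed.

Let gen1 A : nr_generic N A 1%g = 1%g.
Proof.
by apply: (@mulgI _ (nr_generic N A 1%g)); rewrite -nr_genericM !mulg1.
Qed.

Let gmap1 (R : comNzRingType) (G : gfunctor R) A B (f : algHom A B) :
  gmap f (1 : G A)%g = 1%g.
Proof. by apply: (@mulgI _ (gmap f (1 : G A)%g)); rewrite -gmapM !mulg1. Qed.

Definition gpoint (A : algebra M) (x : N (restr incl A)) : units (tens A) :=
  theta (nr_generic N A x).

Lemma gpointM A (x y : N (restr incl A)) : gpoint (x * y)%g = (gpoint x * gpoint y)%g.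
Proof. by rewrite /gpoint -thetaM -nr_genericM. Qed.

Lemma gpoint1 A : gpoint (1 : N (restr incl A))%g = 1%g.
Proof. by rewrite /gpoint (gen1 A) theta1. Qed.

Lemma gpoint_nat (A B : algebra M) (f : algHom A B) (x : N (restr incl A)) :
  gpoint (gmap (restr_hom incl f) x) =
  units_map (@tensor_map K L _ _ (restr_hom phi f)) (gpoint x).
Proof.
rewrite /gpoint -theta_nat; congr theta.
exact: (ntmapE (nr_generic N) f).
Qed.

Lemma gpoint_inj A : injective (@gpoint A).
Proof. by move=> x y /theta_inj/(bij_inj (nr_generic_bij N A)). Qed.

(** By separatedness x = y defines a closed V(I). Equality over B means that j kills I, and then I
    is zero by injectivity. *)
Lemma gpoint_sep (A : algebra O) (B : algebra M) (j : algHom A (restr incl B))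
    (x y : N A) :
  injective j -> gpoint (gmap j x) = gpoint (gmap j y) -> x = y.
Proof.
move=> jinj /gpoint_inj e; have [I IP] := @nr_separated _ _ _ N A x y.
have I0 := (IP _ j).1 e.
have := (IP A (alg_id A)).2; rewrite !(@fmap_id _ _ _ (alg_id A))//; apply.
by move=> a /I0 ja; apply: jinj; rewrite /= ja rmorph0.
Qed.

Definition lie_gen (x : N (dual_alg O)) : units (tens (dual_alg M)) :=
  gpoint (gmap (dual_hom incl) x).

Definition dre (x : tens (dual_alg M)) : tens (base M) := map_mx (@dn_re M) x.
Definition deps (x : tens (dual_alg M)) : tens (base M) := map_mx (@dn_eps M) x.

Lemma deps_ext x y : dre x = dre y -> deps x = deps y -> x = y.
Proof.
move=> /rowP r /rowP s; apply/rowP => i; have := r i; have := s i.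
by rewrite !mxE; case: (x 0 i) (y 0 i) => [a b] [c d] /= -> ->.
Qed.

Lemma dreM x y : dre (x * y) = dre x * dre y.
Proof.
apply/rowP => k; rewrite mxE (tensorM_coord x y) (tensorM_coord (dre x) (dre y)).
rewrite [LHS]dn_re_sum; apply: eq_bigr => i _.
rewrite [LHS]dn_re_sum; apply: eq_bigr => j _.
by rewrite !mxE.
Qed.

Lemma depsM x y : deps (x * y) = dre x * deps y + deps x * dre y.
Proof.
apply/rowP => k; rewrite mxE (tensorM_coord x y) [in RHS]mxE.
rewrite (tensorM_coord (dre x)) (tensorM_coord (deps x)).
rewrite -big_split [LHS]dn_eps_sum; apply: eq_bigr => i _.
rewrite -big_split [LHS]dn_eps_sum; apply: eq_bigr => j _ /=.
by rewrite !mxE mulr0 add0r mulrDl.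
Qed.

Lemma deps_scale (c : M) x :
  deps (tensor_map (restr_hom phi (scale_hom c)) x) = c *: (deps x : 'rV[M]_n).
Proof. by apply/rowP => k; rewrite !mxE. Qed.

Lemma lie_gen_dre x : lie x -> dre (val (lie_gen x)).1 = 1.
Proof.
move=> lx; pose j : algHom (base O) (restr incl (base M)) :=
  @AlgHom O (base O) (restr incl (base M)) incl (fun=> erefl).
have e1 : gmap (restr_hom incl (aug_hom M)) (gmap (dual_hom incl) x) =
    (1 : N (restr incl (base M)))%g.
  rewrite -(gmap1 N j) -lx.
  rewrite -(gmap_comp (h := alg_comp (restr_hom incl (aug_hom M)) (dual_hom incl)))//.
  exact: gmap_comp.
have := gpoint_nat (aug_hom M) (gmap (dual_hom incl) x).
rewrite e1 gpoint1 => /(congr1 (fun u => (val u).1)); exact: esym.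
Qed.

Lemma lie_of_dre x : dre (val (lie_gen x)).1 = 1 -> lie x.
Proof.
move=> xre; pose j : algHom (base O) (restr incl (base M)) :=
  @AlgHom O (base O) (restr incl (base M)) incl (fun=> erefl).
apply: (@gpoint_sep _ _ j); first by move=> b c /val_inj.
rewrite (gmap1 N) gpoint1.
have -> : gmap j (gmap (aug_hom O) x) =
    gmap (restr_hom incl (aug_hom M)) (gmap (dual_hom incl) x).
  rewrite -(gmap_comp (h := alg_comp j (aug_hom O)))//.
  exact: gmap_comp.
by rewrite gpoint_nat; apply: units_inj.
Qed.

Lemma lie_genM x y : lie_gen (x * y)%g = (lie_gen x * lie_gen y)%g.
Proof. by rewrite /lie_gen gmapM gpointM. Qed.

(** The coordinates of a in the basis [vbasis] of L, for a tangent vector 1 + a eps. *)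
Definition lie_eps x : 'rV[M]_n := deps (val (lie_gen x)).1.

Lemma lie_epsD x y : lie x -> lie y -> lie_eps (x * y)%g = lie_eps x + lie_eps y.
Proof.
move=> lx ly; rewrite /lie_eps lie_genM /= depsM !lie_gen_dre// mul1r mulr1.
exact: addrC.
Qed.

Lemma lie_epsZ (c : O) x : lie_eps (lie_scale c x) = int_elt c *: lie_eps x.
Proof.
rewrite -deps_scale; congr (deps _); rewrite /lie_gen.
have -> : gmap (dual_hom incl) (lie_scale c x) =
    gmap (restr_hom incl (scale_hom (int_elt c))) (gmap (dual_hom incl) x).
  rewrite /lie_scale -(gmap_comp (h := alg_comp (dual_hom incl) (scale_hom c)))//.
  apply: gmap_comp => -[a b]; congr Dual; exact: rmorphM.
by rewrite gpoint_nat.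
Qed.

Lemma lie_eps_inj x y : lie x -> lie y -> lie_eps x = lie_eps y -> x = y.
Proof.
move=> lx ly exy; apply: (@gpoint_sep _ _ (dual_hom incl)).
  by move=> [a b] [c d] [ac bd]; congr Dual; apply: val_inj.
apply: units_inj; apply: deps_ext exy.
by have := lie_gen_dre lx; have := lie_gen_dre ly; rewrite /lie_gen => -> ->.
Qed.

Lemma lie1 : lie (1 : N (dual_alg O))%g.
Proof. exact: (gmap1 N). Qed.

Lemma lieM x y : lie x -> lie y -> lie (x * y : N (dual_alg O))%g.
Proof. by rewrite /lie gmapM => -> ->; rewrite mulg1. Qed.

Lemma lieZ c x : lie x -> lie (lie_scale c x : N (dual_alg O)).
Proof.
rewrite /lie /lie_scale => <-.
rewrite -(gmap_comp (h := alg_comp (aug_hom O) (scale_hom c)))//.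
exact: gmap_eq.
Qed.

Lemma lie_eps1 : lie_eps 1%g = 0.
Proof.
have := lie_epsD lie1 lie1; rewrite mulg1 => /eqP.
by rewrite -subr_eq subrr eq_sym => /eqP.
Qed.

(** * Tangent vectors are integral *)

Section Upper.
Variable F : algebra O.
Hypotheses (fieldF : is_field F)
  (resF : forall a : O, vge w 1 (int_elt a) -> str F a = 0).
Variables (F' : fieldType) (w' : dvaluation F').
Variables (f : {rmorphism M -> F'}) (g : {rmorphism L -> F'}).
Hypothesis fg : forall c : K, f (phi c) = g c%:A.
Hypothesis fw : forall a, vge w 0 a -> vge w' 0 (f a).

Let O_local (a : O) : str F a <> 0 -> exists b, a * b = 1.
Proof.
move=> Fa; have a0 : int_elt a != 0.
  by apply/eqP => a0; apply: Fa; apply: resF; rewrite a0 vge0.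
have wa : w (int_elt a) = 0.
  have : vge w 0 (int_elt a) := valP a; rewrite vgeE// => wa0.
  have : ~~ vge w 1 (int_elt a) by apply/negP => /resF.
  by rewrite vgeE//; lia.
have ai : (int_elt a)^-1 \in integral w.
  by rewrite -[_ \in _]/(vge w 0 _) vgeE ?invr_eq0// dvalV// wa.
by exists (IntRing ai); apply: val_inj; rewrite /= divff.
Qed.

(** Only integrality is transported by f, so the series is first made integral by a power of the
    uniformizer. *)
Let f_bounded (x : fps M) : x \in bounded w -> fps_map f x \in bounded w'.
Proof.
move=> /boundedP[m xm]; apply/boundedP.
have [pi pi0 wpi] := dval_uniformizer w.
exists (w' (f (pi ^ m)) + 0) => k /=.
have -> : coef x k = pi ^ m * (pi ^ (- m) * coef x k).
  by rewrite mulrA -expfzDr// subrr expr0z mul1r.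
rewrite rmorphM; apply: vgeM; first by rewrite /vge lexx orbT.
apply: fw; rewrite -[0](addNr m); apply: vgeM => //.
by rewrite vgeE ?expfz_neq0// dvalXz// wpi mul1r.
Qed.

Let incl_bounded (x : fps O) : fps_map incl x \in bounded w.
Proof. by apply/boundedP; exists 0 => k; exact: (valP (coef x k)). Qed.

Let fps_incl (x : fps O) : bfps w := BFps (incl_bounded x).

Fact fps_incl_zmod : zmod_morphism fps_incl.
Proof. by move=> x y; apply: val_inj; exact: (rmorphB (fps_map incl)). Qed.
Fact fps_incl_monoid : monoid_morphism fps_incl.
Proof.
split=> [|x y]; apply: val_inj; first exact: (rmorph1 (fps_map incl)).
exact: (rmorphM (fps_map incl)).
Qed.
HB.instance Definition _ := GRing.isZmodMorphism.Build _ _ fps_incl fps_incl_zmod.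
HB.instance Definition _ :=
  GRing.isMonoidMorphism.Build _ _ fps_incl fps_incl_monoid.

Fact fps_incl_homE r : fps_incl (str (fps_alg O) r) = str (restr incl (bfps_alg w)) r.
Proof. by apply: val_inj; exact: fps_mapC. Qed.

Let fps_incl_hom : algHom (fps_alg O) (restr incl (bfps_alg w)) :=
  @AlgHom O (fps_alg O) (restr incl (bfps_alg w)) fps_incl fps_incl_homE.

Let bfps_dual (x : bfps w) : dualnum M := fps_dual (val x).

Fact bfps_dual_zmod : zmod_morphism bfps_dual.
Proof. by move=> x y; exact: (rmorphB (@fps_dual M)). Qed.
Fact bfps_dual_monoid : monoid_morphism bfps_dual.
Proof.
split=> [|x y]; first exact: (rmorph1 (@fps_dual M)).
exact: (rmorphM (@fps_dual M)).
Qed.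
HB.instance Definition _ := GRing.isZmodMorphism.Build _ _ bfps_dual bfps_dual_zmod.
HB.instance Definition _ :=
  GRing.isMonoidMorphism.Build _ _ bfps_dual bfps_dual_monoid.

Let bfps_dual_hom : algHom (bfps_alg w) (dual_alg M) :=
  @AlgHom M (bfps_alg w) (dual_alg M) bfps_dual (fun=> erefl).

Lemma lie_upper x : lie x -> vge w' 0 (\sum_i f (lie_eps x 0 i) * g e`_i).
Proof.
move=> lx; have [schN _ smN] := nr_smooth N.
have [y yx] := formal_curve fieldF O_local schN smN x.
pose z := gpoint (gmap fps_incl_hom y : N (restr incl (bfps_alg w))).
have zx : lie_gen x = units_map (@tensor_map K L _ _ (restr_hom phi bfps_dual_hom)) z.
  rewrite -gpoint_nat; congr gpoint; rewrite -yx.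
  rewrite -(gmap_comp (h := alg_comp (dual_hom incl) (fps_dual_hom O)))//.
  by apply: gmap_comp => s; congr Dual.
(* The two morphisms to F'[[s]] agree on K, so they induce a morphism [h] on the tensor product with
   L. It carries units to units, and all its values have bounded coefficients. *)
pose F1 : {rmorphism restr phi (bfps_alg w) -> fps F'} :=
  fps_map f \o (val : {rmorphism bfps w -> fps M}).
pose G1 : {rmorphism L -> fps F'} := @fpsC F' \o g.
have FG c : F1 (str (restr phi (bfps_alg w)) c) = G1 c%:A.
  by rewrite /= -fg; exact: fps_mapC.
have [h [hF hG] _] := tensor_pushout FG.
have hE t k : coef (h t) k = \sum_i f (coef (val (t 0 i)) k) * g e`_i.
  rewrite {1}[t]tensor_decomp rmorph_sum coef_sum_fps; apply: eq_bigr => i _.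
  by rewrite rmorphM hF hG coefMC_fps.
have hb t : h t \in bounded w'.
  rewrite [t]tensor_decomp rmorph_sum; apply: rpred_sum => i _.
  rewrite rmorphM hF hG; apply: rpredM; last exact: fpsC_bounded.
  exact/f_bounded/(valP (t 0 i)).
have hz : h (val z).1 * h (val z).2 = 1 by rewrite -rmorphM (eqP (valP z)) rmorph1.
have -> : \sum_i f (lie_eps x 0 i) * g e`_i = coef (h (val z).1) 1.
  rewrite hE; apply: eq_bigr => i _; congr (f _ * _).
  by rewrite /lie_eps zx !mxE.
(* The constant term is the image of 1, because x reduces to the origin. *)
apply: (bounded_unit_integral _ _ hz) => //.
have := lie_gen_dre lx; rewrite zx => /rowP re1.
rewrite hE -[RHS](rmorph1 g) [in RHS](vbasis_coord 1) rmorph_sum.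
apply: eq_bigr => i _; rewrite -[_ *: _]mulr_algl rmorphM -fg; congr (f _ * _).
by have := re1 i; rewrite !mxE.
Qed.

End Upper.

(** * Integral elements are tangent vectors *)

Section Lower.
Variables (a : tens (base M)) (q : {poly O}).
Hypothesis qmonic : q \is monic.
Hypothesis qa : \sum_(k < size q) tinj (base M) (int_elt q`_k) * a ^+ k = 0.

(* If q has the roots a_m, then g(t) is the product of the 1 + t a_m, and is thus
   a multiple of 1 + t a. *)
Let r := (size q).-1.
Let g : {poly O} := \sum_(k < size q) q`_k *: (- 'X) ^+ (r - k).

Lemma peval_g (A : algebra O) (t : A) :
  peval t g = \sum_(k < size q) str A q`_k * (- t) ^+ (r - k).
Proof.
rewrite (rmorph_sum (peval t)); apply: eq_bigr => k _.
rewrite -mul_polyC (rmorphM (peval t)) (rmorphXn (peval t)) (rmorphN (peval t)).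
by rewrite /= pevalC pevalX.
Qed.

Section Point.
Variables (A : algebra M) (y : dopen g (restr incl A)).

Let t : A := (val y).1.
Let s : A := (val y).2.

Let toA : algHom (restr phi (base M)) (restr phi A) :=
  restr_hom phi (@AlgHom M (base M) A (str A) (fun=> erefl)).

Let b : tens A := - tinj A t * tensor_map toA a.

(** Multiplying q(a) = 0 by (-t)^r gives sum_k q_k (-t)^(r-k) b^k = 0, as b = -t a. Subtracted from
    g(t), this leaves the sum of the q_k (-t)^(r-k) (1 - b^k), each a multiple of 1 - b = 1 + t
    a. *)
Let g_eq : tinj A (peval (t : restr incl A) g) =
  (1 - b) * (\sum_(k < size q) tinj A (str A (int_elt q`_k) * (- t) ^+ (r - k)) *
     \sum_(i < k) b ^+ i).
Proof.
have size_r : size q = r.+1 by rewrite prednK// size_poly_gt0 monic_neq0.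
rewrite mulr_sumr peval_g rmorph_sum.
transitivity (\sum_(k < size q)
    tinj A (str A (int_elt q`_k) * (- t) ^+ (r - k)) * (1 - b ^+ k)).
  apply/eqP; rewrite -subr_eq0 -sumrB; apply/eqP.
  have := congr1 (fun x : tens (base M) => tinj A ((- t) ^+ r) * tensor_map toA x) qa.
  rewrite rmorph0 mulr0 rmorph_sum mulr_sumr => z0; rewrite -[RHS]z0.
  apply: eq_bigr => k _.
  transitivity (tinj A (str A (int_elt q`_k) * (- t) ^+ (r - k)) * b ^+ k).
    by rewrite mulrBr mulr1 opprB addrC subrK.
  rewrite (rmorphM (tensor_map toA)) (rmorphXn (tensor_map toA)) /= tensor_map_inj.
  rewrite /b -(rmorphN (tinj A)) exprMn -(rmorphXn (tinj A)) !mulrA -!(rmorphM (tinj A)).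
  congr (tinj A _ * _); rewrite -mulrA -exprD subnK 1?mulrC//.
  by rewrite -ltnS -size_r ltn_ord.
apply: eq_bigr => k _; rewrite mulrCA; congr (_ * _).
by rewrite -opprB subrX1 -mulNr opprB.
Qed.

Definition one_plus_subproof :
  (1 + tinj A t * tensor_map toA a) *
  (tinj A s * \sum_(k < size q) tinj A (str A (int_elt q`_k) * (- t) ^+ (r - k)) *
     \sum_(i < k) b ^+ i) == 1.
Proof.
have -> : 1 + tinj A t * tensor_map toA a = 1 - b by rewrite /b mulNr opprK.
by rewrite mulrCA -g_eq -rmorphM (eqP (valP y)) rmorph1.
Qed.

Definition one_plus : units (tens A) := exist _ (_, _) one_plus_subproof.

Lemma one_plusE k :
  (val one_plus).1 0 k = str A (phi (coord e k 1)) + t * str A (a 0 k).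
Proof.
rewrite [LHS]mxE (tensor_inclE (restr phi A)); congr (_ + _).
by rewrite (tensor_injM (A := restr phi A)) !mxE.
Qed.

End Point.

Lemma one_plus_nat (A B : algebra M) (f : algHom A B) (y : dopen g (restr incl A)) :
  one_plus (fmap (restr_hom incl f) y : dopen g (restr incl B)) =
  units_map (@tensor_map K L _ _ (restr_hom phi f)) (one_plus y).
Proof.
apply: units_inj; apply/rowP => k; rewrite one_plusE [RHS]mxE one_plusE /=.
by rewrite rmorphD rmorphM !alg_homE.
Qed.

Let theta_inv A (u : units (tens A)) : T A := projT1 (cid (theta_surj u)).
Let theta_invK A (u : units (tens A)) : theta (theta_inv u) = u :=
  projT2 (cid (theta_surj u)).

Fact one_plus_trans_subproof (A B : algebra M) (f : algHom A B)
    (y : base_change incl (dopen g) A) :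
  theta_inv (one_plus (fmap f y : dopen g (restr incl B))) =
  gmap f (theta_inv (one_plus y)).
Proof.
by apply: theta_inj; rewrite theta_nat !theta_invK one_plus_nat.
Qed.

Definition one_plus_trans : nattrans (base_change incl (dopen g)) (underlying T) :=
  @NatTrans M (base_change incl (dopen g)) (underlying T)
    (fun A y => theta_inv (@one_plus A y)) one_plus_trans_subproof.

Lemma lie_lower : exists2 x : N (dual_alg O), lie x & lie_eps x = a.
Proof.
have [h [hE _]] := @nr_mapping _ _ _ N _ (dopen_smooth g) one_plus_trans.
(* The constant coefficient of g is the leading coefficient of q; so the origin lies in D(g), and
   with it the tangent vector t = eps. *)
have g0 (A : algebra O) : peval (0 : A) g = 1.
  have size_r : size q = r.+1 by rewrite prednK// size_poly_gt0 monic_neq0.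
  rewrite peval_g oppr0 size_r big_ord_recr /= big1 ?add0r => [|i _].
    by rewrite subnn mulr1 -/(lead_coef q) (monicP qmonic) rmorph1.
  by rewrite expr0n subn_eq0 leqNgt ltn_ord mulr0.
pose eps : dual_alg O := Dual 0 1.
have ge : dn_re (peval eps g) = 1.
  by rewrite -(g0 (base O)) -[dn_re _]/(aug_hom O _) peval_nat.
(* The inverse of 1 + c eps is 1 - c eps. *)
pose s : dual_alg O := Dual 1 (- dn_eps (peval eps g)).
have es : s * peval eps g == 1.
  apply/eqP; rewrite /s; case: (peval eps g) ge => b c /= ->.
  transitivity (Dual (1 * 1) (1 * c + - c * 1) : dualnum O) => //.
  by rewrite !mulr1 mul1r subrr.
pose y : dopen g (dual_alg O) := exist _ (eps, s) es.
exists (h _ y).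
  pose j : algHom (base O) (restr incl (base M)) :=
    @AlgHom O (base O) (restr incl (base M)) incl (fun=> erefl).
  apply: (@gpoint_sep _ _ j); first by move=> b c /val_inj.
  rewrite (gmap1 N) gpoint1 /gpoint.
  have e1 : gmap j (gmap (aug_hom O) (h _ y)) = h _ (fmap j (fmap (aug_hom O) y)).
    by rewrite !ntmapE.
  rewrite e1 hE /= theta_invK; apply: units_inj; apply/rowP => k.
  by rewrite one_plusE /= ?rmorph0 ?mul0r addr0 mxE.
rewrite /lie_eps /lie_gen /gpoint.
have e1 : gmap (dual_hom incl) (h _ y) = h _ (fmap (dual_hom incl) y).
  by rewrite ntmapE.
rewrite e1 hE /= theta_invK; apply/rowP => k.
rewrite [LHS]mxE; etransitivity.
  exact: (congr1 (@dn_eps M) (one_plusE (A := dual_alg M) _ k)).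
by rewrite /= mulr0 !add0r mul1r.
Qed.

End Lower.

End NeronLie.

(** * Extension of discrete valuations *)

Section Chevalley.
Variables (K : fieldType) (v : dvaluation K) (F : fieldExtType K).
Variables (pi : K) (pi0 : pi != 0) (vpi : v pi = 1).
Local Open Scope classical_set_scope.

Let ip : F := pi%:A.

Let ip0 : ip != 0. Proof. by rewrite scaler_eq0 oner_eq0 orbF. Qed.

(* Chevalley's argument: a subring of F which contains O_K, in which pi is not
   invertible, and which is maximal for these properties is a valuation ring. *)
Definition dominating (B : F -> Prop) : Prop :=
  [/\ forall c, c \in integral v -> B c%:A,
      forall x y, B x -> B y -> B (x - y),
      forall x y, B x -> B y -> B (x * y)
    & ~ B ip^-1].

(** Zorn's lemma is applied to sets A, and the empty chain has an empty union; adding O_K makes the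
    empty set admissible. *)
Let S (A : set F) (x : F) : Prop := A x \/ exists2 c, c \in integral v & x = c%:A.

Lemma dominating_base : dominating (S set0).
Proof.
split=> [c ci|x y [//|[c ci ->]] [//|[d di ->]]|x y [//|[c ci ->]] [//|[d di ->]]|].
- by right; exists c.
- by right; exists (c - d); rewrite ?rpredB ?scalerBl.
- by right; exists (c * d); rewrite ?rpredM// -scalerAl mul1r scalerA.
- case=> [//|[c ci e]]; have : c%:A = pi^-1%:A :> F.
    by rewrite -e; exact: (esym (fmorphV (in_alg F) pi)).
  move=> /(fmorph_inj (in_alg F)) ce; move: ci; rewrite ce integralE.
  by rewrite vgeE ?invr_eq0// dvalV// vpi.
Qed.

Lemma maximal_dominating : exists B, dominating B /\
  forall B', dominating B' -> (forall x, B x -> B' x) -> forall x, B' x -> B x.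
Proof.
have [|A [domA maxA]] := @Zorn_bigcup F (fun A => dominating (S A)).
  move=> C Cdom Ctot.
  have [->|/set0P[X0 CX0]] := eqVneq C set0.
    by rewrite bigcup_set0; exact: dominating_base.
  have mono (X : set F) x : C X -> S X x -> S (\bigcup_(X in C) X) x.
    by move=> CX [Xx|]; [left; exists X|right].
  have lift x y : S (\bigcup_(X in C) X) x -> S (\bigcup_(X in C) X) y ->
      exists2 X, C X & S X x /\ S X y.
    move=> [[X CX Xx]|Ox] [[Y CY Yy]|Oy].
    - have [XY|YX] := Ctot X Y CX CY.
        by exists Y => //; split; left=> //; exact: XY.
      by exists X => //; split; left=> //; exact: YX.
    - by exists X => //; split; [left|right].
    - by exists Y => //; split; [right|left].
    - by exists X0 => //; split; right.
  split=> [c ci|x y Sx Sy|x y Sx Sy|].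
  - by right; exists c.
  - have [X CX [Xx Xy]] := lift x y Sx Sy; apply: (mono X) => //.
    by have [_ + _ _] := Cdom _ CX; apply.
  - have [X CX [Xx Xy]] := lift x y Sx Sy; apply: (mono X) => //.
    by have [_ _ + _] := Cdom _ CX; apply.
  - move=> Si; have [X CX [Xi _]] := lift _ _ Si Si.
    by have [_ _ _] := Cdom _ CX; apply.
exists (S A); split=> // B' domB' AB' x B'x; apply: contrapT => nAx.
have SB' : S B' = B'.
  apply/seteqP; split=> y; last by left.
  by case=> // -[c ci ->]; have [+ _ _ _] := domB'; apply.
apply: (maxA B'); last by rewrite SB'.
split=> [y Ay|B'A]; first by apply: AB'; left.
by apply: nAx; left; apply: B'A.
Qed.

Section ValuationRing.
Variable B : F -> Prop.
Hypothesis domB : dominating B.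
Hypothesis maxB : forall B', dominating B' -> (forall x, B x -> B' x) ->
  forall x, B' x -> B x.

Let BO c : c \in integral v -> B c%:A. Proof. by have [+ _ _ _] := domB; apply. Qed.
Let BB x y : B x -> B y -> B (x - y). Proof. by have [_ + _ _] := domB; apply. Qed.
Let BM x y : B x -> B y -> B (x * y). Proof. by have [_ _ + _] := domB; apply. Qed.
Let Bpi : ~ B ip^-1. Proof. by have [_ _ _ +] := domB; apply. Qed.
Let B1 : B 1. Proof. by have := BO (rpred1 _); rewrite scale1r. Qed.
Let B0 : B 0. Proof. by rewrite -(subrr 1); apply: BB. Qed.
Let BD x y : B x -> B y -> B (x + y).
Proof. by move=> Bx By; rewrite -[y]opprK -[- y]sub0r; apply/BB/BB. Qed.
Let BX x k : B x -> B (x ^+ k).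
Proof. by move=> Bx; elim: k => [//|k IH]; rewrite exprS; apply: BM. Qed.
Let Bip : B ip.
Proof. by apply: BO; rewrite integralE vgeE// vpi. Qed.
Let Bsum (J : Type) (r : seq J) (P : pred J) (f : J -> F) :
  (forall j, P j -> B (f j)) -> B (\sum_(j <- r | P j) f j).
Proof. by move=> Bf; elim/big_ind: _. Qed.

(** The uniformizer lies in the Jacobson radical: for s = 1 - pi b, the ring B[1/s] still does not
    contain pi^-1, because every power of s is 1 - pi c with c in B. By maximality B[1/s] = B. *)
Let unit1 b : B b -> B (1 - ip * b)^-1.
Proof.
move=> Bb; set s := 1 - ip * b.
have s0 : s != 0.
  apply/eqP => /eqP; rewrite subr_eq0 => /eqP e; apply: Bpi.
  by rewrite -[_^-1]mulr1 e mulKf.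
have sX k : exists2 c, B c & s ^+ k = 1 - ip * c.
  elim: k => [|k [c Bc e]]; first by exists 0; rewrite // mulr0 subr0.
  exists (b + c - ip * b * c); first by apply: BB; [exact: BD|apply/BM => //; exact: BM].
  by rewrite exprS e /s; ring.
apply: (@maxB (fun y => exists k, B (y * s ^+ k))) => [|x Bx|]; last 2 first.
  by exists 0%N; rewrite mulr1.
  by exists 1%N; rewrite expr1 mulVf.
split=> [c ci|x y [k Bk] [l Bl]|x y [k Bk] [l Bl]|[k]].
- by exists 0%N; rewrite mulr1; apply: BO.
- exists (k + l)%N.
  have -> : (x - y) * s ^+ (k + l) = x * s ^+ k * s ^+ l - y * s ^+ l * s ^+ k.
    by rewrite exprD; ring.
  have Bs : B s by apply/BB/BM.
  by apply: BB; apply: BM => //; exact: BX.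
- exists (k + l)%N; rewrite exprD mulrACA; exact: BM.
- have [c Bc ->] := sX k; rewrite mulrBr mulr1 mulKf// => Bc'.
  by apply: Bpi; rewrite -[_^-1](subrK c); exact: BD.
Qed.

(** A witness that 1 lies in pi B[x], of degree at most n in x. *)
Let rel (n : nat) (x : F) := exists2 b : nat -> F, forall i, B (b i) &
  1 = \sum_(i < n.+1) ip * b i * x ^+ i.

Let rel_mono m n x : (m <= n)%N -> rel m x -> rel n x.
Proof.
move=> mn [b Bb e]; exists (fun i => if (i < m.+1)%N then b i else 0).
  by move=> i; case: ifP.
rewrite e (big_ord_widen n.+1 (fun i => ip * b i * x ^+ i))// big_mkcond.
by apply: eq_bigr => i _; case: ifP; rewrite ?mulr0 ?mul0r.
Qed.

Let rel_notin x : ~ B x -> exists n, rel n x.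
Proof.
move=> nBx; pose P (p : {poly F}) := forall i, B p`_i.
(* B[x] is strictly larger than B, hence contains pi^-1 by maximality; multiplied by pi, such an
   expression is the relation. *)
pose B' y := exists2 p, P p & y = p.[x].
have B'i : B' ip^-1.
  apply: contrapT => nB'; apply: nBx; apply: (@maxB B').
  - split=> // [c ci|_ _ [p Pp ->] [q Pq ->]|_ _ [p Pp ->] [q Pq ->]].
    + exists (c%:A)%:P; last by rewrite hornerC.
      by move=> i; rewrite coefC; case: ifP => _ //; exact: BO.
    + by exists (p - q); [move=> i; rewrite coefB; exact: BB|rewrite !hornerE].
    + exists (p * q); last by rewrite hornerM.
      by move=> i; rewrite coefM; apply: Bsum => j _; exact: BM.
  - move=> y By; exists y%:P; last by rewrite hornerC.
    by move=> i; rewrite coefC; case: ifP.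
  - exists 'X; last by rewrite hornerX.
    by move=> i; rewrite coefX; case: (_ == _).
case: B'i => p Pp e; exists (size p), (fun i => p`_i) => //.
rewrite -(mulfV ip0) e (@horner_coef_wide _ (size p).+1)// mulr_sumr.
by apply: eq_bigr => i _; rewrite mulrA.
Qed.

(* The relation of degree n.+1 of x^-1 lowers the degree of the one of x. *)
Let rel_reduce n x : x != 0 -> rel n.+1 x -> rel n.+1 x^-1 -> rel n x.
Proof.
move=> x0 [b Bb eb] [c Bc ec].
pose s := 1 - ip * c 0%N; have Bs := unit1 (Bc 0%N).
have s0 : s != 0.
  apply/eqP => /eqP; rewrite subr_eq0 => /eqP e; apply: Bpi.
  by rewrite -[_^-1]mulr1 e mulKf.
pose d := b n.+1 * s^-1.
exists (fun i => b i + d * (ip * c (n.+1 - i)%N)).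
  by move=> i; apply: BD => //; do 2 apply: BM => //.
under eq_bigr do rewrite mulrDr mulrDl.
rewrite big_split/= {1}eb big_ord_recr/=; congr (_ + _).
have es : s = \sum_(i < n.+1) ip * c i.+1 * x^-1 ^+ i.+1.
  by rewrite /s {1}ec big_ord_recl expr0 mulr1 addrC addKr.
rewrite (reindex_inj rev_ord_inj)/=.
transitivity (ip * d * x ^+ n.+1 * s).
  by rewrite /d; field.
rewrite es mulr_sumr; apply: eq_bigr => i _.
rewrite ?subSS.
have -> : (n.+1 - (n - i))%N = i.+1 by have := ltn_ord i; lia.
have -> : x ^+ n.+1 = x ^+ (n - i) * x ^+ i.+1.
  by rewrite -exprD; congr (_ ^+ _); have := ltn_ord i; lia.
rewrite exprVn; field.
by rewrite expf_neq0.
Qed.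

(** If neither x nor x^-1 lay in B, both would satisfy relations of a common degree; lowering both
    degrees together down to 0 gives 1 = pi b with b in B, a contradiction. *)
Lemma dominating_total x : B x \/ B x^-1.
Proof.
have [->|x0] := eqVneq x 0; first by left.
apply: contrapT => /not_orP[nx nxi].
have [n rn] := rel_notin nx; have [m rm] := rel_notin nxi.
have no0 y : ~ rel 0 y.
  by case=> b Bb; rewrite big_ord1 expr0 mulr1 => e; apply: Bpi; rewrite -[_^-1]mulr1 e mulKf.
have both k : ~ (rel k x /\ rel k x^-1).
  suff H : forall k y, y != 0 -> rel k y -> rel k y^-1 -> False.
    by case=> r1 r2; exact: (H k x).
  elim=> [|j IH] y y0; first by move=> /no0.
  move=> r1 r2; apply: (IH y) => //; first exact: rel_reduce.
  by apply: rel_reduce; rewrite ?invr_eq0 ?invrK.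
apply: (both (maxn n m)); split; apply: rel_mono.
- exact: leq_maxl.
- exact: rn.
- exact: leq_maxr.
- exact: rm.
Qed.

Let U x := [/\ x != 0, B x & B x^-1].

Let U1 : U 1. Proof. by split; rewrite ?invr1 ?oner_eq0. Qed.
Let UM x y : U x -> U y -> U (x * y).
Proof.
move=> [? ? ?] [? ? ?]; split; rewrite ?mulf_neq0 ?invfM//; exact: BM.
Qed.
Let UV x : U x -> U x^-1.
Proof. by move=> [? ? ?]; split; rewrite ?invrK ?invr_eq0. Qed.
Let UX x k : U x -> U (x ^+ k).
Proof. by move=> Ux; elim: k => [//|k IH]; rewrite exprS; exact: UM. Qed.

Let nonunit x := x = 0 \/ ~ B x^-1.

(** A valuation ring is local: one of y / x and x / y lies in B, so that the sum is a multiple of x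
    or of y. *)
Let nonunitD x y : nonunit x -> nonunit y -> nonunit (x + y).
Proof.
have H a b : a != 0 -> B (b / a) -> ~ B a^-1 -> nonunit (a + b).
  move=> a0 Bba nBa; have [ab0|ab0] := eqVneq (a + b) 0; [by left|right=> Bi].
  apply: nBa; have -> : a^-1 = (1 + b / a) * (a + b)^-1 by field; rewrite ab0 a0.
  by apply: BM => //; exact: BD.
case=> [->|nx]; first by rewrite add0r.
case=> [->|ny]; first by rewrite addr0; right.
have x0 : x != 0 by apply/eqP => x0; apply: nx; rewrite x0 invr0.
have y0 : y != 0 by apply/eqP => y0; apply: ny; rewrite y0 invr0.
have [Byx|Bxy] := dominating_total (y / x); first exact: H.
by rewrite addrC; apply: H => //; move: Bxy; rewrite invfM invrK mulrC.
Qed.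

Let largest (n : nat) (t : nat -> F) : (exists2 i, (i < n)%N & t i != 0) ->
  exists i, [/\ (i < n)%N, t i != 0 & forall j, (j < n)%N -> B (t j / t i)].
Proof.
elim: n => [[]//|n IH] [i]; rewrite ltnS => lin ti0.
have [[j jn tj0]|no] := pselect (exists2 j, (j < n)%N & t j != 0); last first.
  have t0 j : (j < n)%N -> t j = 0.
    by move=> jn; apply/eqP; apply: contrapT => /negP tj; apply: no; exists j.
  have {lin} ein : i = n.
    apply/eqP; rewrite eqn_leq lin leqNgt; apply/negP => /t0 /eqP.
    by rewrite (negbTE ti0).
  exists n; split=> //; first by rewrite -ein.
  move=> j; rewrite ltnS leq_eqVlt => /orP[/eqP->|/t0->]; last by rewrite mul0r.
  by rewrite -ein divff.
have [|k [kn tk0 Bk]] := IH; first by exists j.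
have [Bnk|Bkn] := dominating_total (t n / t k).
  exists k; split=> //; first exact: leqW.
  by move=> m; rewrite ltnS leq_eqVlt => /orP[/eqP->|/Bk].
have [tn0|tn0] := eqVneq (t n) 0.
  exists k; split=> //; first exact: leqW.
  by move=> m; rewrite ltnS leq_eqVlt => /orP[/eqP->|/Bk//]; rewrite tn0 mul0r.
exists n; split=> // m; rewrite ltnS leq_eqVlt => /orP[/eqP->|/Bk Bm].
  by rewrite divff.
have -> : t m / t n = t m / t k * (t n / t k)^-1 by field; rewrite tk0 tn0.
exact: BM.
Qed.

Let ipX (c : K) : c != 0 -> exists2 u, U u & c%:A = ip ^ (v c) * u.
Proof.
move=> c0; exists ((pi ^ (- v c) * c)%:A).
  have p0 : pi ^ (- v c) != 0 by rewrite expfz_neq0.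
  have e : v (pi ^ (- v c) * c) = 0 by rewrite dvalM// dvalXz// vpi mul1r addNr.
  split.
  - by rewrite scaler_eq0 oner_eq0 orbF mulf_neq0.
  - by apply: BO; rewrite integralE vgeE ?mulf_neq0// e.
  - rewrite -(fmorphV (in_alg F)); apply: BO; rewrite integralE vgeE.
      by rewrite dvalV ?mulf_neq0// e.
    by rewrite invr_eq0 mulf_neq0.
rewrite -[ip ^ _](fmorphXz (in_alg F)) -(rmorphM (in_alg F)) mulrA -expfzDr//.
by rewrite subrr expr0z mul1r.
Qed.

Let ipU (s : int) : U (ip ^ s) -> s = 0.
Proof.
have H (k : nat) : ~ B (ip ^ (- k.+1%:Z)).
  move=> Bk; apply: Bpi; have -> : ip^-1 = ip ^+ k * ip ^ (- k.+1%:Z).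
    by rewrite -exprnN exprSr invfM mulVKf// expf_neq0.
  by apply: BM => //; exact: BX.
case: s => [[|s]|s] // [_ Bs Bi]; exfalso.
  by apply: (H s); rewrite -invr_expz.
by apply: (H s); rewrite NegzE in Bs.
Qed.

(* Two terms of a linear relation between the powers of x over K are associated;
   this makes some x ^+ k with 0 < k <= [F : K] associated to a power of pi. *)
Let power x : x != 0 -> exists s, U (x ^+ (\dim {:F})`! / ip ^ s).
Proof.
move=> x0.
have [P [P0 Psize Px]] := algebraic_relation x.
pose t (i : nat) : F := (P`_i)%:A * x ^+ i.
have tsum : \sum_(i < size P) t i = 0.
  move: Px; rewrite /root horner_coef size_map_poly => /eqP Px; rewrite -[RHS]Px.
  by apply: eq_bigr => i _; rewrite coef_map.
have lead0 : t (size P).-1 != 0.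
  rewrite mulf_neq0 ?expf_neq0// scaler_eq0 oner_eq0 orbF.
  by rewrite -[P`_ _]/(lead_coef P) lead_coef_eq0.
have [|i [iP ti0 Bi]] := @largest (size P) t.
  by exists (size P).-1 => //; rewrite ltn_predL size_poly_gt0.
have [[j [jP ji Uj]]|no] :=
  pselect (exists j, [/\ (j < size P)%N, j != i & U (t j / t i)]); last first.
  (* Divided by its largest term, the relation would write -1 as a sum of nonunits. *)
  exfalso; have : nonunit (- (1 : F)).
    have -> : -1 = \sum_(j < size P | j != Ordinal iP) t j / t i.
      move: tsum; rewrite (bigD1 (Ordinal iP))//= => /(congr1 (fun z => z / t i)).
      rewrite mul0r mulrDl divff// mulr_suml => /eqP; rewrite addrC addr_eq0.
      by move=> /eqP ->.
    elim/big_ind: _ => [|y z|j ji]; [by left|exact: nonunitD|].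
    have [->|tji] := eqVneq (t j / t i) 0; [by left|right=> Bji].
    by apply: no; exists j; split=> //; split=> //; exact: Bi.
  case=> [/eqP|]; first by rewrite oppr_eq0 oner_eq0.
  by apply; rewrite invrN invr1 -sub0r; exact: BB.
have coef_neq0 l : t l != 0 -> P`_l != 0.
  by apply: contraNneq => Pl; rewrite /t Pl scale0r mul0r.
have tj0 : t j != 0.
  by case: Uj => + _ _; apply: contraNneq => ->; rewrite mul0r.
have {Uj} : exists2 s, U (x ^ (j%:Z - i%:Z) * ip ^ s) & True.
  have [u Uu cu] := ipX (coef_neq0 _ tj0); have [u' Uu' cu'] := ipX (coef_neq0 _ ti0).
  exists (v P`_j - v P`_i) => //.
  have [u0 _ _] := Uu; have [u0' _ _] := Uu'.
  have -> : x ^ (j%:Z - i%:Z) * ip ^ (v P`_j - v P`_i) = t j / t i * (u' / u).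
    rewrite /t cu cu' !expfzDr// -!invr_expz -!exprnP; field.
    by rewrite u0 u0' expf_neq0 ?expfz_neq0.
  by apply: UM => //; apply: UM => //; exact: UV.
case=> s Us _.
have [k [s' [k0 kn Uk]]] : exists k s',
    [/\ (0 < k)%N, (k <= \dim {:F})%N & U (x ^+ k * ip ^ s')].
  have [ij|ij|ij] := ltngtP i j; last by rewrite ij eqxx in ji.
    exists (j - i)%N, s; split; [by rewrite subn_gt0|lia|].
    by rewrite exprnP -subzn// ltnW.
  exists (i - j)%N, (- s); split; [by rewrite subn_gt0|lia|].
  have := UV Us; rewrite invfM !invr_expz opprB.
  by rewrite exprnP -subzn// ltnW.
(* The exponent k depends on x; the factorial of the degree is a uniform multiple. *)
have /dvdnP[m ->] : (k %| (\dim {:F})`!)%N by rewrite dvdn_fact// k0.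
exists (- (s' * m%:Z)); rewrite invr_expz opprK.
have -> : x ^+ (m * k) * ip ^ (s' * m%:Z) = (x ^+ k * ip ^ s') ^+ m.
  by rewrite [RHS]exprMn -exprM mulnC (exprnP (ip ^ s')) exprz_exp.
exact: UX.
Qed.

(** The extended valuation before normalization: x^D is associated to pi^(W x), where D = [F : K]!,
    and pi itself has value D. *)
Let W x : int := if pselect (x != 0) is left x0 then projT1 (cid (power x0)) else 0.
Let D : nat := (\dim {:F})`!.

Let WE x : x != 0 -> U (x ^+ D / ip ^ W x).
Proof.
by move=> x0; rewrite /W; case: pselect => // x0'; exact: projT2 (cid (power x0')).
Qed.

Let W_unique x s : x != 0 -> U (x ^+ D / ip ^ s) -> W x = s.
Proof.
move=> x0 Us; apply/eqP; rewrite -subr_eq0; apply/eqP/ipU.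
have -> : ip ^ (W x - s) = x ^+ D / ip ^ s * (x ^+ D / ip ^ W x)^-1.
  by rewrite expfzDr// -invr_expz; field; rewrite !expfz_neq0//= expf_neq0.
exact/UM/UV/WE.
Qed.

Let WM x y : x != 0 -> y != 0 -> W (x * y) = W x + W y.
Proof.
move=> x0 y0; apply: W_unique; first exact: mulf_neq0.
have -> : (x * y) ^+ D / ip ^ (W x + W y) = x ^+ D / ip ^ W x * (y ^+ D / ip ^ W y).
  by rewrite exprMn expfzDr//; field; rewrite !expfz_neq0.
exact/UM/WE/y0/WE.
Qed.

Let WV x : x != 0 -> W x^-1 = - W x.
Proof.
move=> x0; apply: W_unique; first by rewrite invr_eq0.
have -> : x^-1 ^+ D / ip ^ (- W x) = (x ^+ D / ip ^ W x)^-1.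
  by rewrite exprVn -invr_expz invrK invfM invrK.
exact/UV/WE.
Qed.

Let Wip : W ip = D%:Z.
Proof. by apply: W_unique => //; rewrite -exprnP divff ?expf_neq0//; exact: U1. Qed.

Let W_ge0 x : x != 0 -> (0 <= W x) <-> B x.
Proof.
move=> x0; have D0 : (0 < D)%N by rewrite fact_gt0.
have [_ BW BWi] := WE x0; split=> [W0|Bx].
  have BxD : B (x ^+ D).
    rewrite -[x ^+ D](divfK (_ : ip ^ W x != 0)) ?expfz_neq0//.
    by apply: BM => //; rewrite -(gez0_abs W0) -exprnP; exact: BX.
  have [//|Bxi] := dominating_total x.
  have -> : x = x ^+ D * x^-1 ^+ D.-1.
    by rewrite -[in x ^+ D](prednK D0) exprS -mulrA -exprMn divff// expr1n mulr1.
  by apply: BM => //; exact: BX.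
rewrite leNgt; apply/negP => Wn; apply: Bpi.
have : B (ip ^ W x).
  have -> : ip ^ W x = x ^+ D * (x ^+ D / ip ^ W x)^-1.
    by field; rewrite expfz_neq0//= expf_neq0.
  by apply: BM => //; exact: BX.
have -> : W x = - (`|W x|.-1).+1%:Z by lia.
rewrite -exprnN => Bn.
have -> : ip^-1 = ip ^+ `|W x|.-1 * ip ^- `|W x|.-1.+1.
  by rewrite exprSr invfM mulVKf// expf_neq0.
by apply: BM => //; exact: BX.
Qed.

Let WX x (s : int) : x != 0 -> W (x ^ s) = W x * s.
Proof.
move=> x0; have H (k : nat) : W (x ^+ k) = W x * k%:Z.
  elim: k => [|k IH]; last by rewrite exprS WM ?expf_neq0// IH; lia.
  rewrite expr0 mulr0; apply: W_unique; rewrite ?oner_eq0//.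
  by rewrite expr1n expr0z divr1; exact: U1.
case: s => s; first by rewrite -exprnP H.
by rewrite NegzE -exprnN WV ?expf_neq0// H mulrN.
Qed.

Lemma dominating_valuation : exists w : dvaluation F, dv_extends v w.
Proof.
have D0 : (0 < D)%N by rewrite fact_gt0.
(* The values of [W] form a subgroup of the integers; dividing by its least positive element a
   normalizes the valuation. *)
pose P (a : nat) := `[< (0 < a)%N /\ exists2 x, x != 0 & W x = a%:Z >].
have exP : exists a, P a by exists D; apply/asboolP; split=> //; exists ip.
case: (ex_minnP exP) => a /asboolP[a0 [y y0 Wy]] amin.
have divW x : x != 0 -> W x = (W x %/ a)%Z * a%:Z.
  move=> x0; rewrite {1}(divz_eq (W x) a).
  suff -> : (W x %% a)%Z = 0 by rewrite addr0.
  apply: contrapT => /eqP m0.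
  have am : (0 : int) <= (W x %% a)%Z < a%:Z.
    by rewrite modz_ge0 ?ltz_pmod// eqz_nat -lt0n.
  have : P `|(W x %% a)%Z|%N.
    apply/asboolP; split; first by rewrite absz_gt0.
    exists (x * y ^ (- (W x %/ a)%Z)); first by rewrite mulf_neq0 ?expfz_neq0.
    rewrite WM ?expfz_neq0// WX// Wy gez0_abs; last by case/andP: am.
    by have := divz_eq (W x) a; lia.
  by move=> /amin; lia.
pose w (x : F) : int := (W x %/ a)%Z.
have wE x : x != 0 -> W x = w x * a%:Z by exact: divW.
have a0' : a%:Z != 0 by rewrite eqz_nat -lt0n.
have wM x z : x != 0 -> z != 0 -> w (x * z) = w x + w z.
  move=> x0 z0; apply: (mulIf a0'); rewrite -wE ?mulf_neq0// WM// mulrDl.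
  by rewrite -!wE.
have w_ge0 x : x != 0 -> (0 <= w x) <-> B x.
  move=> x0; rewrite -W_ge0// (wE x)// pmulr_lge0//; lia.
have wV x : x != 0 -> w x^-1 = - w x.
  move=> x0; apply: (mulIf a0'); rewrite -wE ?invr_eq0// WV// mulNr -wE//.
have wD x z : x != 0 -> z != 0 -> x + z != 0 -> Num.min (w x) (w z) <= w (x + z).
  have H b c : b != 0 -> B (c / b) -> b + c != 0 -> w b <= w (b + c).
    move=> b0 Bcb bc0; have e : b + c = b * (1 + c / b) by field.
    have n0 : 1 + c / b != 0 by apply: contraNneq bc0 => e0; rewrite e e0 mulr0.
    rewrite e wM// lerDl; apply/w_ge0 => //; exact: BD.
  move=> x0 z0 xz0; rewrite ge_min.
  have [Bzx|Bxz] := dominating_total (z / x); first by rewrite H.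
  rewrite orbC addrC H// 1?addrC//.
  by move: Bxz; rewrite invfM invrK mulrC.
have wu : exists2 x, x != 0 & w x = 1.
  by exists y => //; apply: (mulIf a0'); rewrite -wE// Wy mul1r.
exists (DValuation wM wD wu) => c; rewrite !integralE.
have [->|c0] := eqVneq c 0; first by rewrite scale0r !vge0.
have cF : c%:A != 0 :> F by rewrite scaler_eq0 oner_eq0 orbF.
rewrite !vgeE//=; apply/idP/idP => [/w_ge0 Bc|vc]; last first.
  by apply/w_ge0 => //; apply: BO; rewrite integralE vgeE.
rewrite leNgt; apply/negP => vc; apply: Bpi.
have -> : ip^-1 = (pi^-1 / c)%:A * c%:A.
  by rewrite -(rmorphM (in_alg F)) divfK// fmorphV.
apply: BM; last exact: Bc.
apply: BO; rewrite integralE vgeE ?mulf_neq0 ?invr_eq0//.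
by rewrite dvalM ?invr_eq0// !dvalV// vpi; lia.
Qed.

End ValuationRing.

End Chevalley.

Theorem valuation_extension (K : fieldType) (v : dvaluation K) (F : fieldExtType K) :
  exists w : dvaluation F, dv_extends v w.
Proof.
have [pi pi0 vpi] := dval_uniformizer v.
have [B [domB maxB]] := maximal_dominating F pi0 vpi.
exact: (dominating_valuation pi0 vpi domB maxB).
Qed.

Section Extension.
Variables (K : fieldType) (v : dvaluation K) (F : fieldExtType K) (w : dvaluation F).
Hypothesis vw : dv_extends v w.

Lemma ext_vge0 c : vge w 0 c%:A = vge v 0 c. Proof. exact: vw. Qed.

Lemma ext_unit c : c != 0 -> v c = 0 -> w c%:A = 0.
Proof.
have H (d : K) : d != 0 -> (0 <= w d%:A) = (0 <= v d).
  by move=> d0; rewrite -(vgeE v)// -(vgeE w) ?alg_eq0// ext_vge0.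
move=> c0 vc; apply/eqP; rewrite eq_le; apply/andP; split; last by rewrite H// vc.
have := H c^-1; rewrite invr_eq0 dvalV// vc oppr0 algV dvalV ?alg_eq0// oppr_ge0.
by move=> ->.
Qed.

Variables (pi : K) (pi0 : pi != 0) (vpi : v pi = 1).

Lemma extE c : c != 0 -> w c%:A = v c * w pi%:A.
Proof.
move=> c0; have [p0 e0] : pi ^ (v c) != 0 /\ pi ^ (- v c) != 0.
  by rewrite !expfz_neq0.
have -> : c%:A = (pi%:A) ^ (v c) * (pi ^ (- v c) * c)%:A :> F.
  rewrite -algXz -algM mulrA -expfzDr//.
  by rewrite subrr expr0z mul1r.
have u0 : pi ^ (- v c) * c != 0 by rewrite mulf_neq0.
have vu : v (pi ^ (- v c) * c) = 0 by rewrite dvalM// dvalXz// vpi mul1r addNr.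
rewrite dvalM; [|by rewrite expfz_neq0 ?alg_eq0|by rewrite alg_eq0].
by rewrite (ext_unit u0 vu) addr0 dvalXz ?alg_eq0// mulrC.
Qed.

Lemma ext_pi_gt0 : 0 < w pi%:A.
Proof.
have : ~~ vge w 0 (pi^-1)%:A.
  by rewrite ext_vge0 vgeE ?invr_eq0// dvalV// vpi.
rewrite vgeE ?alg_eq0 ?invr_eq0// algV dvalV ?alg_eq0//=.
by rewrite oppr_ge0 -ltNge.
Qed.

End Extension.

(** * Extensions of a complete field *)

Section Complete.
Variables (K : fieldType) (v : dvaluation K) (hK : complete_dv v).
Variables (k : fieldType) (res : {rmorphism intring v -> k}).
Hypotheses (hres : residue_map res) (hk : GRing.closed_field_axiom k).
Variables (F : fieldExtType K) (w : dvaluation F).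
Hypothesis vw : dv_extends v w.

Local Notation O := (intring v).

Definition int_alg : {rmorphism O -> F} := in_alg F \o int_incl v.
Definition ev (x : F) (P : {poly O}) : F := (map_poly int_alg P).[x].

Lemma int_alg_vge (c : O) : vge w 0 (int_alg c).
Proof. by rewrite /= (ext_vge0 vw); exact: (valP c). Qed.

Lemma ev_vge x P : vge w 0 x -> vge w 0 (ev x P).
Proof.
move=> wx; rewrite /ev horner_coef; apply: vge_sum => i _.
by rewrite coef_map -[0](addr0 0); apply: vgeM; [exact: int_alg_vge|exact: vgeX].
Qed.

Lemma evM x P Q : ev x (P * Q) = ev x P * ev x Q.
Proof. by rewrite /ev rmorphM hornerM. Qed.
Lemma evB x P Q : ev x (P - Q) = ev x P - ev x Q.
Proof. by rewrite /ev rmorphB !hornerE. Qed.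
Lemma evC x c : ev x c%:P = int_alg c.
Proof. by rewrite /ev map_polyC hornerC. Qed.
Lemma evX x : ev x 'X = x.
Proof. by rewrite /ev map_polyX hornerX. Qed.

Lemma vge1_alg (c : K) : vge v 1 c -> vge w 1 c%:A.
Proof.
have [->|c0] := eqVneq c 0; first by rewrite scale0r !vge0.
have [pi pi0 vpi] := dval_uniformizer v.
rewrite !vgeE ?alg_eq0// => vc; rewrite (extE vw pi0 vpi)//.
by have := ext_pi_gt0 vw pi0 vpi; nia.
Qed.

(** Induction on the size. A leading coefficient which vanishes in k is dropped. Otherwise the
    polynomial is made monic and a root in k splits off a linear factor; as the maximal ideal is
    prime, either this factor or the cofactor takes at x a value in it. *)
Lemma residue_root (n : nat) (P : {poly O}) x : (size P <= n)%N -> vge w 0 x ->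
  (exists i, res P`_i <> 0) -> vge w 1 (ev x P) ->
  exists c : O, vge w 1 (x - int_alg c).
Proof.
move=> + wx; elim: n P => [|n IH] P.
  by rewrite leqn0 size_poly_eq0 => /eqP -> [i]; rewrite coef0 rmorph0.
move=> Pn [i Pi] wP.
have size_gt0 : (0 < size P)%N.
  by rewrite size_poly_gt0; apply/eqP => P0; apply: Pi; rewrite P0 coef0 rmorph0.
pose m := (size P).-1; have sizeP : size P = m.+1 by rewrite prednK.
have [l0|/eqP l0] := eqVneq (res (lead_coef P)) 0.
  pose Q := take_poly m P.
  have PQ : P = Q + (lead_coef P) *: 'X^m.
    apply/polyP => j; rewrite coefD coefZ coefXn coef_take_poly.
    have [jm|jm|->] := ltngtP j m; rewrite ?mulr0 ?addr0 ?add0r ?mulr1//.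
    by rewrite nth_default// sizeP.
  apply: (IH Q).
  - by rewrite (leq_trans (size_take_poly _ _))// -ltnS -sizeP.
  - exists i; rewrite coef_take_poly; case: ltnP => // mi; exfalso; apply: Pi.
    move: mi; rewrite leq_eqVlt => /orP[/eqP <-//|mi].
    by rewrite nth_default ?rmorph0// sizeP.
  - move: wP; rewrite {1}PQ /ev rmorphD /= hornerD => wP.
    rewrite -[_.[x]](addrK (map_poly int_alg (lead_coef P *: 'X^m)).[x]).
    apply: vgeB wP _; rewrite map_polyZ hornerZ map_polyXn hornerXn.
    rewrite -[1]addr0; apply: vgeM; last exact: vgeX.
    exact/vge1_alg/(hres.2 _).1.
have [l' ll'] : exists l' : O, lead_coef P * l' = 1.
  have nl : vge v 1 (int_elt (lead_coef P)) = false.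
    by apply/negP => vl; apply: l0; apply/(hres.2 _).
  have [L0 vL] := vgePn nl.
  have vL0 : v (int_elt (lead_coef P)) = 0.
    have : vge v 0 (int_elt (lead_coef P)) := valP (lead_coef P).
    by rewrite vgeE//; lia.
  have Li : (int_elt (lead_coef P))^-1 \in integral v.
    by rewrite integralE vgeE ?invr_eq0// dvalV// vL0.
  by exists (IntRing Li); apply: val_inj; rewrite /= divff.
pose Q := l' *: P.
have QE j : Q`_j = l' * P`_j by rewrite coefZ.
have Qlead : Q`_m = 1 by rewrite QE mulrC.
have sizeQ : size Q = m.+1.
  apply/eqP; rewrite eqn_leq -{1}sizeP size_scale_leq ltnNge; apply/negP => Qm.
  have := Qlead; rewrite nth_default// => /(congr1 res).
  by rewrite rmorph0 rmorph1 => /eqP; rewrite eq_sym oner_eq0.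
have wQ : vge w 1 (ev x Q).
  rewrite /ev map_polyZ hornerZ -[1](add0r 1).
  by apply: vgeM wP; exact: int_alg_vge.
have Qmonic : Q \is monic by rewrite monicE lead_coefE sizeQ /= Qlead.
have [m0|m0] := posnP m.
  have Q1 : Q = 1.
    apply/polyP => -[|j]; first by rewrite coef1 -{1}m0 Qlead.
    by rewrite coef1 nth_default// sizeQ m0.
  move: wQ; rewrite /ev Q1 rmorph1 hornerC vgeE ?oner_eq0// dval1.
  by rewrite ler10.
(* The axiom solves X^m = sum of the c_j X^j, whence the opposite signs. *)
have [cb cbE] := hk (fun j => - res Q`_j) m0.
have [c cE] := hres.1 cb.
have Qc : res Q.[c] = 0.
  rewrite horner_coef sizeQ big_ord_recr /= Qlead mul1r rmorphD rmorph_sum rmorphXn.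
  rewrite cE cbE -big_split big1// => j _ /=.
  by rewrite rmorphM rmorphXn cE mulNr subrr.
have /factor_theorem[Q2 Q2E] : root (Q - (Q.[c])%:P) c.
  by rewrite /root !hornerE subrr.
have size_lt : (size (Q.[c])%:P < size Q)%N.
  by rewrite sizeQ (leq_ltn_trans (size_polyC_leq1 _)).
have Q2monic : Q2 \is monic.
  rewrite -(monicMr _ (monicXsubC c)) -Q2E monicE lead_coefDl ?size_polyN//.
have size2 : (size Q2).+1 = m.+1.
  rewrite -sizeQ -(size_polyDl (p := Q) (q := - (Q.[c])%:P)) ?size_polyN// Q2E.
  by rewrite size_Mmonic ?monic_neq0 ?monicXsubC// size_XsubC addn2.
have : vge w 1 ((ev x Q2) * (x - int_alg c)).
  have -> : ev x Q2 * (x - int_alg c) = ev x Q - int_alg Q.[c].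
    by have /(congr1 (ev x)) := Q2E; rewrite evM !evB evX !evC => ->.
  by apply: vgeB => //; apply: vge1_alg; apply/(hres.2 _).
move=> /vge_prime[]; first exact: ev_vge.
- by apply: vgeB => //; exact: int_alg_vge.
- move=> wQ2; apply: (IH Q2) => //; first by rewrite -ltnS size2 -sizeP.
  exists (size Q2).-1; rewrite -lead_coefE (monicP Q2monic) rmorph1.
  by apply/eqP; rewrite oner_eq0.
- by exists c.
Qed.

Let toO (c : K) : O := insubd (0 : O) c.

Let toOE c : vge v 0 c -> int_elt (toO c) = c.
Proof. by move=> vc; rewrite -[LHS]/(val _) insubdK. Qed.

(** The residue field does not grow, k being algebraically closed. An algebraic relation of x,
    divided by a coefficient of least valuation, becomes integral and nonzero modulo the maximal
    ideal. *)
Lemma residue_lift x : vge w 0 x -> exists2 c : K, vge v 0 c & vge w 1 (x - c%:A).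
Proof.
move=> wx; have [P [P0 _ Px]] := algebraic_relation x.
have [m mP] := vge_bound v (size P) (fun i => P`_i).
have {}mP j : vge v m P`_j.
  by have [/mP//|nj] := ltnP j (size P); rewrite nth_default ?vge0.
have [|i [Pi0 Pi _]] := @vge_min_attained _ v m (fun i => P`_i) (size P).-1 _ mP.
  by rewrite -lead_coefE lead_coef_eq0.
pose c j := P`_j / P`_i.
have vc j : vge v 0 (c j).
  rewrite -(subrr (v P`_i)); apply: vgeM; first exact: Pi.
  by rewrite -dvalV//; exact: vge_self.
pose Q : {poly O} := \poly_(j < size P) toO (c j).
have [||e we] := @residue_root _ Q x (leqnn _) wx.
- exists i; rewrite coef_poly; have [iP|nP] := ltnP i (size P); last first.
    by move: Pi0; rewrite nth_default ?eqxx.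
  have -> : toO (c i) = 1 by apply: val_inj; rewrite /= toOE// /c divff.
  by rewrite rmorph1; apply/eqP; rewrite oner_eq0.
- suff -> : ev x Q = 0 by exact: vge0.
  rewrite /ev (@horner_coef_wide _ (size P)); last first.
    by rewrite (leq_trans (size_poly _ _))// size_poly.
  transitivity ((P`_i)^-1%:A * \sum_(j < size P) (P`_j)%:A * x ^+ j).
    rewrite mulr_sumr; apply: eq_bigr => j _; rewrite coef_map coef_poly ltn_ord /=.
    by rewrite toOE// /c algM mulrA [_%:A * _]mulrC.
  move: Px; rewrite /root horner_coef size_map_poly => /eqP Px.
  suff -> : \sum_(j < size P) (P`_j)%:A * x ^+ j = 0 :> F by rewrite mulr0.
  by rewrite -[RHS]Px; apply: eq_bigr => j _; rewrite coef_map.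
by exists (int_elt e) => //; exact: (valP e).
Qed.

Variables (pi : K) (pi0 : pi != 0) (vpi : v pi = 1).
Variables (t : F) (t0 : t != 0) (wt : w t = 1).

Let e : nat := `|w pi%:A|%N.
Let eE : w pi%:A = e%:Z.
Proof. by have := ext_pi_gt0 vw pi0 vpi; rewrite /e; lia. Qed.
Let e_gt0 : (0 < e)%N.
Proof. by have := ext_pi_gt0 vw pi0 vpi; rewrite /e; lia. Qed.

Lemma digits (m : nat) x : vge w 0 x -> exists2 c : nat -> K,
  forall i, vge v 0 (c i) & exists2 y, vge w 0 y &
  x = \sum_(i < m) (c i)%:A * t ^+ i + t ^+ m * y.
Proof.
move=> wx; elim: m => [|m [c vc [y wy xE]]].
  exists (fun=> 0) => [_|]; first exact: vge0.
  by exists x => //; rewrite big_ord0 expr0 add0r mul1r.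
have [d vd wd] := residue_lift wy.
exists (fun i => if i == m then d else c i); first by move=> i; case: ifP.
exists ((y - d%:A) / t).
  rewrite -(subrr 1); apply: vgeM => //.
  by rewrite -{1}wt -dvalV//; exact: vge_self.
rewrite big_ord_recr /= eqxx {1}xE -addrA; congr (_ + _).
  by apply: eq_bigr => i _; rewrite ifN// neq_ltn ltn_ord.
by rewrite exprSr; field.
Qed.

(** The power t^e is pi times a unit, which is absorbed in the remainder. *)
Lemma digits_pi x : vge w 0 x -> exists2 cy : (nat -> K) * F,
  (forall i, vge v 0 (cy.1 i)) /\ vge w 0 cy.2 &
  x = \sum_(i < e) (cy.1 i)%:A * t ^+ i + pi%:A * cy.2.
Proof.
move=> /(digits e)[c vc [y wy ->]].
exists (c, (t ^+ e / pi%:A) * y) => /=.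
  split=> //; rewrite -[0]addr0; apply: vgeM => //.
  rewrite vgeE ?mulf_neq0 ?expf_neq0 ?invr_eq0 ?alg_eq0//.
  by rewrite dvalM ?expf_neq0 ?invr_eq0 ?alg_eq0// dvalX// dvalV ?alg_eq0// wt eE; lia.
by congr (_ + _); field; rewrite alg_eq0.
Qed.

(* [Y N] is the remainder after N steps of the pi-adic expansion of x, [a N i] the
   partial sums of its coordinates. *)
Lemma integral_expansion x : vge w 0 x -> exists2 l : nat -> K,
  forall i, vge v 0 (l i) & x = \sum_(i < e) (l i)%:A * t ^+ i.
Proof.
move=> wx; pose st y (wy : vge w 0 y) := cid2 (digits_pi wy).
pose next (y : {y | vge w 0 y}) : {y | vge w 0 y} :=
  exist _ (s2val (st _ (valP y))).2 (s2valP (st _ (valP y))).2.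
pose dig (y : {y | vge w 0 y}) : nat -> K := (s2val (st _ (valP y))).1.
have stepE y : val y = \sum_(i < e) (dig y i)%:A * t ^+ i + pi%:A * val (next y).
  exact: (s2valP' (st _ (valP y))).
have digP y i : vge v 0 (dig y i) by exact: (s2valP (st _ (valP y))).1.
pose Y N := iter N next (exist _ x wx).
pose a N i := \sum_(M < N) pi ^+ M * dig (Y M) i.
have vpX (N : nat) c : vge v 0 c -> vge v N (pi ^+ N * c).
  move=> vc; rewrite -[N%:Z]addr0; apply: vgeM => //.
  by rewrite vgeE ?expf_neq0// dvalX// vpi; lia.
have va N i : vge v 0 (a N i).
  by apply: vge_sum => M _; apply: vge_le (vpX _ _ (digP _ _)).
have xE N : x = \sum_(i < e) (a N i)%:A * t ^+ i + (pi ^+ N)%:A * val (Y N).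
  elim: N => [|N IH].
    rewrite big1 ?expr0 ?scale1r ?mul1r ?add0r// => i _.
    by rewrite /a big_ord0 scale0r mul0r.
  rewrite {1}IH (stepE (Y N)) mulrDr addrA; congr (_ + _); last first.
    by rewrite mulrA -algM -exprSr.
  rewrite mulr_sumr -big_split; apply: eq_bigr => i _ /=.
  by rewrite /a big_ord_recr /= scalerDl mulrDl algM mulrA.
have cauchy i : exists l : K, forall n : nat, exists N : nat, forall j : nat,
    (N <= j)%N -> vge v n (a j i - l).
  apply: hK => n; exists n.
  have H j1 j2 : (n <= j1)%N -> (j1 <= j2)%N -> vge v n (a j2 i - a j1 i).
    move=> nj1 j12; have -> : a j2 i = a j1 i +
        \sum_(M < j2 - j1) pi ^+ (j1 + M) * dig (Y (j1 + M)%N) i.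
      by rewrite -{1}(subnKC j12); exact: big_split_ord.
    rewrite addrC addKr; apply: vge_sum => M _; apply: vge_le (vpX _ _ (digP _ _)); lia.
  move=> j1 j2 n1 n2; have [le|/ltnW le] := leqP j1 j2; last exact: H.
  by rewrite -vgeN opprB; exact: H.
have [l lP] := choice cauchy.
have vl i : vge v 0 (l i).
  have [N /(_ N (leqnn N)) lN] := lP i 0%N.
  by rewrite -[l i](subKr (a N i)); apply: vgeB.
exists l => //; apply/eqP; rewrite -subr_eq0; apply/eqP/(vge_all0 (v := w)) => n.
have [N NP] := choice (fun i => lP i n).
pose j := maxn n (\max_(i < e) N i).
have aj i : (i < e)%N -> vge v n (a j i - l i).
  move=> ie; apply: NP; rewrite leq_max; apply/orP; right.
  exact: (leq_bigmax (Ordinal ie)).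
have wt_ge0 (i : nat) : vge w 0 (t ^+ i) by apply: vgeX; rewrite vgeE// wt.
have walg (m : nat) c : vge v m c -> vge w m c%:A.
  have [->|c0] := eqVneq c 0; first by rewrite scale0r !vge0.
  rewrite !vgeE ?alg_eq0// (extE vw pi0 vpi)// eE; have := e_gt0; nia.
rewrite {1}(xE j) addrAC -sumrB; apply: vgeD.
  apply: vge_sum => i _; rewrite -mulrBl -scalerBl -[n%:Z]addr0.
  by apply: vgeM => //; apply: walg; apply: aj.
rewrite -[n%:Z]addr0; apply: vgeM; last exact: (valP (Y j)).
apply: walg; rewrite vgeE ?expf_neq0// dvalX// vpi.
by have nj : (n <= j)%N := leq_maxl _ _; rewrite natz lez_nat.
Qed.

(** The i-th nonzero term has valuation e v(c_i) + i; for i < e these are distinct modulo e. *)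
Lemma vge_expansion (m : int) (c : 'I_e -> K) :
  vge w m (\sum_i (c i)%:A * t ^+ i) -> forall i, vge w m ((c i)%:A * t ^+ i).
Proof.
have vt (d : K) (i : nat) : d != 0 -> w (d%:A * t ^+ i) = v d * e%:Z + i%:Z.
  move=> d0; rewrite dvalM; [|by rewrite alg_eq0|by rewrite expf_neq0].
  by rewrite dvalX// wt (extE vw pi0 vpi)// eE natz.
apply: vge_sum_distinct => i j; rewrite !mulf_eq0 !negb_or !alg_eq0.
move=> /andP[ci0 ti] /andP[cj0 tj]; rewrite !vt// => eq.
apply: ord_inj; have := ltn_ord i; have := ltn_ord j; move: eq.
set x := v (c i); set y := v (c j).
have [->|xy] := eqVneq x y; first by lia.
have : x < y \/ y < x by lia.
by nia.
Qed.

(** The t^i with i < e form a K-basis of F: they are free because the terms of a combination have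
    distinct valuations, and they span by the expansion of integral elements. *)
Lemma ramification : e = \dim {:F}.
Proof.
pose X : e.-tuple F := [tuple t ^+ i | i < e].
have XE (i : 'I_e) : X`_i = t ^+ i by rewrite -tnth_nth tnth_mktuple.
have Xfree : free X.
  apply/freeP => c c0 i; apply/eqP; rewrite -(alg_eq0 F) -(mulIr_eq0 _ (mulIf (_ : t ^+ i != 0))).
    2: by rewrite expf_neq0.
  apply/eqP/(vge_all0 (v := w)) => m; move: i; apply: vge_expansion.
  rewrite (_ : \sum_i _ = 0) ?vge0//; rewrite -[RHS]c0.
  by apply: eq_bigr => i _; rewrite XE mulr_algl.
have Xspan : <<X>>%VS = fullv.
  apply/eqP; rewrite eqEsubv subvf /=; apply/subvP => y _.
  have [N yN] : exists N : nat, vge w 0 (pi%:A ^+ N * y).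
    exists `|w y|%N; have [->|y0] := eqVneq y 0; first by rewrite mulr0 vge0.
    rewrite vgeE ?mulf_neq0 ?expf_neq0 ?alg_eq0//.
    rewrite dvalM ?expf_neq0 ?alg_eq0// dvalX ?alg_eq0// eE.
    by have := e_gt0; nia.
  have [l _ lE] := integral_expansion yN.
  have p0 : pi%:A ^+ N != 0 :> F by rewrite expf_neq0 ?alg_eq0.
  rewrite -[y](mulKf p0) lE -exprVn -algV -(rmorphXn (in_alg F)) mulr_algl.
  apply: memvZ; apply: memv_suml => i _; rewrite mulr_algl; apply: memvZ.
  by apply: memv_span; rewrite -XE mem_nth// size_tuple.
by rewrite -Xspan; move: Xfree; rewrite /free size_tuple => /eqP.
Qed.

Lemma ext_dim c : c != 0 -> w c%:A = v c * (\dim {:F})%:Z.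
Proof. by move=> c0; rewrite (extE vw pi0 vpi)// eE ramification. Qed.

Lemma integral_expansion_dim x : vge w 0 x -> exists2 l : 'I_(\dim {:F}) -> K,
  forall i, vge v 0 (l i) & x = \sum_i (l i)%:A * t ^+ i.
Proof.
move=> /integral_expansion; rewrite ramification => -[l vl xE].
by exists (fun i => l i).
Qed.

Lemma vge_expansion_dim (m : int) (c : 'I_(\dim {:F}) -> K) :
  vge w m (\sum_i (c i)%:A * t ^+ i) -> forall i, vge w m ((c i)%:A * t ^+ i).
Proof. by move: c; rewrite -ramification; exact: vge_expansion. Qed.

Lemma expansion_dim x : exists l : 'I_(\dim {:F}) -> K, x = \sum_i (l i)%:A * t ^+ i.
Proof.
have [N yN] : exists N : nat, vge w 0 (pi%:A ^+ N * x).
  exists `|w x|%N; have [->|x0] := eqVneq x 0; first by rewrite mulr0 vge0.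
  rewrite vgeE ?mulf_neq0 ?expf_neq0 ?alg_eq0//.
  rewrite dvalM ?expf_neq0 ?alg_eq0// dvalX ?alg_eq0// eE.
  by have := e_gt0; nia.
have [l _ lE] := integral_expansion_dim yN; exists (fun i => pi ^- N * l i).
have p0 : pi%:A ^+ N != 0 :> F by rewrite expf_neq0 ?alg_eq0.
rewrite -[x](mulKf p0) lE mulr_sumr; apply: eq_bigr => i _.
by rewrite algM mulrA algV -(rmorphXn (in_alg F)).
Qed.

Lemma expansion_unique (c : 'I_(\dim {:F}) -> K) :
  \sum_i (c i)%:A * t ^+ i = 0 -> forall i, c i = 0.
Proof.
move=> c0 i; apply/eqP; rewrite -(alg_eq0 F) -(mulIr_eq0 _ (mulIf (_ : t ^+ i != 0))).
  2: by rewrite expf_neq0.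
apply/eqP/(vge_all0 (v := w)) => m; move: i; apply: vge_expansion_dim.
by rewrite c0 vge0.
Qed.

(** Multiplication by x has an integral matrix in the basis of the t^j, and the vector of the t^j is
    an eigenvector for x; so x is a root of the characteristic polynomial. *)
Lemma integral_over x : vge w 0 x -> exists2 q : {poly O}, q \is monic & ev x q = 0.
Proof.
move=> wx; pose n := \dim {:F}.
have wt_ge0 (i : nat) : vge w 0 (t ^+ i) by apply: vgeX; rewrite vgeE// wt.
have row (i : 'I_n) : exists l : 'I_n -> K, (forall j, vge v 0 (l j)) /\
    x * t ^+ i = \sum_j (l j)%:A * t ^+ j.
  have [|l vl lE] := @integral_expansion_dim (x * t ^+ i); last by exists l.
  by rewrite -[0]addr0; exact: vgeM.
have [l lP] := choice row.
pose A : 'M[O]_n := \matrix_(j, i) toO (l i j).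
exists (char_poly A); first exact: char_poly_monic.
rewrite /ev map_char_poly; apply/eqP.
change (root (char_poly (map_mx int_alg A)) x); rewrite -eigenvalue_root_char.
apply/eigenvalueP; exists (\row_j t ^+ j).
  apply/rowP => i; rewrite !mxE (lP i).2; apply: eq_bigr => j _.
  by rewrite !mxE /= toOE ?(lP i).1// mulrC.
have n0 : (0 < n)%N by rewrite adim_gt0.
apply/eqP => /rowP/(_ (Ordinal n0))/eqP; rewrite !mxE.
by rewrite expr0 oner_eq0.
Qed.

End Complete.

(** * Integral elements and splitting fields *)

Section IntegralImage.
Variables (K : fieldType) (v : dvaluation K) (F : fieldExtType K).
Variables (F' : fieldType) (w' : dvaluation F') (f : {rmorphism F -> F'}).
Hypothesis fO : forall c : K, vge v 0 c -> vge w' 0 (f c%:A).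

(** Valuation rings are integrally closed: were w'(f x) negative, the leading power would dominate
    the equation. *)
Lemma vge_integral (x : F) (q : {poly intring v}) : q \is monic ->
  ev x q = 0 -> vge w' 0 (f x).
Proof.
move=> qmonic qx; apply: contrapT => /negP/negbTE/vgePn[fx0 wfx].
have sizeq : size q = (size q).-1.+1 by rewrite prednK// size_poly_gt0 monic_neq0.
have ep : \sum_(i < (size q).-1.+1) f (int_elt q`_i)%:A * f x ^+ i = 0.
  have /(congr1 f) := qx; rewrite rmorph0 /ev.
  rewrite (@horner_coef_wide _ (size q)) ?size_poly// sizeq rmorph_sum => q0; rewrite -[RHS]q0.
  by apply: eq_bigr => i _; rewrite coef_map rmorphM rmorphXn.
move: ep; rewrite big_ord_recr /= -lead_coefE (monicP qmonic) /= scale1r rmorph1 mul1r addrC.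
move=> ep; have X0 : f x ^+ (size q).-1 != 0 by rewrite expf_neq0.
have [|] := @dval_dominant _ w' _
  (\sum_(i < (size q).-1) f (int_elt q`_i)%:A * f x ^+ i) X0; last by rewrite ep eqxx.
apply: vge_sum => i _.
apply: (@vge_le _ _ _ (0 + w' (f x ^+ i))).
  by rewrite !dvalX//; have := ltn_ord i; nia.
by apply: vgeM; [apply/fO/(valP q`_i)|exact: vge_self].
Qed.

End IntegralImage.

Lemma irreducible_factor (M : fieldType) (f : {poly M}) : (1 < size f)%N ->
  exists2 g : {poly M}, irreducible_poly g & g %| f.
Proof.
move=> f1; pose P (m : nat) := `[< exists g : {poly M}, [/\ (1 < size g)%N, g %| f & size g = m] >].
have exP : exists m, P m by exists (size f); apply/asboolP; exists f.
case: (ex_minnP exP) => m /asboolP[g [g1 gf sg]] mmin; exists g => //.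
split=> // h h1 hg; rewrite -dvdp_size_eqp// eqn_leq dvdp_leq//=; last first.
  by rewrite -size_poly_gt0 (leq_trans _ g1).
rewrite sg; apply: mmin; apply/asboolP; exists h; split=> //; last first.
  exact: dvdp_trans gf.
rewrite ltn_neqAle eq_sym h1 size_poly_gt0; apply: contraTneq hg => ->.
by rewrite dvd0p -size_poly_gt0 (leq_trans _ g1).
Qed.

(** Roots are adjoined one at a time, and the valuation is extended each time. Each extension is
    renormalized, so that integrality is compared rather than values. *)
Lemma splitting_valuation (m : nat) (M : fieldType) (w : dvaluation M) (f : {poly M}) :
  (size f <= m)%N -> f \is monic ->
  exists (F : fieldType) (w' : dvaluation F) (g : {rmorphism M -> F}),
    (forall x, vge w' 0 (g x) = vge w 0 x) /\
    exists s : seq F, map_poly g f = \prod_(a <- s) ('X - a%:P).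
Proof.
elim: m M w f => [|m IH] M w f fm fmon.
  move: fm; rewrite leqn0 size_poly_eq0 => /eqP f0.
  by rewrite f0 monicE lead_coef0 eq_sym oner_eq0 in fmon.
have [f1|f1] := leqP (size f) 1.
  exists M, w, idfun; split=> //; exists [::]; rewrite big_nil.
  have /size_poly1P[c _ fE] : size f == 1%N.
    by rewrite eqn_leq f1 size_poly_gt0 monic_neq0.
  by move: fmon; rewrite fE map_polyC monicE lead_coefC /= => /eqP ->.
have [h hirr hf] := irreducible_factor f1.
have [L _ [z rz _]] := irredp_FAdjoin hirr.
have /factor_theorem[q qE] : root (map_poly (in_alg L) f) z.
  by move/dvdpP: hf => [q ->]; rewrite rmorphM rootM rz orbT.
have fLmon : map_poly (in_alg L) f \is monic by rewrite map_monic.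
have qmon : q \is monic by rewrite -(monicMr _ (monicXsubC z)) -qE.
have [wL wwL] := valuation_extension w L.
have [|F [w' [g [gw [s sE]]]]] := IH L wL q _ qmon.
  rewrite -ltnS; apply: leq_trans fm; rewrite -(size_map_poly (in_alg L)) qE.
  by rewrite size_Mmonic ?monic_neq0 ?monicXsubC// size_XsubC addn2.
exists F, w', (g \o in_alg L); split=> [x|].
  by rewrite /= gw (ext_vge0 wwL).
exists (g z :: s); rewrite big_cons map_poly_comp qE rmorphM /= sE mulrC.
by rewrite rmorphB /= map_polyX map_polyC.
Qed.

(** * Integrality in a tensor product with a tame extension *)

Section Interpolation.
Variables (F : fieldType) (w : dvaluation F) (b : int).

(** Induction through the quotient q of c - c(x) by X - x: its values (c(y) - c(x)) / (y - x) lose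
    b, and c_j = q_(j-1) - x q_j for j > 0 gives the bound back. *)
Lemma newton_interpolation (s : seq F) (N : int) (c : {poly F}) :
  (size c <= size s)%N -> uniq s -> (forall x, x \in s -> vge w b x) ->
  (forall x y, x \in s -> y \in s -> x != y -> w (x - y) = b) ->
  (forall x, x \in s -> vge w N c.[x]) ->
  forall j, vge w (N - b * j%:Z) c`_j.
Proof.
elim: s N c => [|x s IH] N c.
  by rewrite leqn0 size_poly_eq0 => /eqP-> _ _ _ _ j; rewrite coef0 vge0.
move=> cs /= /andP[xs us] wb wd wc.
have /factor_theorem[q qE] : root (c - (c.[x])%:P) x by rewrite /root !hornerE subrr.
have cE : c = q * ('X - x%:P) + (c.[x])%:P by rewrite -qE subrK.
have sq : (size q <= size s)%N.
  have [->|q0] := eqVneq q 0; first by rewrite size_poly0.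
  have : (size (q * ('X - x%:P))%R <= (size s).+1)%N.
    rewrite -qE (leq_trans (size_polyD _ _))// geq_max cs size_polyN.
    exact: leq_trans (size_polyC_leq1 _) _.
  by rewrite size_Mmonic ?monicXsubC// size_XsubC addn2.
have qP : forall j, vge w (N - b - b * j%:Z) q`_j.
  apply: IH => // [y ys|y z ys zs|y ys].
  - by apply: wb; rewrite inE ys orbT.
  - by apply: wd; rewrite inE ?ys ?zs orbT.
  - have yx : y != x by apply: contraNneq xs => <-.
    have yx0 : y - x != 0 by rewrite subr_eq0.
    have -> : q.[y] = (c.[y] - c.[x]) / (y - x).
      by rewrite {1}cE !hornerE; field.
    apply: vgeM; first by apply: vgeB; apply: wc; rewrite inE ?eqxx ?ys ?orbT.
    rewrite -(wd y x) ?inE ?eqxx ?ys ?orbT// -dvalV//; exact: vge_self.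
move=> j; rewrite cE coefD coefC mulrBr coefB coefMX coefMC.
apply: vgeD.
  apply: vgeB.
    case: j => [|j] /=; first exact: vge0.
    by apply: vge_le (qP j); lia.
  apply: (@vge_le _ _ _ (N - b - b * j%:Z + b)); first by lia.
  by apply: vgeM => //; apply: wb; rewrite inE eqxx.
case: ifP => [/eqP->|_]; last exact: vge0.
by rewrite mulr0 subr0; apply: wc; rewrite inE eqxx.
Qed.

(** Each factor contributes at least b and the total is b times their number, which leaves no
    slack. *)
Lemma dval_prod_extremal (r : seq F) (f : F -> F) :
  (forall x, x \in r -> vge w b (f x)) -> \prod_(x <- r) f x != 0 ->
  w (\prod_(x <- r) f x) = b * (size r)%:Z ->
  forall x, x \in r -> w (f x) = b.
Proof.
have low (r' : seq F) : (forall x, x \in r' -> vge w b (f x)) -> \prod_(x <- r') f x != 0 ->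
    b * (size r')%:Z <= w (\prod_(x <- r') f x).
  elim: r' => [|x r' IH] fb; first by rewrite big_nil dval1 mulr0.
  rewrite big_cons mulf_eq0 negb_or => /andP[fx0 p0]; rewrite dvalM//.
  have := fb x; rewrite inE eqxx vgeE// => /(_ isT) bx.
  have fbr y : y \in r' -> vge w b (f y) by move=> yr; apply: fb; rewrite inE yr orbT.
  by have /= := IH fbr p0; lia.
elim: r => [|x r IH] // fb; rewrite big_cons mulf_eq0 negb_or => /andP[fx0 p0].
rewrite dvalM// => e.
have fbr y : y \in r -> vge w b (f y) by move=> yr; apply: fb; rewrite inE yr orbT.
have := fb x; rewrite inE eqxx vgeE// => /(_ isT) bx.
have := low r fbr p0 => H; rewrite /= in e.
have e1 : b * (size r).+1%:Z = b * (size r)%:Z + b by rewrite -addn1 PoszD mulrDr mulr1.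
have wx : w (f x) = b.
  move: H e bx; rewrite e1; move: (b * _) (w _) (w _) => X Y Z; lia.
move=> y; rewrite inE => /orP[/eqP->//|yr]; apply: IH => //.
by move: e; rewrite e1 wx; move: (b * _) (w _) => X Y; lia.
Qed.

End Interpolation.

(** E is K[X]/J with J contained in (f), so that evaluation at a root of the image of f factors
    through E. *)
Lemma simple_embedding (K : fieldType) (E : fieldExtType K) (z : E) (f : {poly K})
    (F : fieldType) (h : {rmorphism K -> F}) (b : F) :
  (forall x, exists P, x = (map_poly (in_alg E) P).[z]) ->
  (forall P, (map_poly (in_alg E) P).[z] = 0 -> f %| P) ->
  root (map_poly h f) b ->
  exists2 s : {rmorphism E -> F},
    forall P, s (map_poly (in_alg E) P).[z] = (map_poly h P).[b]
    & (forall c, s c%:A = h c) /\ s z = b.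
Proof.
move=> gen ker rb; have [P PE] := choice gen.
pose s x := (map_poly h (P x)).[b].
have sE Q : s (map_poly (in_alg E) Q).[z] = (map_poly h Q).[b].
  rewrite /s; set x := _.[z].
  have /ker/dvdpP[q qE] : (map_poly (in_alg E) (P x - Q)).[z] = 0.
    by rewrite rmorphB !hornerE -PE subrr.
  apply/eqP; rewrite -subr_eq0 -hornerN -hornerD -rmorphB qE rmorphM hornerM.
  by rewrite (rootP rb) mulr0.
have sD : zmod_morphism s.
  move=> x y; rewrite {1}(PE x) {1}(PE y) -hornerN -hornerD -rmorphB sE.
  by rewrite rmorphB !hornerE.
have sM : monoid_morphism s.
  split=> [|x y].
    by have := sE 1; rewrite !rmorph1 !hornerC.
  by rewrite {1}(PE x) {1}(PE y) -hornerM -rmorphM sE rmorphM hornerM.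
pose sz := GRing.isZmodMorphism.Build _ _ s sD.
pose sm := GRing.isMonoidMorphism.Build _ _ s sM.
pose s' : {rmorphism E -> F} := HB.pack s sz sm.
exists s' => //; split=> [c|].
  by have := sE c%:P; rewrite !map_polyC !hornerC.
by have := sE 'X; rewrite !map_polyX !hornerX.
Qed.

(** * Valuations under field embeddings *)

Section HomValuation.
Variables (K : fieldType) (v : dvaluation K) (hK : complete_dv v).
Variables (k : fieldType) (res : {rmorphism intring v -> k}).
Hypotheses (hres : residue_map res) (hk : GRing.closed_field_axiom k).
Variables (E : fieldExtType K) (w : dvaluation E) (vw : dv_extends v w).
Variables (pi : K) (pi0 : pi != 0) (vpi : v pi = 1).
Variables (F : fieldType) (w' : dvaluation F) (f : {rmorphism E -> F}).
Hypothesis fO : forall c : K, vge v 0 c -> vge w' 0 (f c%:A).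

(** O_E is integral over O_K, so that it is enough to control the embedding on O_K. *)
Lemma hom_integral x : vge w 0 x -> vge w' 0 (f x).
Proof.
have [t t0 wt] := dval_uniformizer w.
move=> /(integral_over hK hres hk vw pi0 vpi t0 wt)[q qmon qx].
exact: (vge_integral fO qmon qx).
Qed.

Lemma hom_unit x : x != 0 -> w x = 0 -> w' (f x) = 0.
Proof.
move=> x0 wx; have fx0 : f x != 0 by rewrite fmorph_eq0.
have : vge w' 0 (f x) by apply: hom_integral; rewrite vgeE// wx.
have : vge w' 0 (f x^-1) by apply: hom_integral; rewrite vgeE ?invr_eq0// dvalV// wx.
by rewrite fmorphV !vgeE ?invr_eq0// dvalV//; move: (w' _) => X; lia.
Qed.

(** With d = [E : K], the element x^d / pi^(w x) is a unit, as pi has valuation d in E, and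
    embeddings preserve units. The factor w'(f(pi)) accounts for the normalization of w'. *)
Lemma hom_val x : x != 0 -> w' (f x) * (\dim {:E})%:Z = w x * w' (f pi%:A).
Proof.
move=> x0; have [t t0 wt] := dval_uniformizer w.
pose y := x ^+ (\dim {:E}) * pi%:A ^ (- w x).
have p0 : pi%:A != 0 :> E by rewrite alg_eq0.
have y0 : y != 0 by rewrite mulf_neq0 ?expf_neq0 ?expfz_neq0.
have wy : w y = 0.
  rewrite dvalM ?expf_neq0 ?expfz_neq0// dvalX// dvalXz//.
  by rewrite (ext_dim hK hres hk vw pi0 vpi t0 wt)// vpi -mulr_natr natz; ring.
have := hom_unit y0 wy.
have fx0 : f x != 0 by rewrite fmorph_eq0.
have fp0 : f pi%:A != 0 by rewrite fmorph_eq0.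
rewrite rmorphM rmorphXn fmorphXz dvalM ?expf_neq0 ?expfz_neq0//.
rewrite dvalX// dvalXz// -mulr_natr natz.
by move: (w' _) (w' _) (w x) => X Y Z; lia.
Qed.

Lemma hom_pi_gt0 : (forall x, vge w' 0 (f x) = vge w 0 x) -> 0 < w' (f pi%:A).
Proof.
move=> fw; have fp0 : f pi%:A != 0 by rewrite fmorph_eq0 alg_eq0.
have : ~~ vge w' 0 (f (pi%:A)^-1).
  by rewrite fw -algV (ext_vge0 vw) vgeE ?invr_eq0// dvalV// vpi.
by rewrite fmorphV vgeE ?invr_eq0// dvalV// oppr_ge0 -ltNge.
Qed.

End HomValuation.

Section Tame.
Variables (K : fieldType) (v : dvaluation K) (hK : complete_dv v).
Variables (k : fieldType) (res : {rmorphism intring v -> k}).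
Hypotheses (hres : residue_map res) (hk : GRing.closed_field_axiom k).
Variables (pi : K) (pi0 : pi != 0) (vpi : v pi = 1).
Variables (E : fieldExtType K) (wE : dvaluation E) (vwE : dv_extends v wE).
Variables (L : fieldExtType K) (wL : dvaluation L) (vwL : dv_extends v wL).
Variables (z : E) (z0 : z != 0) (wz : wE z = 1).
Variables (t : L) (t0 : t != 0) (wt : wL t = 1).

Local Notation d := (\dim {:E}).
Local Notation n := (\dim {:L}).
Local Notation e := (vbasis {:L}).

Let d_gt0 : (0 < d)%N. Proof. exact: adim_gt0. Qed.
Let n_gt0 : (0 < n)%N. Proof. exact: adim_gt0. Qed.

Let eval (P : {poly K}) : E := (map_poly (in_alg E) P).[z].

Let evalE (P : {poly K}) (m : nat) : (size P <= m)%N -> eval P = \sum_(i < m) (P`_i)%:A * z ^+ i.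
Proof.
move=> Pm; rewrite /eval (@horner_coef_wide _ m) ?size_map_poly//.
by apply: eq_bigr => i _; rewrite coef_map.
Qed.

Let poly_of (l : 'I_d -> K) : {poly K} := \sum_i l i *: 'X^i.

Let size_poly_of l : (size (poly_of l) <= d)%N.
Proof.
apply: (leq_trans (size_sum _ _ _)); apply/bigmax_leqP => i _.
by rewrite (leq_trans (size_scale_leq _ _))// size_polyXn.
Qed.

Let coef_poly_of l (i : 'I_d) : (poly_of l)`_i = l i.
Proof.
rewrite coef_sum (bigD1 i)//= coefZ coefXn eqxx mulr1 big1 ?addr0// => j ji.
by rewrite coefZ coefXn eq_sym; case: eqP => [/val_inj e1|]; rewrite ?mulr0// e1 eqxx in ji *.
Qed.

Let eval_surj x : exists P, x = eval P.
Proof.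
have [l ->] := expansion_dim hK hres hk vwE pi0 vpi z0 wz x.
exists (poly_of l); rewrite (evalE (size_poly_of l)).
by apply: eq_bigr => i _; rewrite coef_poly_of.
Qed.

(** The Eisenstein equation of z: in the expansion of z^d each nonzero term l_i z^i has valuation d
    v(l_i) + i >= d, and i < d forces v(l_i) >= 1. *)
Lemma uniformizer_relation : exists f : {poly K},
  [/\ f \is monic, size f = d.+1, eval f = 0 & forall j, (j < d)%N -> vge v 1 f`_j].
Proof.
have [l lE] := expansion_dim hK hres hk vwE pi0 vpi z0 wz (z ^+ d).
have szl : (size (- poly_of l) < size ('X^d : {poly K}))%N.
  by rewrite size_polyN size_polyXn ltnS size_poly_of.
exists ('X^d - poly_of l); split.
- by rewrite monicE lead_coefDl// lead_coefXn.
- by rewrite size_polyDl// size_polyXn.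
- rewrite /eval rmorphB /= map_polyXn !hornerE -/(eval _) (evalE (size_poly_of l)).
  rewrite lE; apply/eqP; rewrite subr_eq0; apply/eqP; apply: eq_bigr => i _.
  by rewrite coef_poly_of.
- move=> j jd; rewrite coefB coefXn ltn_eqF// sub0r vgeN.
  rewrite -[j]/(val (Ordinal jd)) coef_poly_of.
  have : vge wE d%:Z (\sum_i (l i)%:A * z ^+ i).
    by rewrite -lE vgeE ?expf_neq0// dvalX// wz natz.
  move/(vge_expansion_dim hK hres hk vwE pi0 vpi z0 wz)/(_ (Ordinal jd)).
  have [->|l0] := eqVneq (l (Ordinal jd)) 0; first by rewrite !vge0.
  rewrite vgeE ?mulf_neq0 ?alg_eq0 ?expf_neq0// dvalM ?alg_eq0 ?expf_neq0//.
  rewrite dvalX// wz (ext_dim hK hres hk vwE pi0 vpi z0 wz)// natz vgeE//= => H.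
  by move: (v _) H => X H; have := jd; have := d_gt0; nia.
Qed.

Lemma relation_divides (f P : {poly K}) :
  f \is monic -> size f = d.+1 -> eval f = 0 -> eval P = 0 -> f %| P.
Proof.
move=> fmon sf f0 P0; have szm : (size (P %% f)%R <= d)%N.
  by rewrite -ltnS -sf ltn_modp monic_neq0.
rewrite /dvdp; have : eval (P %% f) = 0.
  move: P0; rewrite {1}(divp_eq P f) /eval rmorphD rmorphM hornerD hornerM.
  by rewrite -/(eval _) -/(eval f) f0 mulr0 add0r.
rewrite (evalE szm) => /(expansion_unique hK hres hk vwE pi0 vpi z0 wz) c0.
rewrite -size_poly_eq0 size_poly_eq0; apply/eqP/polyP => i; rewrite coef0.
have [id|di] := ltnP i d; first exact: (c0 (Ordinal id)).
by rewrite nth_default// (leq_trans szm).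
Qed.

Hypothesis d_unit : d%:R != 0 :> K /\ v d%:R = 0.

Variable T : 'I_n -> 'I_n -> K.
Hypothesis TE : forall l : 'I_n, e`_l = \sum_i (T l i)%:A * t ^+ i.

Lemma tame_upper (a : 'I_n -> E) :
  (forall (F : fieldType) (w' : dvaluation F) (f : {rmorphism E -> F})
     (g : {rmorphism L -> F}), (forall c : K, f c%:A = g c%:A) ->
     (forall x, vge wE 0 x -> vge w' 0 (f x)) ->
     vge w' 0 (\sum_l f (a l) * g e`_l)) ->
  forall i : 'I_n, vge wE (- (d * i %/ n)%N%:Z) (\sum_l a l * (T l i)%:A).
Proof.
move=> aP i.
have [f [fmon sf f0 fj]] := uniformizer_relation.
have fLmon : map_poly (in_alg L) f \is monic by rewrite map_monic.
have [F [w' [g [gw [s sE]]]]] := splitting_valuation wL (leqnn _) fLmon.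
pose gK : {rmorphism K -> F} := g \o in_alg L.
have fFE : map_poly gK f = \prod_(b <- s) ('X - b%:P) by rewrite map_poly_comp.
have ss : size s = d.
  by apply: succn_inj; rewrite -(size_prod_XsubC s id) -fFE size_map_poly.
have gO c : vge v 0 c -> vge w' 0 (g c%:A) by rewrite gw (ext_vge0 vwL).
have emb b : b \in s -> exists2 sg : {rmorphism E -> F},
    (forall c, sg c%:A = g c%:A) & sg z = b.
  move=> bs; have rb : root (map_poly gK f) b by rewrite fFE root_prod_XsubC.
  have [sg _ [sgc sgz]] := simple_embedding eval_surj
    (fun P => relation_divides fmon sf f0) rb.
  by exists sg.
pose eF := w' (g pi%:A).
have eF_gt0 : 0 < eF by exact: hom_pi_gt0 gw.
(* Each conjugate of z is the image of z under an embedding of E, so that its valuation is eF /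
   d. *)
have wb b : b \in s -> b != 0 /\ w' b * d%:Z = eF.
  move=> /emb[sg sgc <-]; rewrite fmorph_eq0 z0; split=> //.
  rewrite (hom_val hK hres hk vwE pi0 vpi (w' := w') (f := sg))// ?wz ?mul1r ?sgc//.
  by move=> c vc; rewrite sgc; exact: gO.
have : exists b0, b0 \in s.
  by case: s ss {sE fFE emb wb} => [/esym|b0 s _]; [move: d_gt0; case: (d)|exists b0; rewrite inE eqxx].
case=> b0 b0s; pose b := w' b0.
have bd : b * d%:Z = eF by have [] := wb _ b0s.
have b_gt0 : 0 < b by have := eF_gt0; rewrite -bd; have := d_gt0; nia.
have wsb x : x \in s -> w' x = b.
  move=> /wb[_]; rewrite -bd; apply: mulIf; rewrite eqz_nat -lt0n//.
have vsb x : x \in s -> vge w' b x.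
  by move=> xs; have [x0 _] := wb _ xs; rewrite vgeE// (wsb x).
have gunit c : c != 0 -> v c = 0 -> w' (g c%:A) = 0.
  move=> c0 vc; apply: (hom_unit hK hres hk vwL pi0 vpi gO); rewrite ?alg_eq0//.
  exact: (ext_unit vwL c0 vc).
have g1 c : vge v 1 c -> vge w' eF (g c%:A).
  move=> vc; have -> : c = pi * (pi^-1 * c) by rewrite mulVKf.
  rewrite algM rmorphM -[eF]addr0; apply: vgeM; first exact: vge_self.
  apply: gO; rewrite -(addNr 1); apply: vgeM => //.
  by rewrite vgeE ?invr_eq0// dvalV// vpi.
have vgeMn (N : int) (x : F) m : vge w' N x -> vge w' N (x *+ m).
  by move=> vx; elim: m => [|m IH]; [exact: vge0|rewrite mulrS; exact: vgeD].
(* By tameness the leading term d x^(d-1) dominates the derivative of the minimal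
   polynomial at its root x; so the valuation of the product of the differences
   with x attains its lower bound, and each of them has valuation b. *)
have diffs x : x \in s -> \prod_(y <- rem x s) (x - y) != 0 /\
    w' (\prod_(y <- rem x s) (x - y)) = b * (size (rem x s))%:Z.
  move=> xs; set fF := map_poly gK f in fFE *.
  have [x0 _] := wb _ xs; have wx := wsb _ xs.
  have D : fF^`().[x] = \prod_(y <- rem x s) (x - y).
    rewrite fFE (perm_big _ (perm_to_rem xs)) big_cons derivM derivXsubC mul1r.
    rewrite hornerD hornerM hornerXsubC subrr mul0r addr0 horner_prod.
    by apply: eq_bigr => y _; rewrite hornerXsubC.
  have sF : size fF = d.+1 by rewrite size_map_poly.
  have : fF^`().[x] = \sum_(j < d) gK f`_j.+1 *+ j.+1 * x ^+ j.
    rewrite (@horner_coef_wide _ d).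
      by apply: eq_bigr => j _; rewrite coef_deriv coef_map.
    by rewrite -ltnS -sF lt_size_deriv// -size_poly_gt0 sF.
  rewrite D => ->.
  have pd : (d.-1 < d)%N by rewrite ltn_predL.
  pose i0 := Ordinal pd.
  have Fi0 : gK f`_i0.+1 *+ i0.+1 * x ^+ i0 = g (d%:R)%:A * x ^+ d.-1.
    rewrite /i0 /= prednK//; congr (_ * _).
    have -> : f`_d = 1 by have := monicP fmon; rewrite lead_coefE sf.
    by rewrite -(rmorphMn gK).
  have g0 : g (d%:R)%:A != 0 by rewrite fmorph_eq0 alg_eq0 d_unit.1.
  have [|j ji|] := @dval_sum_dominant _ w' _ (fun j : 'I_d => gK f`_j.+1 *+ j.+1 * x ^+ j) i0.
  - by rewrite Fi0 mulf_neq0 ?expf_neq0.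
  - rewrite Fi0 dvalM ?expf_neq0// (gunit _ d_unit.1 d_unit.2) add0r dvalX// wx.
    have jd : (j.+1 < d)%N.
      rewrite ltn_neqAle ltn_ord andbT; apply: contraNneq ji => jd.
      by apply/eqP/val_inj/succn_inj; rewrite /= jd prednK.
    apply: (@vge_le _ _ _ (eF + w' (x ^+ j))); last first.
      by apply: vgeM; [apply/vgeMn/g1/fj|exact: vge_self].
    rewrite dvalX// wx -bd -!(mulr_natr b) !natz.
    have -> : d%:Z = d.-1%:Z + 1 by rewrite -[in LHS](prednK d_gt0) -addn1 PoszD.
    rewrite mulrDr mulr1 -addrA lerD2l ler_wpDr//.
    by rewrite mulr_ge0// ltW.
  - move=> s0 ->; split=> //.
    rewrite Fi0 dvalM ?expf_neq0// (gunit _ d_unit.1 d_unit.2) add0r dvalX// wx.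
    by rewrite size_rem// ss -mulr_natr natz.
have diff x y : x \in s -> y \in rem x s -> x - y != 0 /\ w' (x - y) = b.
  move=> xs yr; have [p0 wp] := diffs x xs.
  split; last first.
    apply: (dval_prod_extremal (f := fun y => x - y) _ p0 wp) yr => y' /mem_rem y's.
    by apply: vgeB; exact: vsb.
  apply: contraNneq p0 => xy; apply/eqP.
  by rewrite (perm_big _ (perm_to_rem yr)) big_cons xy; exact: mul0r.
have us : uniq s.
  apply: count_mem_uniq => x; have [xs|xs] := boolP (x \in s); last exact/count_memPn.
  rewrite (permP (perm_to_rem xs)) /= eqxx; congr (1 + _)%N; apply/count_memPn.
  by apply/negP => /(diff x x xs)[]; rewrite subrr eqxx.
have wdiff x y : x \in s -> y \in s -> x != y -> w' (x - y) = b.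
  by move=> xs ys xy; apply: (diff x y xs _).2; rewrite mem_rem_uniq// !inE eq_sym xy.
have [al alE] := choice (fun l => expansion_dim hK hres hk vwE pi0 vpi z0 wz (a l)).
(* The sum of the a_l (x) e_l is rewritten as the sum of the z^j (x) b_j with b_j in L. At each
   conjugate of z, the polynomial c takes the value of this tensor in F. *)
pose bj (j : 'I_d) : L := \sum_l (al l j)%:A * e`_l.
pose c : {poly F} := \sum_j g (bj j) *: 'X^j.
have sc : (size c <= size s)%N.
  rewrite ss; apply: (leq_trans (size_sum _ _ _)); apply/bigmax_leqP => j _.
  by rewrite (leq_trans (size_scale_leq _ _))// size_polyXn.
have cc (j : 'I_d) : c`_j = g (bj j).
  rewrite coef_sum (bigD1 j)//= coefZ coefXn eqxx mulr1 big1 ?addr0// => j' jj.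
  by rewrite coefZ coefXn eq_sym; case: eqP => [/val_inj e1|]; rewrite ?mulr0// e1 eqxx in jj *.
have cv x : x \in s -> vge w' 0 c.[x].
  move=> /emb[sg sgc sgz].
  have -> : c.[x] = \sum_l sg (a l) * g e`_l.
    rewrite horner_sum; under eq_bigr do rewrite hornerZ hornerXn rmorph_sum mulr_suml.
    rewrite exchange_big; apply: eq_bigr => l _ /=; rewrite (alE l) rmorph_sum mulr_suml.
    apply: eq_bigr => j _; rewrite !rmorphM rmorphXn /= sgz sgc; ring.
  apply: aP => // y; apply: (hom_integral hK hres hk vwE pi0 vpi).
  by move=> c' vc'; rewrite sgc; exact: gO.
have cj (j : 'I_d) : vge w' (- (b * j%:Z)) (g (bj j)).
  by rewrite -cc -[- _]add0r; exact: (newton_interpolation sc us vsb wdiff cv).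
pose ga (j : 'I_d) (i : 'I_n) := \sum_l al l j * T l i.
have bjE j : bj j = \sum_i (ga j i)%:A * t ^+ i.
  rewrite /bj; under eq_bigr do rewrite TE mulr_sumr.
  rewrite exchange_big; apply: eq_bigr => i' _ /=; rewrite /ga alg_sum mulr_suml.
  by apply: eq_bigr => l _; rewrite algM mulrA.
(* The bound w'(b_j) >= - b j in terms of v: it reads v([ga j i]) + i / n >= - j / d, with
   denominators cleared. *)
have gaP j i' : ga j i' != 0 ->
    - (j%:Z * n%:Z) <= (v (ga j i') * n%:Z + i'%:Z) * d%:Z.
  move=> ga0; have [b0'|bj0] := eqVneq (bj j) 0.
    move: b0'; rewrite bjE => /(expansion_unique hK hres hk vwL pi0 vpi t0 wt)/(_ i')/eqP.
    by rewrite (negbTE ga0).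
  have := cj j; rewrite vgeE ?fmorph_eq0// => H1.
  have H2 := hom_val hK hres hk vwL pi0 vpi gO bj0.
  have : vge wL (wL (bj j)) (\sum_i (ga j i)%:A * t ^+ i) by rewrite -bjE; exact: vge_self.
  move/(vge_expansion_dim hK hres hk vwL pi0 vpi t0 wt)/(_ i').
  rewrite vgeE ?mulf_neq0 ?alg_eq0 ?expf_neq0// dvalM ?alg_eq0 ?expf_neq0//.
  rewrite dvalX// wt (ext_dim hK hres hk vwL pi0 vpi t0 wt)// natz => H3.
  move: H1 H2 H3 bd b_gt0 n_gt0 d_gt0; rewrite -/eF.
  move: (w' (g _)) (wL _) (v _) => X Y Z H1 H2 H3 H4 H5 H6 H7.
  have H8 : - (j%:Z * n%:Z) <= Y * d%:Z.
    rewrite -(ler_pM2l H5); apply: (@le_trans _ _ (X * n%:Z)).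
      have -> : b * - (j%:Z * n%:Z) = - (b * j%:Z) * n%:Z by ring.
      exact: ler_wpM2r.
    suff -> : X * n%:Z = b * (Y * d%:Z) by [].
    by rewrite H2 -H4; ring.
  by apply: (le_trans H8); rewrite ler_wpM2r.
have -> : \sum_l a l * (T l i)%:A = \sum_j (ga j i)%:A * z ^+ j.
  under eq_bigr do rewrite alE mulr_suml.
  rewrite exchange_big; apply: eq_bigr => j _ /=; rewrite /ga alg_sum mulr_suml.
  by apply: eq_bigr => l _; rewrite algM; ring.
apply: vge_sum => j _; have [->|ga0] := eqVneq (ga j i) 0.
  by rewrite scale0r mul0r vge0.
rewrite vgeE ?mulf_neq0 ?alg_eq0 ?expf_neq0// dvalM ?alg_eq0 ?expf_neq0//.
rewrite dvalX// wz (ext_dim hK hres hk vwE pi0 vpi z0 wz)// natz.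
(* The valuation of [ga j i] z^j is an integer which is at least - d i / n, hence at least - floor(d
   i / n). *)
have := gaP j i ga0; have := ltn_ceil (d * i) n_gt0.
move: (v _) (d * i %/ n)%N => X Y H1 H2.
have : 0 < (X * d%:Z + j%:Z + Y%:Z + 1) * n%:Z.
  move: H1; rewrite -ltz_nat !PoszM => H1; rewrite -(ltrD2l (d%:Z * i%:Z)) addr0.
  apply: (lt_le_trans H1); rewrite -addn1 PoszD -subr_ge0.
  have -> : d%:Z * i%:Z + (X * d%:Z + j%:Z + Y%:Z + 1) * n%:Z - (Y%:Z + 1) * n%:Z =
    (X * n%:Z + i%:Z) * d%:Z - - (j%:Z * n%:Z) by ring.
  by rewrite subr_ge0.
by rewrite pmulr_lgt0 ?ltz_nat// ltzD1 -lerBlDr sub0r.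
Qed.

End Tame.

(** * The cokernel of the base change morphism *)

Section QuotientModule.
Variables (R : comNzRingType) (V : lmodType R) (I : zmodClosed V).
Hypothesis IZ : forall (c : R) x, x \in I -> c *: x \in I.

(* The phantom argument makes the module structure depend on [IZ]. *)
Definition quot_mod of (forall (c : R) x, x \in I -> c *: x \in I) : Type :=
  @Quotient.quot V I.
Local Notation Q := (quot_mod IZ).

HB.instance Definition _ := GRing.Zmodule.copy Q (@Quotient.quot V I).

Definition qpi (x : V) : Q := \pi_(@Quotient.quot V I) x.

Lemma qpi_eq x y : qpi x = qpi y <-> x - y \in I.
Proof. by rewrite Quotient.idealrBE; split=> [e|/eqP]; [exact/eqP|]. Qed.

Lemma qpi_surj (m : Q) : exists x, qpi x = m.
Proof. by exists (repr (m : @Quotient.quot V I)); rewrite /qpi reprK. Qed.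

Lemma qpiB : zmod_morphism qpi.
Proof. exact: (@pi_is_zmod_morphism V _ _ (@Quotient.quot V I)). Qed.

Definition qscale (c : R) (m : Q) : Q := qpi (c *: repr (m : @Quotient.quot V I)).

Lemma qpiZ c x : qpi (c *: x) = qscale c (qpi x).
Proof.
apply/qpi_eq; rewrite -scalerBr; apply: IZ; apply/qpi_eq.
by rewrite /qpi reprK.
Qed.

Lemma qpiD x y : qpi (x + y) = qpi x + qpi y.
Proof.
have q0 : qpi 0 = 0 by rewrite -(subrr 0) qpiB subrr.
by rewrite -[y in LHS]opprK qpiB -[- y in LHS]sub0r qpiB q0 sub0r opprK.
Qed.

Fact qscaleA a b m : qscale a (qscale b m) = qscale (a * b) m.
Proof. by have [x <-] := qpi_surj m; rewrite -!qpiZ scalerA. Qed.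
Fact qscale1 : left_id 1 qscale.
Proof. by move=> m; have [x <-] := qpi_surj m; rewrite -!qpiZ scale1r. Qed.
Fact qscaleDr : right_distributive qscale +%R.
Proof.
move=> c m m'; have [x <-] := qpi_surj m; have [y <-] := qpi_surj m'.
by rewrite -qpiD -!qpiZ scalerDr qpiD.
Qed.
Fact qscaleDl m : {morph qscale^~ m : a b / a + b}.
Proof.
by move=> a b; have [x <-] := qpi_surj m; rewrite -!qpiZ scalerDl qpiD.
Qed.

HB.instance Definition _ := GRing.Zmodule_isLmodule.Build R Q
  qscaleA qscale1 qscaleDr qscaleDl.

Fact qpi_linear : linear qpi.
Proof. by move=> c x y; rewrite qpiD qpiZ. Qed.

HB.instance Definition _ := GRing.isLinear.Build R V Q *:%R qpi qpi_linear.

End QuotientModule.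

Section Cyclics.
Variables (L : fieldType) (w : dvaluation L) (g : nat) (j : 'I_g -> nat).
Local Notation O := (intring w).

Definition multiples : {pred 'rV[O]_g} :=
  fun a => [forall i, vge w (j i) (int_elt (a 0 i))].

Fact multiples_zmod : zmod_closed multiples.
Proof.
split=> [|a b /forallP aj /forallP bj]; apply/forallP => i; rewrite mxE.
  exact: vge0.
by rewrite mxE; exact: vgeB.
Qed.
HB.instance Definition _ := GRing.isZmodClosed.Build _ multiples multiples_zmod.

Fact multiples_scale (c : O) x : x \in multiples -> c *: x \in multiples.
Proof.
move=> /forallP xj; apply/forallP => i; rewrite mxE -[(j i)%:Z]add0r.
by apply: vgeM => //; exact: (valP c).
Qed.

Definition cyclics : lmodType O := quot_mod multiples_scale.

Lemma cyclicsP : is_sum_of_cyclics j cyclics.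
Proof.
exists (@qpi _ _ _ multiples_scale); split=> [m|a]; first exact: qpi_surj.
rewrite -[0](raddf0 (@qpi _ _ _ multiples_scale)); split.
  by move=> /qpi_eq; rewrite subr0 => /forallP.
by move=> aj; apply/qpi_eq; rewrite subr0; apply/forallP.
Qed.

End Cyclics.

(** * The residue field as an algebra over the integers *)

Section ResidueAlgebra.
Variables (K : fieldType) (v : dvaluation K) (hK : complete_dv v).
Variables (k : fieldType) (res : {rmorphism intring v -> k}).
Hypotheses (hres : residue_map res) (hk : GRing.closed_field_axiom k).

Lemma field_is_field : is_field (k : comPzRingType).
Proof.
split=> [|x /eqP x0]; first by apply/eqP; rewrite oner_eq0.
by exists x^-1; rewrite divff.
Qed.

Lemma residue_algebra_base : exists2 F : algebra (intring v), is_field F &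
  forall a : intring v, vge v 1 (int_elt a) -> str F a = 0.
Proof.
exists (@Algebra (intring v) k res); first exact: field_is_field.
by move=> a /(hres.2 a).
Qed.

Variables (E : fieldExtType K) (w : dvaluation E) (vw : dv_extends v w).

(** Every element of O_E is congruent to one of O_K, whose residue does not depend on the choice;
    this makes k an O_E-algebra. *)
Lemma residue_algebra : exists2 F : algebra (intring w), is_field F &
  forall a : intring w, vge w 1 (int_elt a) -> str F a = 0.
Proof.
have [pi pi0 vpi] := dval_uniformizer v.
have [z z0 wz] := dval_uniformizer w.
have cP (a : intring w) : exists c : intring v, vge w 1 (int_elt a - (int_elt c)%:A).
  have [c vc wc] := residue_lift hres hk vw (valP a : vge w 0 (int_elt a)).
  by exists (IntRing (vc : c \in integral v)).
pose r (a : intring w) : k := res (projT1 (cid (cP a))).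
have rE a c : vge w 1 (int_elt a - (int_elt c)%:A) -> r a = res c.
  move=> wc; rewrite /r; move: (projT1 _) (projT2 (cid (cP a))) => c' wr.
  apply/eqP; rewrite -subr_eq0 -rmorphB; apply/eqP/(hres.2 _) => /=.
  have : vge w 1 (int_elt c' - int_elt c)%:A.
    have -> : (int_elt c' - int_elt c)%:A =
        (int_elt a - (int_elt c)%:A) - (int_elt a - (int_elt c')%:A).
      by rewrite scalerBl; ring.
    exact: vgeB.
  have [->|cc0] := eqVneq (int_elt c' - int_elt c) 0; first by rewrite ?scale0r !vge0.
  rewrite !vgeE ?alg_eq0// (ext_dim hK hres hk vw pi0 vpi z0 wz)//.
  by have := adim_gt0 {:E}%AS; move: (v _) => X; nia.
have rP a : exists2 c, r a = res c & vge w 1 (int_elt a - (int_elt c)%:A).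
  by have [c wc] := cP a; exists c => //; exact: rE.
have rD : zmod_morphism r.
  move=> a b; have [c -> ac] := rP a; have [d -> bd] := rP b.
  rewrite -rmorphB; apply: rE => /=.
  have -> : int_elt a - int_elt b - (int_elt c - int_elt d)%:A =
      (int_elt a - (int_elt c)%:A) - (int_elt b - (int_elt d)%:A).
    by rewrite scalerBl; ring.
  exact: vgeB.
have rM : monoid_morphism r.
  split=> [|a b].
    by rewrite -(rmorph1 res); apply: rE; rewrite /= scale1r subrr vge0.
  have [c -> ac] := rP a; have [d -> bd] := rP b.
  rewrite -rmorphM; apply: rE => /=.
  have -> : int_elt a * int_elt b - (int_elt c * int_elt d)%:A =
      (int_elt a - (int_elt c)%:A) * int_elt b +
      (int_elt c)%:A * (int_elt b - (int_elt d)%:A).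
    by rewrite algM; ring.
  apply: vgeD; first by rewrite -[1]addr0; apply: vgeM => //; exact: (valP b).
  by rewrite -[1]add0r; apply: vgeM => //; rewrite (ext_vge0 vw); exact: (valP c).
pose rz := GRing.isZmodMorphism.Build _ _ r rD.
pose rm := GRing.isMonoidMorphism.Build _ _ r rM.
pose r' : {rmorphism intring w -> k} := HB.pack r rz rm.
exists (@Algebra (intring w) k r'); first exact: field_is_field.
move=> a wa /=; rewrite -(rmorph0 res); apply: rE.
by rewrite /= scale0r subr0.
Qed.

End ResidueAlgebra.

Lemma tensor_inj_str (K : fieldType) (L : fieldExtType K) (A : algebra K) (c : K) :
  tensor_inj L (str A c) = tensor_incl A c%:A.
Proof.
by apply/rowP => l; rewrite !mxE linearZ /= rmorphM.
Qed.

Section LowerElement.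
Variables (K : fieldType) (v : dvaluation K) (hK : complete_dv v).
Variables (k : fieldType) (res : {rmorphism intring v -> k}).
Hypotheses (hres : residue_map res) (hk : GRing.closed_field_axiom k).
Variables (pi : K) (pi0 : pi != 0) (vpi : v pi = 1).
Variables (E : fieldExtType K) (wE : dvaluation E) (vwE : dv_extends v wE).
Variables (L : fieldExtType K) (wL : dvaluation L) (vwL : dv_extends v wL).
Variables (z : E) (z0 : z != 0) (wz : wE z = 1).
Variables (t : L) (t0 : t != 0) (wt : wL t = 1).

Local Notation d := (\dim {:E}).
Local Notation n := (\dim {:L}).
Local Notation phi := (in_alg E : {rmorphism K -> E}).
Local Notation B := (restr phi (base E)).
Local Notation O := (intring wE).

Let tj : {rmorphism E -> tensor L B} :=
  (@tensor_inj K L B : {rmorphism B -> tensor L B}).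

Let tj_alg (c : K) : tj c%:A = tensor_incl B c%:A.
Proof. exact: (tensor_inj_str L B c). Qed.

(* y^n = s (x) eps^i, where s = pi^i / z^(n fl) is integral and eps = t^n / pi is
   a unit. *)
Lemma lower_relation (i : nat) : exists2 q : {poly O}, q \is monic &
  \sum_(m < size q) tj (int_elt q`_m) *
    (tj (z ^- (d * i %/ n)) * tensor_incl B (t ^+ i)) ^+ m = 0.
Proof.
have n_gt0 : (0 < n)%N by exact: adim_gt0.
pose fl := (d * i %/ n)%N; set y := _ * tensor_incl B _.
pose eps := t ^+ n / pi%:A.
have eps0 : eps != 0 by rewrite mulf_neq0 ?expf_neq0 ?invr_eq0 ?alg_eq0.
have weps : vge wL 0 (eps ^+ i).
  apply: vgeX; rewrite vgeE// dvalM ?expf_neq0 ?invr_eq0 ?alg_eq0//.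
  rewrite dvalX// dvalV ?alg_eq0// wt natz.
  by rewrite (ext_dim hK hres hk vwL pi0 vpi t0 wt)// vpi mul1r subrr.
have [q qmon qe] := integral_over hK hres hk vwL pi0 vpi t0 wt weps.
pose s : E := z ^- (n * fl) * (pi ^+ i)%:A.
have si : s \in integral wE.
  rewrite integralE vgeE ?mulf_neq0 ?invr_eq0 ?expf_neq0 ?alg_eq0 ?expf_neq0//.
  rewrite dvalM ?invr_eq0 ?expf_neq0 ?alg_eq0 ?expf_neq0// dvalV ?expf_neq0//.
  rewrite dvalX// wz (ext_dim hK hres hk vwE pi0 vpi z0 wz) ?expf_neq0//.
  rewrite dvalX// vpi !natz; have := leq_trunc_div (d * i) n.
  by rewrite -/fl; lia.
pose S : O := IntRing si.
have yn : y ^+ n = tj s * tensor_incl B (eps ^+ i).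
  rewrite /y exprMn -!rmorphXn /s rmorphM -mulrA tj_alg -rmorphM; congr (_ * _).
    by rewrite exprVn -exprM mulnC.
  congr tensor_incl; rewrite -exprM mulnC exprM algX -exprMn.
  by rewrite /eps mulrCA divff ?mulr1// alg_eq0.
clearbody s; pose r := (size q).-1.
have sq : size q = r.+1 by rewrite prednK// size_poly_gt0 monic_neq0.
pose Q (m : nat) : O := int_map vwE q`_m.
(* This is S^r q(X^n / S); at y, where y^n = s eps^i, its value is s^r q(eps^i) = 0. *)
pose q' : {poly O} := \sum_(m < r.+1) (Q m * S ^+ (r - m))%:P * 'X^(n * m).
pose rest : {poly O} := \sum_(m < r) (Q m * S ^+ (r - m))%:P * 'X^(n * m).
have q'E : q' = rest + 'X^(n * r).
  rewrite /q' big_ord_recr /= subnn mulr1; congr (_ + _).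
  by rewrite /Q -[q`_r]/(lead_coef q) (monicP qmon) rmorph1 mul1r.
have sz : (size rest < size ('X^(n * r) : {poly O}))%N.
  rewrite size_polyXn ltnS; apply: (leq_trans (size_sum _ _ _)).
  apply/bigmax_leqP => m _; apply: (leq_trans (size_polyMleq _ _)).
  rewrite size_polyXn addnS /=.
  have := size_polyC_leq1 (Q m * S ^+ (r - m)); have := ltn_ord m.
  by move: (size _) => X; nia.
exists q'; first by rewrite q'E monicE lead_coefDr// lead_coefXn.
pose EO : algebra O := @Algebra O (tensor L B) (tj \o int_incl wE).
rewrite -[LHS]/(peval (y : EO) q') /q' rmorph_sum.
transitivity (tj (s ^+ r) * tensor_incl B (ev (eps ^+ i) q)); last first.
  by rewrite qe rmorph0 mulr0.
rewrite /ev (@horner_coef_wide _ (size q)) ?size_map_poly// sq.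
pose ti : {rmorphism L -> tensor L B} := @tensor_incl K L B.
rewrite -[tensor_incl B _]/(ti _) rmorph_sum mulr_sumr.
apply: eq_bigr => m _; rewrite coef_map [ti _]rmorphM rmorphXn.
rewrite (rmorphM (peval _)) (rmorphXn (peval _)) /= pevalC pevalX.
transitivity (tj ((int_elt q`_m)%:A * s ^+ (r - m)) * (tj s * ti (eps ^+ i)) ^+ m).
  rewrite exprM yn; congr (_ * _).
  rewrite -[LHS]/(tj (int_incl wE (Q m * S ^+ (r - m)))); congr (tj _).
  by rewrite rmorphM rmorphXn.
rewrite [(_ * ti _) ^+ m]exprMn [tj (_ * _)]rmorphM [tj (s ^+ _)]rmorphXn tj_alg -(rmorphXn ti).
rewrite [X in _ = X * _](_ : _ = tj s ^+ (r - m) * tj s ^+ m); last first.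
  by rewrite -exprD subnK// -ltnS.
rewrite -[tensor_incl _ (_ ^+ m)]/(ti _) -[tensor_incl _ _%:A]/(ti _).
move: (ti _) (ti _) (tj s ^+ _) (tj s ^+ _) => X Y Z W.
  by ring.
by rewrite (leq_trans (size_poly _ _))// sq.
Qed.

End LowerElement.

(** * The torus and its base change as functors of units *)

Section BaseTheta.
Variables (K : fieldType) (L : fieldExtType K).
Local Notation T := (weil_restriction (Gm L)).
Local Notation id0 := (idfun : {rmorphism K -> K}).

Let idh (A : algebra K) : algHom A (restr id0 A) :=
  @AlgHom K A (restr id0 A) idfun (fun=> erefl).
Let hid (A : algebra K) : algHom (restr id0 A) A :=
  @AlgHom K (restr id0 A) A idfun (fun=> erefl).

(* Not the identity: [restr idfun A] is not convertible to A. *)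
Definition theta0 (A : algebra K) (x : T A) : units (tensor L (restr id0 A)) :=
  units_map (@tensor_map K L _ _ (idh A)) x.

Lemma theta0E A (x : T A) l : (val (theta0 x)).1 0 l = (val (x : units (tensor L A))).1 0 l.
Proof. by rewrite /theta0 mxE. Qed.

Lemma theta0_inj A : injective (@theta0 A).
Proof.
move=> x y e; apply: (@units_inj (tensor L A)); apply/rowP => l.
have : (val (theta0 x)).1 0 l = (val (theta0 y)).1 0 l by rewrite e.
by rewrite (theta0E x) (theta0E y).
Qed.

Lemma theta0_surj A u : exists x, @theta0 A x = u.
Proof.
exists (units_map (@tensor_map K L _ _ (hid A)) u).
by apply: units_inj; apply/rowP => l; rewrite theta0E mxE.
Qed.

Lemma theta0M A : {morph @theta0 A : x y / (x * y)%g}.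
Proof.
move=> x y; apply: units_inj; apply/rowP => l; rewrite theta0E.
pose x' : units (tensor L A) := x; pose y' : units (tensor L A) := y.
etransitivity; first exact: (tensorM_coord (val x').1 (val y').1 l).
etransitivity; last exact/esym/(tensorM_coord (val (theta0 x)).1 (val (theta0 y)).1 l).
by apply: eq_bigr => i _; apply: eq_bigr => j _; rewrite !theta0E.
Qed.

Lemma theta0_nat (A B : algebra K) (f : algHom A B) x :
  theta0 (gmap f x) = units_map (@tensor_map K L _ _ (restr_hom id0 f)) (theta0 x).
Proof.
by apply: units_inj; apply/rowP => l; rewrite theta0E /= !mxE.
Qed.

End BaseTheta.

Section ExtTheta.
Variables (K : fieldType) (L : fieldExtType K) (E : fieldExtType K).
Local Notation T := (base_changeG (in_alg E) (weil_restriction (Gm L))).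
Local Notation phi := (in_alg E : {rmorphism K -> E}).

Definition theta1 (A : algebra E) (x : T A) : units (tensor L (restr phi A)) := x.

Lemma theta1_inj A : injective (@theta1 A). Proof. by []. Qed.
Lemma theta1_surj A u : exists x, @theta1 A x = u. Proof. by exists u. Qed.
Lemma theta1M A : {morph @theta1 A : x y / (x * y)%g}. Proof. by []. Qed.
Lemma theta1_nat (A B : algebra E) (f : algHom A B) x :
  theta1 (gmap f x) = units_map (@tensor_map K L _ _ (restr_hom phi f)) (theta1 x).
Proof. by apply: units_inj. Qed.

End ExtTheta.

Section Psi.
Variables (K : fieldType) (v : dvaluation K) (L : fieldExtType K).
Variables (E : fieldExtType K) (wE : dvaluation E) (vwE : dv_extends v wE).
Local Notation T := (weil_restriction (Gm L)).
Variables (N : neron_lft v T) (N' : neron_lft wE (base_changeG (in_alg E) T)).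
Variable h : nattrans (base_change (int_map vwE) (underlying N)) (underlying N').
Hypothesis hE : is_base_change_morphism h.

Local Notation phi := (in_alg E : {rmorphism K -> E}).

Let m : algHom (dual_alg K) (restr phi (dual_alg E)) := dual_hom phi.

(** The morphism h extends the identity of the generic fibre, so that it acts on tangent vectors by
    extension of scalars from K to E. *)
Lemma lie_gen_lie_map (x : N (dual_alg (intring v))) :
  lie_gen (@theta1 K L E) (lie_map h x) =
  units_map (@tensor_map K L _ _ m)
    (nr_generic N (dual_alg K) (gmap (dual_hom (int_incl v)) x)).
Proof.
rewrite /lie_gen /gpoint /theta1 /lie_map.
set y := gmap (dual_hom (int_map vwE)) x.
have -> : gmap (dual_hom (int_incl wE)) (h (dual_alg (intring wE)) y) =
    h (restr (int_incl wE) (dual_alg E))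
      (gmap (restr_hom (int_map vwE) (dual_hom (int_incl wE))) y).
  exact: esym (ntmapE h (dual_hom (int_incl wE)) y).
rewrite hE.
have -> : gmap (square_hom vwE (dual_alg E))
      (gmap (restr_hom (int_map vwE) (dual_hom (int_incl wE))) y) =
    gmap (restr_hom (int_incl v) m) (gmap (dual_hom (int_incl v)) x).
  rewrite /y; set a := square_hom _ _; set b := restr_hom _ _; set c := dual_hom _.
  rewrite -(gmap_comp (f := c) (g := b) (h := alg_comp b c))//.
  rewrite -(gmap_comp (f := alg_comp b c) (g := a) (h := alg_comp a (alg_comp b c)))//.
  exact: gmap_comp.
exact: (ntmapE (nr_generic N) m).
Qed.

End Psi.

(** * The two lattices of tangent vectors *)

Section Lattice.
Variables (K : fieldType) (v : dvaluation K) (hK : complete_dv v).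
Variables (k : fieldType) (res : {rmorphism intring v -> k}).
Hypotheses (hres : residue_map res) (hk : GRing.closed_field_axiom k).
Variables (pi : K) (pi0 : pi != 0) (vpi : v pi = 1).
Variables (L : fieldExtType K) (wL : dvaluation L) (vwL : dv_extends v wL).
Variables (t : L) (t0 : t != 0) (wt : wL t = 1).

Local Notation T := (weil_restriction (Gm L)).
Local Notation n := (\dim {:L}).
Local Notation e := (vbasis {:L}).

(** Tangent vectors have coordinates in [vbasis], while integrality is visible in the basis of the
    t^i; the inverse matrix [Tm] passes from the former coordinates to the latter. *)
Definition to_basis : 'M[K]_n := \matrix_(i, l) coord e l (t ^+ i).

Lemma basis_change : exists2 Tm : 'M[K]_n, to_basis *m Tm = 1%:M &
  forall l : 'I_n, e`_l = \sum_i (Tm l i)%:A * t ^+ i.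
Proof.
have [Tf TfE] := choice (fun l : 'I_n => expansion_dim hK hres hk vwL pi0 vpi t0 wt e`_l).
exists (\matrix_(l, i) Tf l i); last first.
  by move=> l; rewrite (TfE l); apply: eq_bigr => i _; rewrite mxE.
apply: mulmx1C; apply/matrixP => l l'; rewrite !mxE.
have -> : (l == l')%:R = coord e l' e`_l by rewrite coord_free ?(basis_free (vbasisP _)).
rewrite (TfE l) linear_sum; apply: eq_bigr => i _.
by rewrite !mxE mulr_algl linearZ.
Qed.

Variables (Tm : 'M[K]_n) (ST : to_basis *m Tm = 1%:M).
Hypothesis TmE : forall l : 'I_n, e`_l = \sum_i (Tm l i)%:A * t ^+ i.

Section Base.
Variable N : neron_lft v T.
Local Notation O := (intring v).
Local Notation eps x := (lie_eps (@theta0 K L) x).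

(** L itself, with its embeddings of K and L, serves as the test field; then n v(c_i) + i >= 0 with
    i < n forces v(c_i) >= 0. *)
Lemma base_upper (x : N (dual_alg O)) i : lie x -> vge v 0 ((eps x *m Tm) 0 i).
Proof.
move=> lx; have [F fieldF resF] := residue_algebra_base hres.
have := lie_upper (@theta0M K L) (@theta0_nat K L) fieldF resF (F' := L) (w' := wL)
  (f := in_alg L) (g := idfun) (fun c => erefl) (fun c => _) lx.
have H c : vge v 0 c -> vge wL 0 (in_alg L c) by rewrite /= (ext_vge0 vwL).
move=> /(_ H).
have -> : \sum_l in_alg L (eps x 0 l) * idfun e`_l =
    \sum_i ((eps x *m Tm) 0 i)%:A * t ^+ i.
  transitivity (\sum_l \sum_i (eps x 0 l)%:A * ((Tm l i)%:A * t ^+ i)).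
    by apply: eq_bigr => l _; rewrite [idfun _]TmE mulr_sumr.
  rewrite exchange_big; apply: eq_bigr => i' _; rewrite mxE alg_sum mulr_suml.
  by apply: eq_bigr => l _; rewrite algM mulrA.
move/(vge_expansion_dim hK hres hk vwL pi0 vpi t0 wt)/(_ i).
move: (_ 0 i) => c; have [->|c0] := eqVneq c 0; first by rewrite !vge0.
rewrite !vgeE ?mulf_neq0 ?alg_eq0 ?expf_neq0// dvalM ?alg_eq0 ?expf_neq0//.
rewrite dvalX// wt natz (ext_dim hK hres hk vwL pi0 vpi t0 wt)// => H0.
have := ltn_ord i; have := adim_gt0 {:L}%AS; move: (v c) H0 => X; nia.
Qed.

Lemma base_lower (i : 'I_n) : exists2 x : N (dual_alg O), lie x &
  eps x *m Tm = delta_mx 0 i.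
Proof.
have wti : vge wL 0 (t ^+ i) by apply: vgeX; rewrite vgeE// wt.
have [q qmon qe] := integral_over hK hres hk vwL pi0 vpi t0 wt wti.
have [|x lx xE] := lie_lower N (@theta0_inj K L) (@theta0_surj K L) (@theta0M K L)
    (@theta0_nat K L) (a := tensor_incl _ (t ^+ i)) qmon.
  set B := restr _ _.
  pose ti : {rmorphism L -> tensor L B} := @tensor_incl K L B.
  transitivity (ti (ev (t ^+ i) q)); last by rewrite qe rmorph0.
  rewrite /ev (@horner_coef_wide _ (size q)) ?size_poly// rmorph_sum.
  apply: eq_bigr => m _; rewrite coef_map [ti _]rmorphM [X in _ = _ * X](rmorphXn ti).
  by congr (_ * _); exact: (tensor_inj_str L B (int_elt q`_m)).
exists x => //; rewrite xE; apply/rowP => j.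
have /matrixP/(_ i j) := ST; rewrite !mxE eqxx /= eq_sym => <-.
by apply: eq_bigr => l _; rewrite !mxE.
Qed.

End Base.

Section Ext.
Variables (E : fieldExtType K) (wE : dvaluation E) (vwE : dv_extends v wE).
Variables (z : E) (z0 : z != 0) (wz : wE z = 1).
Local Notation d := (\dim {:E}).
Hypothesis d_unit : d%:R != 0 :> K /\ v d%:R = 0.
Variables (N : neron_lft v T) (N' : neron_lft wE (base_changeG (in_alg E) T)).
Variable h : nattrans (base_change (int_map vwE) (underlying N)) (underlying N').
Hypothesis hE : is_base_change_morphism h.

Local Notation O := (intring wE).
Local Notation phi := (in_alg E : {rmorphism K -> E}).
Local Notation eps y := (lie_eps (@theta1 K L E) y).
Local Notation lieN := (N' (dual_alg O)).

Definition djump (i : 'I_n) : nat := (d * i %/ n)%N.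

Definition lie_coord (y : lieN) : 'rV[E]_n := eps y *m map_mx phi Tm.

Lemma lie_coordE y i : lie_coord y 0 i = \sum_l eps y 0 l * (Tm l i)%:A.
Proof. by rewrite mxE; apply: eq_bigr => l _; rewrite [X in _ * X]mxE. Qed.

Lemma lie_coordD (x y : lieN) : lie x -> lie y ->
  lie_coord (x * y)%g = lie_coord x + lie_coord y.
Proof.
move=> lx ly; rewrite /lie_coord -mulmxDl.
by rewrite (lie_epsD (@theta1M K L E) (@theta1_nat K L E)).
Qed.

Lemma lie_coordZ (c : O) (x : lieN) :
  lie_coord (lie_scale c x) = int_elt c *: lie_coord x.
Proof. by rewrite /lie_coord (lie_epsZ (@theta1_nat K L E)) scalemxAl. Qed.

Lemma lie_coord1 : lie_coord 1%g = 0.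
Proof. by rewrite /lie_coord (lie_eps1 N' (@theta1M K L E) (@theta1_nat K L E)) mul0mx. Qed.

Lemma lie_coord_inj (x y : lieN) : lie x -> lie y -> lie_coord x = lie_coord y -> x = y.
Proof.
move=> lx ly xy.
apply: (lie_eps_inj (@theta1_inj K L E) (@theta1M K L E) (@theta1_nat K L E)) => //.
have TS : map_mx phi Tm *m map_mx phi to_basis = 1%:M.
  by rewrite -map_mxM (mulmx1C ST) map_mx1.
have := congr1 (mulmx^~ (map_mx phi to_basis)) xy.
by rewrite /lie_coord -!mulmxA TS !mulmx1.
Qed.

Lemma ext_upper (y : lieN) i : lie y -> vge wE (- (djump i)%:Z) (lie_coord y 0 i).
Proof.
move=> ly; have [F fieldF resF] := residue_algebra hK hres hk vwE.
rewrite lie_coordE; apply: (tame_upper hK hres hk pi0 vpi vwE vwL z0 wz t0 wt d_unit TmE).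
move=> F' w' f g fg fw.
exact: (lie_upper (@theta1M K L E) (@theta1_nat K L E) fieldF resF fg fw ly).
Qed.

Lemma ext_lower (i : 'I_n) : exists2 y : lieN, lie y &
  lie_coord y = z ^- djump i *: delta_mx 0 i.
Proof.
have [q qmon qe] := lower_relation hK hres hk pi0 vpi vwE vwL z0 wz t0 wt i.
have [y ly yE] := lie_lower N' (@theta1_inj K L E) (@theta1_surj K L E) (@theta1M K L E)
    (@theta1_nat K L E) qmon qe.
exists y => //; apply/rowP => j; rewrite lie_coordE yE [RHS]mxE mxE eqxx /=.
have /matrixP/(_ i j)/(congr1 (in_alg E)) := ST.
rewrite !mxE eq_sym rmorph_nat => <-; rewrite /= alg_sum mulr_sumr.
apply: eq_bigr => l _; rewrite [X in X * _](_ : _ = z ^- djump i * (to_basis i l)%:A).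
  by rewrite algM mulrA.
by rewrite (tensor_injM (A := restr phi (base E))) !mxE.
Qed.

(** Linear combinations over O_E. The predicate P is trivial when tangent vectors are constructed,
    and is [im_psi] when the image of psi is computed. *)
Lemma lie_combination (P : lieN -> Prop) (m : nat) (C : 'I_m -> O) (Y : 'I_m -> lieN) :
  P 1%g -> (forall c y y', lie y -> P y' -> (exists i, y = Y i) -> P (lie_scale c y * y')%g) ->
  (forall i, lie (Y i)) ->
  exists y, [/\ P y, lie y & lie_coord y = \sum_i int_elt (C i) *: lie_coord (Y i)].
Proof.
move=> P1 PD lY; elim: m C Y PD lY => [|m IH] C Y PD lY.
  exists 1%g; split=> //; first exact: lie1.
  by rewrite big_ord0 lie_coord1.
have [||y [Py ly yE]] := IH (fun i => C (lift ord0 i)) (fun i => Y (lift ord0 i)).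
- by move=> c y y' ly Py' [i yi]; apply: PD => //; exists (lift ord0 i).
- by move=> i; exact: lY.
exists (lie_scale (C ord0) (Y ord0) * y)%g; split.
- by apply: PD => //; exists ord0.
- by apply: lieM => //; exact: lieZ.
- by rewrite lie_coordD ?lie_coordZ ?yE ?big_ord_recl//; exact: lieZ.
Qed.

Lemma int_eltK (a : E) : vge wE 0 a -> int_elt (insubd (0 : O) a) = a.
Proof. by move=> wa; rewrite -[LHS]/(val _) insubdK. Qed.

Lemma ext_surj (c : 'rV[E]_n) : (forall i, vge wE (- (djump i)%:Z) (c 0 i)) ->
  exists2 y : lieN, lie y & lie_coord y = c.
Proof.
move=> cP; have ex i : exists y : lieN, lie y /\ lie_coord y = z ^- djump i *: delta_mx 0 i.
  by have [y ly yE] := ext_lower i; exists y.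
have [Y YP] := choice ex.
have [||y [_ ly yE]] := @lie_combination (fun=> True) n
   (fun i => insubd (0 : O) (c 0 i * z ^+ djump i)) Y I.
- by [].
- by move=> i; have [] := YP i.
exists y => //; rewrite yE; apply/rowP => j; rewrite summxE (bigD1 j)//= big1 ?addr0.
  have [_ ->] := YP j; rewrite int_eltK; last first.
    rewrite -(addNr (djump j)%:Z); apply: vgeM => //.
    by rewrite vgeE ?expf_neq0// dvalX// wz natz.
  by rewrite !mxE !eqxx mulr1 mulfK// expf_neq0.
by move=> i ij; have [_ ->] := YP i; rewrite !mxE eqxx /= eq_sym (negbTE ij) !mulr0.
Qed.

Lemma eps_lie_map (x : N (dual_alg (intring v))) :
  eps (lie_map h x) = map_mx phi (lie_eps (@theta0 K L) x).
Proof.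
apply/rowP => l; rewrite /lie_eps /deps (lie_gen_lie_map hE) !mxE.
by [].
Qed.

Lemma lie_lie_map (x : N (dual_alg (intring v))) : lie x -> lie (lie_map h x).
Proof.
move=> lx; apply: (lie_of_dre (@theta1_inj K L E) (@theta1M K L E) (@theta1_nat K L E)).
have /rowP x1 := lie_gen_dre (@theta0M K L) (@theta0_nat K L) lx.
apply/rowP => l; have := congr1 phi (x1 l).
rewrite /dre (lie_gen_lie_map hE) !mxE => e1; apply: etrans e1.
by [].
Qed.

Lemma im_psi_coord y : im_psi h y -> lie y /\ forall i, vge wE 0 (lie_coord y 0 i).
Proof.
elim=> [|c x {}y lx _ [ly yP]].
  by split=> [|i]; [exact: lie1|rewrite lie_coord1 mxE vge0].
have lmx := lie_lie_map lx; split=> [|i]; first by apply: lieM => //; exact: lieZ.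
rewrite lie_coordD//; last exact: lieZ.
rewrite mxE; apply: vgeD => //; rewrite lie_coordZ mxE -[0](addr0 0).
apply: vgeM; first exact: (valP c).
rewrite /lie_coord eps_lie_map -map_mxM mxE /= (ext_vge0 vwE).
exact: base_upper.
Qed.

(** Over O_K there are tangent vectors whose coordinates are the unit vectors, and their images span
    all integral coordinates. *)
Lemma coord_im_psi y : lie y -> (forall i, vge wE 0 (lie_coord y 0 i)) -> im_psi h y.
Proof.
move=> ly yP; have ex i : exists x : N (dual_alg (intring v)), lie x /\
    lie_eps (@theta0 K L) x *m Tm = delta_mx 0 i.
  by have [x lx xE] := base_lower N i; exists x.
have [X XP] := choice ex.
have [||y' [Py' ly' y'E]] := @lie_combination (im_psi h) n
   (fun i => insubd (0 : O) (lie_coord y 0 i)) (fun i => lie_map h (X i)) (im_psi0 h).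
- by move=> c _ y' _ Py' [i ->]; apply: im_psiD => //; have [] := XP i.
- by move=> i; apply: lie_lie_map; have [] := XP i.
rewrite (_ : y = y')//; apply: lie_coord_inj => //; rewrite y'E.
rewrite [LHS]row_sum_delta; apply: eq_bigr => i _; rewrite int_eltK//; congr (_ *: _).
by rewrite /lie_coord eps_lie_map -map_mxM (XP i).2 map_delta_mx.
Qed.

Lemma cokernel_psi : exists (M : lmodType O) (q : lieN -> M),
  is_coker_psi h q /\ is_sum_of_cyclics djump M.
Proof.
exists (cyclics wE djump).
(* Scaling the i-th coordinate by z^(floor(d i / n)) identifies the Lie algebra with O_E^n, and the
   image of psi with the sum of the m^(floor(d i / n)). *)
pose a y : 'rV[O]_n := \row_i insubd (0 : O) (lie_coord y 0 i * z ^+ djump i).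
have zv (i : 'I_n) : wE (z ^+ djump i) = (djump i)%:Z by rewrite dvalX// wz natz.
have aE y i : lie y -> int_elt (a y 0 i) = lie_coord y 0 i * z ^+ djump i.
  move=> ly; rewrite mxE int_eltK// -(addNr (djump i)%:Z); apply: vgeM.
    exact: ext_upper.
  by rewrite -zv; exact: vge_self.
pose pr := @qpi _ _ _ (@multiples_scale _ wE _ djump).
exists (fun y => pr (a y)); split; last exact: cyclicsP.
split=> [x y lx ly|c x lx|m|x lx].
- rewrite -qpiD; congr pr; apply/rowP => i; apply: val_inj.
  rewrite [LHS]aE; last exact: lieM.
  rewrite [in RHS]mxE; transitivity (int_elt (a x 0 i) + int_elt (a y 0 i)) => //.
  by rewrite !aE// lie_coordD// mxE mulrDl.
- transitivity (pr (c *: a x)); last exact: qpiZ.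
  congr pr; apply/rowP => i; apply: val_inj.
  rewrite [LHS]aE; last exact: lieZ.
  rewrite [in RHS]mxE; transitivity (int_elt c * int_elt (a x 0 i)) => //.
  by rewrite aE// lie_coordZ mxE mulrA.
- have [b <-] := qpi_surj m.
  have [|y ly yE] := @ext_surj (\row_i (int_elt (b 0 i) * z ^- djump i)).
    move=> i; rewrite mxE -[- _]add0r; apply: vgeM; first exact: (valP (b 0 i)).
    by rewrite vgeE ?invr_eq0 ?expf_neq0// dvalV ?expf_neq0// zv.
  exists y => //; congr pr; apply/rowP => i; apply: val_inj.
  by rewrite [LHS]aE// yE mxE divfK// expf_neq0.
- rewrite -(raddf0 pr); split=> [/qpi_eq|/im_psi_coord[_ xP]].
    rewrite subr0 => /forallP xa; apply: coord_im_psi => // i.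
    have := xa i; rewrite aE// => H.
    rewrite -[lie_coord x 0 i](mulfK (_ : z ^+ djump i != 0)) ?expf_neq0//.
    rewrite -(subrr (djump i)%:Z); apply: vgeM => //.
    by rewrite vgeE ?invr_eq0 ?expf_neq0// dvalV ?expf_neq0// zv.
  apply/qpi_eq; rewrite subr0; apply/forallP => i; rewrite aE// -[(_)%:Z]add0r.
  by apply: vgeM => //; rewrite -zv; exact: vge_self.
Qed.

End Ext.

End Lattice.

(** * The jumps *)

Section Dimension.
Variables (K : fieldType) (L : fieldExtType K).
Local Notation T := (weil_restriction (Gm L)).
Local Notation n := (\dim {:L}).
Local Notation e := (vbasis {:L}).
Local Notation id0 := (idfun : {rmorphism K -> K}).
Local Notation D := (restr id0 (dual_alg K)).

(** The element 1 + a eps. *)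
Let X (a : 'rV[K]_n) : tensor L D := \row_l (Dual (coord e l 1) (a 0 l) : dualnum K).

Let X_re a : @dre K K L id0 (X a) = 1.
Proof. by apply/rowP => l; rewrite !mxE. Qed.

Let X_eps a : @deps K K L id0 (X a) = a.
Proof. by apply/rowP => l; rewrite !mxE. Qed.

Let XD a b : X (a + b) = X a * X b.
Proof.
apply: deps_ext; first by rewrite X_re dreM !X_re mulr1.
by rewrite X_eps depsM !X_re !X_eps mul1r mulr1; exact: addrC.
Qed.

Let X0 : X 0 = 1.
Proof.
apply/rowP => l; rewrite !mxE /=; congr Dual.
Qed.

Let U_subproof a : X a * X (- a) == 1.
Proof. by rewrite -XD subrr X0. Qed.

Let U a : units (tensor L D) := exist _ (X a, X (- a)) (U_subproof a).

Lemma weil_restriction_dimension : has_dimension T n.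
Proof.
have [f fE] := choice (fun a => theta0_surj (U a)).
exists f; split=> [a b|c a|a b ab|x].
- apply: theta0_inj; rewrite theta0M !fE; apply: units_inj; exact: XD.
- apply: theta0_inj; rewrite /lie_scale theta0_nat !fE; apply: units_inj.
  by apply/rowP => l; rewrite !mxE.
- have : U a = U b by rewrite -!fE ab.
  move=> /(congr1 (fun u => @deps K K L id0 (val u).1)) /=.
  by rewrite !X_eps.
- split=> [lx|[a <-]].
    exists (deps (val (theta0 x)).1); apply: theta0_inj; rewrite fE.
    apply: units_inj; apply: deps_ext; rewrite /= ?X_eps// X_re.
    have := theta0_nat (aug_hom K) x; rewrite lx.
    move=> /(congr1 (fun u => (val u).1)) /= e1.
    apply/rowP => l; have /rowP/(_ l) := e1.
    by rewrite !mxE => ->.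
  apply: theta0_inj; rewrite theta0_nat fE; apply: units_inj.
  by apply/rowP => l; rewrite !mxE.
Qed.

End Dimension.

Section Degrees.
Variables (K : fieldType) (v : dvaluation K) (hK : complete_dv v).
Variables (k : fieldType) (res : {rmorphism intring v -> k}).
Hypotheses (hres : residue_map res) (hk : GRing.closed_field_axiom k).

(* A root z of an irreducible factor of X^m - pi satisfies m w(z) = w(pi), which is
   the degree of the extension and is at most m. *)
Lemma ramified_extension (m : nat) : (0 < m)%N ->
  exists E : fieldExtType K, \dim {:E} = m.
Proof.
move=> m0; have [pi pi0 vpi] := dval_uniformizer v.
have sf : size ('X^m - pi%:P : {poly K}) = m.+1 by rewrite size_XnsubC.
have [|g girr gf] := @irreducible_factor _ ('X^m - pi%:P : {poly K}).
  by rewrite sf ltnS.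
have [E dimE [z rz _]] := irredp_FAdjoin girr; exists E.
have zm : z ^+ m = pi%:A.
  have : root (map_poly (in_alg E) ('X^m - pi%:P)) z.
    by move/dvdpP: gf => [q ->]; rewrite rmorphM rootM rz orbT.
  rewrite /root rmorphB /= map_polyXn map_polyC !hornerE subr_eq0.
  by move/eqP.
have [w vw] := valuation_extension v E.
have [t t0 wt] := dval_uniformizer w.
have z0 : z != 0.
  apply: contraTneq pi0 => z0; rewrite negbK -(alg_eq0 E) -zm z0 expr0n.
  by rewrite gtn_eqF.
have : w (z ^+ m) = (\dim {:E})%:Z.
  by rewrite zm (ext_dim hK hres hk vw pi0 vpi t0 wt)// vpi mul1r.
rewrite dvalX// -mulr_natr natz => wz.
have dim_le : (\dim {:E} <= m)%N.
  rewrite dimE -ltnS prednK; last by rewrite size_poly_gt0 irredp_neq0.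
  by rewrite -sf dvdp_leq// -size_poly_gt0 sf.
have dim_gt0 := adim_gt0 {:E}%AS.
apply/eqP; rewrite eqn_leq dim_le /=; move: dim_gt0 wz.
move: (w z) (\dim _) => x d d0 xm; rewrite -lez_nat -xm ler_peMl//; nia.
Qed.

Lemma ahom_dim_le (E1 E2 : fieldExtType K) : 'AHom(E1, E2) -> (\dim {:E1} <= \dim {:E2})%N.
Proof.
move=> f; have /limg_dim_eq <- : (fullv :&: lker f)%VS = 0%VS.
  by apply/eqP; rewrite (eqP (AHom_lker0 f)) capv0.
exact/dimvS/subvf.
Qed.

End Degrees.

Section JumpData.
Variables (K : fieldType) (v : dvaluation K) (hK : complete_dv v).
Variables (p : nat) (k : fieldType) (res : {rmorphism intring v -> k}).
Hypotheses (hres : residue_map res) (hk : GRing.closed_field_axiom k).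
Hypothesis hp : p \in [pchar k].
Variables (L : fieldExtType K) (D : jump_data v p (weil_restriction (Gm L))).

Local Notation n := (\dim {:L}).

(** The residue field has characteristic p, so that d is nonzero in it. *)
Lemma coprime_unit (d : nat) : coprime p d -> d%:R != 0 :> K /\ v d%:R = 0.
Proof.
move=> pd; have resd : res d%:R <> 0.
  rewrite rmorph_nat => /eqP; rewrite -(dvdn_pcharf hp) => pdvd.
  by have := prime_coprime d (pcharf_prime hp); rewrite pd pdvd.
have eltd : int_elt (d%:R : intring v) = d%:R by rewrite -(rmorph_nat (int_incl v)).
have : ~~ vge v 1 d%:R by apply/negP => vd; apply: resd; apply/(hres.2 _); rewrite eltd.
have : vge v 0 d%:R by rewrite -eltd; exact: (valP (d%:R : intring v)).
have [->|d0] := eqVneq (d%:R : K) 0; first by rewrite !vge0.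
by rewrite !vgeE//; move: (v _) => x; lia.
Qed.

Lemma djumps_weil_restriction (m : nat) :
  is_djumps D m (fun i : 'I_n => degree D m * i %/ n)%N.
Proof.
split=> [a b ab|]; first by rewrite leq_div2r// leq_mul2l ab orbT.
have [pi pi0 vpi] := dval_uniformizer v.
have [wL vwL] := valuation_extension v L.
have [t t0 wt] := dval_uniformizer wL.
have [z z0 wz] := dval_uniformizer (jd_val D m).
have [Tm ST TmE] := basis_change hK hres hk pi0 vpi vwL t0 wt.
exact: (cokernel_psi hK hres hk pi0 vpi vwL t0 wt ST TmE z0 wz
  (coprime_unit (jd_tame D m)) (@jd_homE _ _ _ _ D m)).
Qed.

Lemma degree_unbounded (B : nat) : exists M, forall m, (M <= m)%N -> (B <= degree D m)%N.
Proof.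
have p_gt1 := prime_gt1 (pcharf_prime hp).
(* The degree p B + 1 is prime to p and at least B. *)
have [E dimE] := ramified_extension hK hres hk (ltn0Sn (p * B)).
have [|M [f]] := @jd_cofinal _ _ _ _ D E.
  by rewrite dimE -addn1 mulnC /coprime gcdnMDl gcdn1.
exists M => m Mm; apply: (@leq_trans (degree D M)).
  apply: leq_trans (ahom_dim_le f); rewrite dimE ltnW// ltnS leq_pmull//.
  exact: ltnW.
rewrite -(subnK Mm); elim: (m - M)%N => // j IH; apply: leq_trans IH _.
by have [g] := jd_tower D (j + M); exact: ahom_dim_le g.
Qed.

Lemma jumps_weil_restriction (R : realType) :
  is_jumps D (fun i : 'I_n => i%:R / n%:R : R).
Proof.
split; first exact: weil_restriction_dimension.
exists (fun m i => degree D m * i %/ n)%N; split=> [m|i].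
  exact: djumps_weil_restriction.
have n_gt0 : (0 < n)%N by exact: adim_gt0.
have nR : 0 < n%:R :> R by rewrite ltr0n.
apply/cvgrPdist_le => eps eps0.
have [M MP] := degree_unbounded (Num.truncn eps^-1).+1.
exists M => // m /= /MP dm.
have d_gt0 : (0 < degree D m)%N by apply: leq_trans dm.
have dR : 0 < (degree D m)%:R :> R by rewrite ltr0n.
(* The distance between floor(d i / n) / d and i / n is at most 1 / d. *)
have deps : (degree D m)%:R^-1 <= eps.
  rewrite invf_ple ?posrE//; apply: (@le_trans _ _ (Num.truncn eps^-1).+1%:R).
    by apply: ltW; exact: truncnS_gt.
  by rewrite ler_nat.
set d := degree D m in dm d_gt0 dR deps *; set q := (d * i %/ n)%N.
have lo : (q * n)%:R <= (d * i)%:R :> R by rewrite ler_nat leq_trunc_div.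
have hi : (d * i)%:R <= (q.+1 * n)%:R :> R by rewrite ler_nat ltnW// ltn_ceil.
apply: le_trans deps; rewrite ler_norml; apply/andP; split.
  apply: (@le_trans _ _ 0); first by rewrite oppr_le0 invr_ge0 ltW.
  rewrite subr_ge0 ler_pdivrMr// mulrAC ler_pdivlMr// -!natrM.
  by rewrite (mulnC i).
rewrite lerBlDr -[X in X + _]div1r -mulrDl ler_pdivrMr// mulrAC ler_pdivlMr//.
by rewrite mulrC addrC natr1 -!natrM.
Qed.

End JumpData.

Lemma sum_fractions (R : numFieldType) (m : nat) : (0 < m)%N ->
  \sum_(i < m) (i%:R / m%:R : R) = (m%:R - 1) / 2.
Proof.
move=> m0; have mR : m%:R != 0 :> R by rewrite pnatr_eq0 -lt0n.
have S : \sum_(i < m) (i%:R : R) * 2 = m%:R * (m%:R - 1).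
  elim: m {m0 mR} => [|m IH]; first by rewrite big_ord0 mul0r.
  by rewrite big_ord_recr /= IH -natr1; ring.
move: S; rewrite -!mulr_suml => S.
have two : 2 != 0 :> R by rewrite pnatr_eq0.
by rewrite -[X in X / _](mulfK two) S; field.
Qed.

Theorem corollary2p6
  (R : realType)
  (K : fieldType) (v : dvaluation K) (hK : complete_dv v)
  (p : nat) (k : fieldType) (res : {rmorphism intring v -> k})
  (hres : residue_map res) (hk : GRing.closed_field_axiom k) (hp : p \in [pchar k])
  (hH : henselian res)
  (L : fieldExtType K) (hL : separable 1%VS {:L})
  (D : jump_data v p (weil_restriction (Gm L))) :
  is_jumps D (fun i : 'I_(\dim {:L}) => i%:R / (\dim {:L})%:R : R) /\
  is_ctame D (((\dim {:L})%:R - 1) / 2 : R).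
Proof.
have jumps := jumps_weil_restriction hK hres hk hp D R.
split=> //; exists (\dim {:L}), (fun i => i%:R / (\dim {:L})%:R); split=> //.
by rewrite sum_fractions// adim_gt0.
Qed.
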